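(* Let $u\in\mathcal W_{u^0}$ be the solution of the primal problem (P), let $u_\tau=\{u_k\}_{k=0}^N$ be the solution of the time-discrete primal problem (P$_\tau$), let $u_{\tau h}=\{u_k^h\}_{k=0}^N$ be the solution of the fully discrete primal problem (P$_{\tau h}$), let $z\in\mathcal W^{\bar q}$ be the solution of the mean-value-linearized dual problem (D) with $\hat u=Iu_{\tau h}$, and let $z_\tau=\{z_k\}_{k=0}^N$, $z_k\in\mathcal V$, be the solution of the time-discrete dual problem (D$_\tau$) (all problems as in the context). Then $$\mathcal Q(u)-\mathcal Q(Iu_{\tau h})=\mathcal R_{\mathrm s}(u_{\tau h};z_\tau-v_\tau^h)+\mathcal R_{\mathrm t}(u_{\tau h},u_\tau,z,z_\tau)+\operatorname{Osc}$$ for any $v_\tau^h=\{v_k^h\}_{k=0}^N$ with $v_k^h\in\mathcal S_k^{h,p}$, where the spatial error representation is $$\mathcal R_{\mathrm s}(u_{\tau h};z_\tau-v_\tau^h):=(u^0-u_0^h,z_0-v_0^h)+\sum_{k=1}^N\tau_k\langle r_h^k,z_k-v_k^h\rangle,$$ the temporal error representation is $$\mathcal R_{\mathrm t}(u_{\tau h},u_\tau,z,z_\tau):=(u^0-u_0^h,z(0)-z_0)+\sum_{k=0}^{N-1}\int_{t_k}^{t_{k+1}}\Big\{\mathcal R_{\mathrm{PDE}}\big(Iu_{\tau h}(t);z(t)-z_{k+1}\big)+\langle r_\tau^{k+1}(t),z_{k+1}\rangle\Big\}\,dt,$$ and the data-oscillation contribution is $$\operatorname{Osc}:=\sum_{k=0}^{N-1}\int_{t_k}^{t_{k+1}}\langle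 r_f^{k+1}(t),z_{k+1}\rangle\,dt.$$
   Context: Setting. $\Omega\subset\mathbb R^d$, $d\in\{1,2,3\}$, is bounded, $T>0$; $\mathcal V$ is a Hilbert space with dual $\mathcal V^*$ and $\mathcal V\subset L^2(\Omega)\subset\mathcal V^*$ with continuous embeddings; $(\cdot,\cdot)$ is the $L^2(\Omega)$ inner product and $\langle\cdot,\cdot\rangle$ the $\mathcal V^*$–$\mathcal V$ duality pairing. $\mathcal W:=\{v\in L^2(0,T;\mathcal V):\partial_tv\in L^2(0,T;\mathcal V^* )\}$, $\mathcal W_{u^0}:=\{v\in\mathcal W:v(0)=u^0\}$, $\mathcal W^{\bar q}:=\{v\in\mathcal W:v(T)=\bar q\}$. $\mathcal B(\cdot,\cdot)$ is the (symmetric) bilinear form on $\mathcal V$ of an elliptic self-adjoint operator. $\mathcal N(\cdot;\cdot)$ is the semilinear form of a sufficiently smooth nonlinear operator, linear in the argument after the semicolon, split as $\mathcal N(u;v)=\mathcal N_c(u;v)-\mathcal N_e(u;v)$, with $\mathcal N_c,\mathcal N_e$ of the same kind; $\mathcal N_e(\cdot;\cdot)$ is bounded on $L^2(\Omega)\times L^2(\Omega)$ and sufficiently smooth there, so that its terms at the initial time, where $u_0\in L^2(\Omega)$, are well defined. Data: $u^0\in L^2(\Omega)$, $f\in L^2(0,T;\mathcal V^* )$. Mean-value linearization. For $\mathcal M\in\{\mathcal N,\mathcal N_c,\mathcal N_e\}$, $\mathcal M^s(u,\hat u;w,v):=\int_0^1\mathcal M'(su+(1-s)\hat u)(w,v)\,ds$,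 where $\mathcal M'(\hat w)(w,v)=\lim_{s\to0}\frac{\mathcal M(\hat w+sw;v)-\mathcal M(\hat w;v)}{s}$ is the Gâteaux derivative; by the chain rule $\mathcal M^s(u,\hat u;u-\hat u,v)=\mathcal M(u;v)-\mathcal M(\hat u;v)$. Problem (P): $u\in\mathcal W_{u^0}$ with $\int_0^T(\langle\partial_tu,v\rangle+\mathcal B(u,v)+\mathcal N(u;v))\,dt=\int_0^T\langle f,v\rangle\,dt$ for all $v\in L^2(0,T;\mathcal V)$. Quantity of interest: $\mathcal Q(u):=(\bar q,u(T))+\int_0^T(q,u)\,dt$ with $\bar q\in L^2(\Omega)$, $q\in L^2(0,T;L^2(\Omega))$. Problem (D): $z\in\mathcal W^{\bar q}$ with $\int_0^T(\langle-\partial_tz,w\rangle+\mathcal B(z,w)+\mathcal N^s(u,\hat u;w,z))\,dt=\int_0^T(q,w)\,dt$ for all $w\in L^2(0,T;\mathcal V)$. Discretization. $0=t_0<t_1<\dots<t_N=T$, $\mathcal I_{k+1}=[t_k,t_{k+1}]$, $\tau_{k+1}=t_{k+1}-t_k$. $f_{k+1}=f(\cdot,t_{k+1})$ (with $f$ regular enough, e.g. $f\in C^0((0,T];L^2(\Omega))$), or alternatively $f_{k+1}=\frac1{\tau_{k+1}}\int_{t_k}^{t_{k+1}}f\,dt$ with $f\in L^2(0,T;L^2(\Omega))$. For $k=0,\dots,N$, $\mathcal S_k^{h,p}\subset\mathcal V$ is the conforming finite element space of functions in $\mathcal V$ that are polynomials of order up to $p$ on each element of a shape-regular mesh $\mathcal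 K_k$ of $\Omega$ (the mesh may depend on $k$). Problem (P$_\tau$): $u_0\in L^2(\Omega)$ with $(u_0,v)=(u^0,v)$ for all $v\in L^2(\Omega)$, and for $k=0,\dots,N-1$, $u_{k+1}\in\mathcal V$ with $\big(\frac{u_{k+1}-u_k}{\tau_{k+1}},v\big)+\mathcal B(u_{k+1},v)+\mathcal N_c(u_{k+1};v)-\mathcal N_e(u_k;v)=(f_{k+1},v)$ for all $v\in\mathcal V$. Problem (P$_{\tau h}$): $u_0^h\in\mathcal S_0^{h,p}$ with $(u_0^h,v^h)=(u^0,v^h)$ for all $v^h\in\mathcal S_0^{h,p}$, and for $k=0,\dots,N-1$, $u_{k+1}^h\in\mathcal S_{k+1}^{h,p}$ with $\big(\frac{u_{k+1}^h-u_k^h}{\tau_{k+1}},v^h\big)+\mathcal B(u_{k+1}^h,v^h)+\mathcal N_c(u_{k+1}^h;v^h)-\mathcal N_e(u_k^h;v^h)=(f_{k+1},v^h)$ for all $v^h\in\mathcal S_{k+1}^{h,p}$. Solutions of (P$_\tau$) and (P$_{\tau h}$) are assumed to exist. Time reconstruction: for a sequence $w_\tau=\{w_k\}_{k=0}^N$, $Iw_\tau(t)=\frac{t_{k+1}-t}{\tau_{k+1}}w_k+\frac{t-t_k}{\tau_{k+1}}w_{k+1}$ for $t\in[t_k,t_{k+1}]$. Let $\mathbf N_k$ be the continuous piecewise-linear hat function in time on the partition with $\mathbf N_k(t_j)=\delta_{jk}$. Set $q_k=\frac1{\tau_k}\int_0^Tq\,\mathbf N_k(t)\,dt$ for $k=1,\dots,N$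 and $q_0=\frac1{\tau_1}\int_0^Tq\,\mathbf N_0(t)\,dt$. Problem (D$_\tau$) (solved backwards): $z_k\in\mathcal V$, $k=0,\dots,N$, with, for all $w\in\mathcal V$: terminal condition $(z_N,w)+\tau_N\mathcal B(z_N,w)+\tau_N\mathcal N_c^s(u_N,u_N^h;w,z_N)=\tau_N(q_N,w)+(\bar q,w)$; for $k=1,\dots,N-1$: $-\big(\frac{z_{k+1}-z_k}{\tau_k},w\big)+\mathcal B(z_k,w)+\mathcal N_c^s(u_k,u_k^h;w,z_k)-\frac{\tau_{k+1}}{\tau_k}\mathcal N_e^s(u_k,u_k^h;w,z_{k+1})=(q_k,w)$; and $-\big(\frac{z_1-z_0}{\tau_1},w\big)-\mathcal N_e^s(u_0,u_0^h;w,z_1)=(q_0,w)$. Residuals. $\mathcal R_{\mathrm{PDE}}(\hat u(t);v):=\langle f(t),v\rangle-\langle\partial_t\hat u(t),v\rangle-\mathcal B(\hat u(t),v)-\mathcal N(\hat u(t);v)$. For $k=0,\dots,N-1$, $v\in\mathcal V$, $t\in(t_k,t_{k+1}]$: $\langle r_h^{k+1},v\rangle:=(f_{k+1},v)-\big(\frac{u_{k+1}^h-u_k^h}{\tau_{k+1}},v\big)-\mathcal B(u_{k+1}^h,v)-\mathcal N_c(u_{k+1}^h;v)+\mathcal N_e(u_k^h;v)$; $\langle r_\tau^{k+1}(t),v\rangle:=\mathcal B(u_{k+1}^h,v)+\mathcal N_c(u_{k+1}^h;v)-\mathcal N_e(u_k^h;v)-\mathcal B(Iu_{\tau h}(t),v)-\mathcal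 N(Iu_{\tau h}(t);v)$; $\langle r_f^{k+1}(t),v\rangle:=\langle f(t)-f_{k+1},v\rangle$. *)

(* Defs.v *)
From HB Require Import structures.
From mathcomp Require Import all_boot all_order all_algebra generic_quotient ring_quotient.
From mathcomp Require Import all_classical all_reals all_analysis.
From mathcomp Require Import measurable_realfun.

Set Implicit Arguments.
Unset Strict Implicit.
Unset Printing Implicit Defensive.

Import Order.TTheory GRing.Theory Num.Theory.
Import numFieldNormedType.Exports.

Local Open Scope classical_set_scope.
Local Open Scope ring_scope.

(* R^n is the type of n-tuples with the product sigma-algebra. *)
Notation Rn R n := (n.-tuple (measurableTypeR R)).

Section lebesgue_tuple.
Context (R : realType).

Local Notation Rn n := (Rn R n).

Definition Rn_cons n (x : measurableTypeR R * Rn n) : Rn n.+1 :=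
  [the n.+1.-tuple _ of x.1 :: x.2].

Lemma measurable_Rn_cons n : measurable_fun setT (@Rn_cons n).
Proof. exact: measurable_cons. Qed.

Section step.
Context n (m : {sigma_finite_measure set (Rn n) -> \bar R}).

Definition lebesgue_cons : set (Rn n.+1) -> \bar R :=
  pushforward (lebesgue_measure \x m)%E (@Rn_cons n).

Let cons0 : lebesgue_cons set0 = 0%E.
Proof. by rewrite /lebesgue_cons /pushforward preimage_set0 measure0. Qed.

Let cons_ge0 A : (0 <= lebesgue_cons A)%E.
Proof. by rewrite /lebesgue_cons /pushforward. Qed.

Let cons_sigma_additive : semi_sigma_additive lebesgue_cons.
Proof.
have mf (A : set (Rn n.+1)) : measurable A -> measurable (@Rn_cons n @^-1` A).
  by move=> mA; rewrite -[X in measurable X]setTI; exact: measurable_Rn_cons.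
move=> F mF tF mUF; rewrite /lebesgue_cons /pushforward preimage_bigcup.
apply: measure_semi_sigma_additive.
- by move=> k; exact: mf.
- apply/trivIsetP => /= i j _ _ ij; rewrite -preimage_setI.
  by move/trivIsetP : tF => /(_ _ _ _ _ ij) ->//; rewrite preimage_set0.
- by rewrite -preimage_bigcup; exact: mf.
Qed.

HB.instance Definition _ := isMeasure.Build _ _ _
  lebesgue_cons cons0 cons_ge0 cons_sigma_additive.

Let cons_sigma_finite : sigma_finite setT lebesgue_cons.
Proof.
have [F FT Foo] : sigma_finite setT (lebesgue_measure \x m)%E.
  have /sigma_finiteP[F [TF ndF Foo]] := sigma_finiteT (@lebesgue_measure R).
  have /sigma_finiteP[G [TG ndG Goo]] := sigma_finiteT m.
  exists (fun n => F n `*` G n).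
    rewrite -setXTT TF TG predeqE => -[x y]; split.
      move=> [/= [i _ Fnx] [k _ Gky]]; exists (maxn i k) => //; split.
      - by move: x Fnx; exact/subsetPset/ndF/leq_maxl.
      - by move: y Gky; exact/subsetPset/ndG/leq_maxr.
    by move=> [i _ []/= ? ?]; split; exists i.
  move=> k; have [? ?] := Foo k; have [? ?] := Goo k.
  split; first exact: measurableX.
  by rewrite product_measure1E// lte_mul_pinfty// ge0_fin_numE.
pose uncons (x : Rn n.+1) : measurableTypeR R * Rn n := (thead x, [tuple of behead x]).
have munc : measurable_fun setT uncons.
  apply/measurable_fun_pairP; split; first exact: (measurable_tnth ord0).
  exact: measurable_behead.
have unconsK x : uncons (Rn_cons x) = x.
  by case: x => x t; rewrite /uncons theadE; congr pair; exact/val_inj.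
exists (fun k => uncons @^-1` (F k)).
  by rewrite -preimage_bigcup -FT preimage_setT.
move=> k; have [mFk Fkoo] := Foo k; split.
  by rewrite -[X in measurable X]setTI; exact: munc.
rewrite /lebesgue_cons /pushforward -comp_preimage.
by rewrite (_ : _ \o _ = id) ?preimage_id//; apply/funext.
Qed.

HB.instance Definition _ := Measure_isSigmaFinite.Build _ _ _
  lebesgue_cons cons_sigma_finite.

End step.

(* The n-fold product of the one-dimensional Lebesgue measure. *)
Fixpoint lebesgue_Rn n : {sigma_finite_measure set (Rn n) -> \bar R} :=
  match n with
  | 0 => \d_([tuple] : Rn 0)
  | k.+1 => lebesgue_cons (lebesgue_Rn k)
  end.
End lebesgue_tuple.

(* L2 mu is the quotient of the library's square-integrable functions by
   almost-everywhere equality, with its L^2 norm. *)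
Section L2.
Context d (T : measurableType d) (R : realType) (mu : {measure set T -> \bar R}).

Lemma le1_2 : (1 <= (2 : R)%:E)%E.
Proof. by rewrite lee_fin ler1n. Qed.

Definition sqfun := LfunType mu le1_2.
HB.instance Definition _ := GRing.Lmodule.on sqfun.

Definition ae_null : {pred sqfun} := fun f => `[< {ae mu, forall x, f x = 0} >].

Lemma ae_nullP (f : sqfun) : reflect {ae mu, forall x, f x = 0} (f \in ae_null).
Proof. exact: asboolP. Qed.

Lemma ae_null_zmod_closed : zmod_closed ae_null.
Proof.
split=> [|f g /ae_nullP f0 /ae_nullP g0]; apply/ae_nullP.
  exact: nearW.
apply: filterS2 f0 g0 => x fx gx.
by rewrite (_ : (f - g) x = f x - g x)// fx gx subr0.
Qed.
HB.instance Definition _ := GRing.isZmodClosed.Build sqfun ae_null ae_null_zmod_closed.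

Definition L2 : Type := @Quotient.quot sqfun ae_null.
HB.instance Definition _ := GRing.Zmodule.on L2.
HB.instance Definition _ := EqQuotient.on L2.

Definition L2class (f : sqfun) : L2 := \pi_(@Quotient.quot sqfun ae_null)%qT f.
Definition L2fun (f : L2) : sqfun := repr (f : @Quotient.quot sqfun ae_null).

Lemma L2funK f : L2class (L2fun f) = f. Proof. exact: reprK. Qed.

Lemma L2classP (f g : sqfun) :
  L2class f = L2class g <-> {ae mu, forall x, f x = g x}.
Proof.
split=> [/eqP|fg].
  rewrite /L2class -Quotient.idealrBE => /ae_nullP; apply: filterS => x.
  by rewrite (_ : (f - g) x = f x - g x)// => /eqP; rewrite subr_eq0 => /eqP.
apply/eqP; rewrite /L2class -Quotient.idealrBE; apply/ae_nullP.
by apply: filterS fg => x fgx; rewrite (_ : (f - g) x = f x - g x)// fgx subrr.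
Qed.

Lemma L2classD f g : L2class (f + g) = L2class f + L2class g.
Proof. exact: Quotient.pi_add. Qed.

Lemma L2class_repr f : {ae mu, forall x, L2fun (L2class f) x = f x}.
Proof. by apply/L2classP; rewrite L2funK. Qed.

Definition L2scale (a : R) (f : L2) : L2 := L2class (a *: L2fun f).

Lemma L2classZ a f : L2class (a *: f) = L2scale a (L2class f).
Proof.
apply/L2classP; have := L2class_repr f.
apply: filterS => x fx.
by rewrite (_ : (a *: f) x = a * f x)// (_ : (_ *: L2fun _) x = a * L2fun (L2class f) x)// fx.
Qed.

Let L2scaleA a b f : L2scale a (L2scale b f) = L2scale (a * b) f.
Proof. by rewrite -(L2funK f) -!L2classZ scalerA. Qed.
Let L2scale1 : left_id 1 L2scale.
Proof. by move=> f; rewrite -(L2funK f) -L2classZ scale1r. Qed.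
Let L2scaleDr : right_distributive L2scale +%R.
Proof.
by move=> a f g; rewrite -(L2funK f) -(L2funK g) -L2classD -!L2classZ -L2classD scalerDr.
Qed.
Let L2scaleDl f : {morph L2scale^~ f : a b / a + b}.
Proof. by move=> a b; rewrite -(L2funK f) -!L2classZ -L2classD scalerDl. Qed.

HB.instance Definition _ := GRing.Zmodule_isLmodule.Build R L2
  L2scaleA L2scale1 L2scaleDr L2scaleDl.

Definition L2norm (f : L2) : R := fine ('N[mu]_2%:E[EFin \o L2fun f])%E.

Lemma L2norm_class (f : sqfun) :
  L2norm (L2class f) = fine ('N[mu]_2%:E[EFin \o f])%E.
Proof.
rewrite /L2norm unlock; congr (fine (_ `^ _)%E).
have mpow (g : sqfun) : measurable_fun setT (fun x => `|(EFin \o g) x| `^ 2)%E.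
  apply: (measurableT_comp (measurable_poweR _)) => //.
  by apply: measurableT_comp => //; exact/measurable_EFinP.
apply: ae_eq_integral; [exact: measurableT|exact: mpow|exact: mpow|].
by apply: filterS (L2class_repr f) => x fx _ /=; rewrite fx.
Qed.

Let L2normD (f g : L2) : L2norm (f + g) <= L2norm f + L2norm g.
Proof.
rewrite -(L2funK f) -(L2funK g) -L2classD !L2norm_class; exact: ler_LnormD.
Qed.

Let L2normZ (a : R) (f : L2) : L2norm (a *: f) = `|a| * L2norm f.
Proof.
rewrite -(L2funK f) -[a *: _]L2classZ !L2norm_class.
by rewrite -[LHS]/(fine 'N[mu]_2%:E[EFin \o (a \*: L2fun f)])%E LnormZ fineM// -finite_norm_fine.
Qed.

Let L2norm_eq0 (f : L2) : L2norm f = 0 -> f = 0.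
Proof.
move=> /fine_Lnormr_eq0 f0; rewrite -(L2funK f).
have -> : 0 = L2class 0 by rewrite -[0 in RHS](subrr (L2fun f)) /L2class raddfB subrr.
by apply/L2classP; apply: filterS f0 => x; apply.
Qed.

HB.instance Definition _ := Lmodule_isNormed.Build R L2 L2normD L2normZ L2norm_eq0.

Definition L2dot (f g : L2) : R := \int[mu]_x (L2fun f x * L2fun g x).

End L2.

(* L^2(Om), for mOm : measurable Om with Om a set of R^n *)
Notation L2_on mOm := (L2 (mrestr (lebesgue_Rn _ _) mOm)).

(* The topological dual, with the operator norm. *)
Section dual_space.
Context (R : realType) (E : normedModType R).

Definition dual_pred : {pred E -> R^o} :=
  fun F => `[< linear F /\ continuous F >].

Lemma dual_submod_closed : submod_closed dual_pred.
Proof.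
split=> [|a F G /asboolP[lF cF] /asboolP[lG cG]]; apply/asboolP; split.
- by move=> a x y /=; rewrite /GRing.zero /= scaler0 addr0.
- exact: cst_continuous.
- move=> b x y; rewrite -[LHS]/(a *: F (b *: x + y) + G (b *: x + y)).
  rewrite -[RHS]/(b *: (a *: F x + G x) + (a *: F y + G y)) lF lG.
  by rewrite !scalerDr !scalerA [a * b]mulrC !addrA; congr (_ + _); rewrite addrAC.
- move=> x; apply: (@continuousD _ R^o E (a \*: F) G x); last exact: cG.
  by apply: continuousZ; [exact: cst_continuous|exact: cF].
Qed.
HB.instance Definition _ := GRing.isSubmodClosed.Build _ _ dual_pred dual_submod_closed.

Record topdual : Type := Dual { dual_fun :> E -> R^o; _ : dual_fun \in dual_pred }.
HB.instance Definition _ := [isSub for dual_fun].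
HB.instance Definition _ := [Choice of topdual by <:].
HB.instance Definition _ := [SubChoice_isSubLmodule of topdual by <:].

Lemma dual_linear (F : topdual) : linear F.
Proof. by case: F => F /= /asboolP[]. Qed.

Lemma dual_continuous (F : topdual) : continuous F.
Proof. by case: F => F /= /asboolP[]. Qed.

Definition dual_norm (F : topdual) : R :=
  sup [set `|F x| | x in [set x | `|x| <= 1]].

HB.instance Definition _ (F : topdual) := GRing.isLinear.Build R E R^o _ F (dual_linear F).

Lemma dual_bounded (F : topdual) : has_sup [set `|F x| | x in [set x : E | `|x| <= 1]].
Proof.
split; first by exists `|F 0|; exists 0; rewrite //= normr0.
have Fc : continuous (F : {linear E -> R^o}) by exact: dual_continuous.
have /linear_boundedP/pinfty_ex_gt0[M M0 MF] :=
  @continuous_linear_bounded _ _ _ 0 (F : {linear E -> R^o}) (Fc 0).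
exists M => _ [x /= x1 <-]; apply: le_trans (MF x) _.
by rewrite ler_piMr// ltW.
Qed.

Lemma ler_dual_norm (F : topdual) x : `|F x| <= dual_norm F * `|x|.
Proof.
have [->|x0] := eqVneq x 0; first by rewrite linear0 !normr0 mulr0.
rewrite -ler_pdivrMr ?normr_gt0//; apply: sup_upper_bound; first exact: dual_bounded.
exists (`|x|^-1 *: x) => /=.
  by rewrite normrZ normfV normr_id mulVf ?normr_eq0.
by rewrite linearZ normrZ normfV normr_id mulrC.
Qed.

Lemma dual_norm_le (F : topdual) (M : R) : (forall x, `|x| <= 1 -> `|F x| <= M) ->
  dual_norm F <= M.
Proof.
move=> FM; apply: ge_sup; first exact: (dual_bounded F).1.
by move=> _ [x /= x1 <-]; exact: FM.
Qed.

Let dual_normD (F G : topdual) : dual_norm (F + G) <= dual_norm F + dual_norm G.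
Proof.
apply: dual_norm_le => x x1; rewrite -[(F + G) x]/(F x + G x).
apply: le_trans (ler_normD _ _) _; apply: lerD.
  by apply: sup_upper_bound; [exact: dual_bounded|exists x].
by apply: sup_upper_bound; [exact: dual_bounded|exists x].
Qed.

Let dual_normZ (a : R) (F : topdual) : dual_norm (a *: F) = `|a| * dual_norm F.
Proof.
have H (b : R) (G : topdual) : dual_norm (b *: G) <= `|b| * dual_norm G.
  apply: dual_norm_le => x x1; rewrite -[(b *: G) x]/(b * G x) normrM ler_wpM2l//.
  by apply: sup_upper_bound; [exact: dual_bounded|exists x].
apply/eqP; rewrite eq_le H/=.
have [->|a0] := eqVneq a 0.
  rewrite normr0 mul0r scale0r; apply: le_trans (normr_ge0 _) _.
  by apply: sup_upper_bound; [exact: dual_bounded|exists 0; rewrite //= normr0].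
rewrite -ler_pdivlMl ?normr_gt0// -normfV.
by rewrite -[in leLHS](scalerK a0 F) H.
Qed.

Let dual_norm_eq0 (F : topdual) : dual_norm F = 0 -> F = 0.
Proof.
move=> F0; apply/val_inj/funext => x /=; apply/eqP; rewrite -normr_le0.
by apply: le_trans (ler_dual_norm _ _) _; rewrite F0 mul0r.
Qed.

HB.instance Definition _ := Lmodule_isNormed.Build R topdual dual_normD dual_normZ dual_norm_eq0.
End dual_space.

Definition dual_pair (R : realType) (E : normedModType R) (F : topdual E) (v : E) : R :=
  F v.
Notation "<| F , v |>" := (dual_pair F v)
  (at level 0, F, v at level 99, format "<|  F ,  v  |>") : ring_scope.

Section bochner.
Context (R : realType) (E : normedModType R).

Definition simple_fun (s : R -> E) :=
  finite_set (range s) /\ forall x, measurable (s @^-1` [set x]).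

Definition strongly_measurable (D : set R) (g : R -> E) :=
  exists s : nat -> R -> E, (forall n, simple_fun (s n)) /\
    forall t, D t -> s n t @[n --> \oo] --> g t.

(* Membership in L^2(0,T;E).  Functions of time are handled through
   representatives that are pointwise limits of Borel simple functions
   everywhere on [0,T]: the Borel sigma-algebra is not complete, and allowing
   an exceptional null set here would break Borel measurability of scalar
   compositions. *)
Definition inL2 (T : R) (g : R -> E) :=
  strongly_measurable `[0, T] g /\
  lebesgue_measure.-integrable `[0, T] (fun t => (`|g t| ^+ 2)%:E).

End bochner.

Section forms.
Context (R : realType) (E : normedModType R).

Definition hilbert := exists ip : E -> E -> R,
  [/\ forall a u1 u2 v, ip (a *: u1 + u2) v = a * ip u1 v + ip u2 v,
      forall u v, ip u v = ip v u &
      forall u, ip u u = `|u| ^+ 2].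

(* A semilinear form M(u;v) is a map M from E to its dual. *)
Definition gateaux (M : E -> topdual E) (x w v : E) : R :=
  'D_w (fun y => <| M y, v |> : R^o) x.

(* Smoothness enough for the chain rule along segments: M is continuous into
   the dual (operator norm) and each M(.;v) is Gateaux differentiable with
   M'(.)(w,v) continuous.  No operator-norm continuity of M' is asked, so that
   superposition operators on L^2 are covered. *)
Definition smooth_form (M : E -> topdual E) :=
  [/\ continuous M,
      forall x w v, derivable (fun y => <| M y, v |> : R^o) x w &
      forall w v, continuous (fun x => gateaux M x w v : R^o)].

(* M maps bounded sets of E to bounded sets of the dual. *)
Definition bounded_form (M : E -> topdual E) :=
  forall r : R, exists C : R, forall u v, `|u| <= r -> `|<| M u, v |>| <= C * `|v|.

Definition mean_value (M : E -> topdual E) (u uh w v : E) : R :=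
  \int[lebesgue_measure]_(s in `[0, 1]) gateaux M (s *: u + (1 - s) *: uh) w v.

End forms.

Section time_grid.
Context (R : realType) (tm : nat -> R) (Nt : nat).

Definition time_grid (T : R) :=
  [/\ tm 0%N = 0, tm Nt = T & forall k, (k < Nt)%N -> tm k < tm k.+1].

(* tau_k = t_k - t_(k-1), used for 1 <= k <= Nt *)
Definition step (k : nat) : R := tm k - tm k.-1.

(* find returns the first k with s <= t_(k+1), i.e. the index of the cell
   containing s. *)
Definition interp (E : lmodType R) (w : nat -> E) (s : R) : E :=
  let k := find (fun j => s <= tm j.+1) (iota 0 Nt) in
  ((tm k.+1 - s) / step k.+1) *: w k + ((s - tm k) / step k.+1) *: w k.+1.

Definition hat (k : nat) (s : R) : R :=
  interp (fun j => (j == k)%:R : R^o) s.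

End time_grid.

Section finite_elements.
Context (R : realType) (d : nat).
Local Notation X := (Rn R d).
Local Notation leb := (@lebesgue_Rn R d).

Definition edist (x y : X) : R :=
  Num.sqrt (\sum_(i < d) ((tnth x i : R) - (tnth y i : R)) ^+ 2).

Definition edist_bounded (A : set X) :=
  exists M : R, forall x y, A x -> A y -> edist x y <= M.

(* K has diameter at most h and contains a ball of radius rho, where
   h <= sigma * rho. *)
Definition shape_regular (sigma : R) (K : set X) :=
  exists (c : X) (h rho : R),
  [/\ 0 < rho, h <= sigma * rho,
      forall x y, K x -> K y -> edist x y <= h &
      forall x, edist x c < rho -> K x].

(* Elements may have any shape, and the mesh may have hanging nodes. *)
Definition mesh (Om : set X) (sigma : R) (Ks : seq (set X)) :=
  [/\ forall i, (i < size Ks)%N ->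
        measurable (nth set0 Ks i) /\ shape_regular sigma (nth set0 Ks i),
      forall i j, (i < j < size Ks)%N ->
        leb (nth set0 Ks i `&` nth set0 Ks j) = 0%E,
      leb (Om `\` \bigcup_(i in `I_(size Ks)) nth set0 Ks i) = 0%E &
      leb ((\bigcup_(i in `I_(size Ks)) nth set0 Ks i) `\` Om) = 0%E].

(* Polynomial of total degree at most p with coefficients c. *)
Definition poly_fun (p : nat) (c : {ffun 'I_d -> 'I_p.+1} -> R) (x : X) : R :=
  \sum_(a : {ffun 'I_d -> 'I_p.+1} | (\sum_(i < d) a i <= p)%N)
     c a * \prod_(i < d) (tnth x i : R) ^+ a i.

Definition fe_space (nu : {measure set X -> \bar R}) (V : normedModType R)
    (iota : V -> L2 nu) (Ks : seq (set X)) (p : nat) : set V :=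
  [set v | forall i, (i < size Ks)%N -> exists c : {ffun 'I_d -> 'I_p.+1} -> R,
     {ae nu, forall x, nth set0 Ks i x -> L2fun (iota v) x = poly_fun c x}].

End finite_elements.

Section problems.
Context (dX : measure_display) (X : measurableType dX) (R : realType)
        (nu : {measure set X -> \bar R}) (V : normedModType R)
        (iota : V -> L2 nu) (T : R).
Local Notation H := (L2 nu).
Local Notation "( f , g )_H" := (L2dot f g) (format "( f ,  g )_H").

(* The last clause is injectivity of the map from L^2 to the dual of V. *)
Definition gelfand_triple :=
  [/\ injective iota, continuous iota &
      forall g : H, (forall v, (g, iota v)_H = 0) -> g = 0].

(* Ellipticity is Garding's inequality, so that natural boundary conditions
   are allowed; lambda = 0 is coercivity. *)
Definition elliptic_form (B : V -> V -> R) :=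
  [/\ forall a u1 u2 v, B (a *: u1 + u2) v = a * B u1 v + B u2 v,
      forall u v, B u v = B v u,
      exists C : R, forall u v, `|B u v| <= C * `|u| * `|v| &
      exists (alpha lambda : R), 0 < alpha /\
        forall v, alpha * `|v| ^+ 2 <= B v v + lambda * `|iota v| ^+ 2].

Definition test_fun (phi : R -> R) :=
  (forall n t, derivable (derive1n n phi : R -> R^o) t 1) /\
  exists a b : R, [/\ 0 < a, b < T & forall t, phi t != 0 -> a <= t <= b].

(* The identity int phi' u = - int phi u' of Bochner integrals in the dual,
   where u(t) acts on v as (u(t),v), tested with every v. *)
Definition weak_time_derivative (u : R -> V) (du : R -> topdual V) :=
  forall phi, test_fun phi -> forall v : V,
    \int[lebesgue_measure]_(t in `[0, T]) (derive1 phi t * (iota (u t), iota v)_H) =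
    - \int[lebesgue_measure]_(t in `[0, T]) (phi t * <| du t, v |>).

Definition W : set (R -> V) :=
  [set u | inL2 T u /\ exists2 du, inL2 T du & weak_time_derivative u du].

(* d/dt u; two choices agree almost everywhere. *)
Definition dt (u : R -> V) : R -> topdual V :=
  xget (fun=> 0) [set du | inL2 T du /\ weak_time_derivative u du].

Definition continuous_representative (u : R -> V) (uc : R -> H) :=
  {within `[0, T], continuous uc} /\
  {ae lebesgue_measure, forall t : R, t \in `[0, T] -> uc t = iota (u t)}.

(* u(s), the value at s in [0,T] of the L^2-valued continuous representative *)
Definition value_at (u : R -> V) (s : R) : H :=
  xget (fun=> 0) [set uc | continuous_representative u uc] s.

Definition has_trace (u : R -> V) (s : R) (a : H) :=
  exists2 uc, continuous_representative u uc & uc s = a.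

Definition W_init (u0 : H) : set (R -> V) := [set u | W u /\ has_trace u 0 u0].
Definition W_final (qbar : H) : set (R -> V) :=
  [set z | W z /\ has_trace z T qbar].

(* The Bochner integral of c(t) g(t), through its inner products. *)
Definition is_integral (D : set R) (c : R -> R) (g : R -> H) (a : H) :=
  forall w, (a, w)_H = \int[lebesgue_measure]_(t in D) (c t * (g t, w)_H).

Definition represents (g : H) (F : topdual V) := forall v, <| F, v |> = (g, iota v)_H.

Section equations.
Context (B : V -> V -> R) (N Nc : V -> topdual V) (Ne : H -> topdual H)
        (u0 : H) (f : R -> topdual V) (qbar : H) (q : R -> H).

(* Integrability of the nonlinear term is part of being a solution: the
   integral below is total, and B, dt u and f contribute integrable terms. *)
Definition primal (u : R -> V) :=
  W_init u0 u /\ forall v, inL2 T v ->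
    lebesgue_measure.-integrable `[0, T] (fun t => <| N (u t), v t |>%:E) /\
    \int[lebesgue_measure]_(t in `[0, T])
       (<| dt u t, v t |> + B (u t) (v t) + <| N (u t), v t |>) =
    \int[lebesgue_measure]_(t in `[0, T]) <| f t, v t |>.

Definition QoI (u : R -> V) : R :=
  (qbar, value_at u T)_H +
  \int[lebesgue_measure]_(t in `[0, T]) (q t, iota (u t))_H.

Definition dual_problem (u uhat : R -> V) (z : R -> V) :=
  W_final qbar z /\ forall w, inL2 T w ->
    lebesgue_measure.-integrable `[0, T]
      (fun t => (mean_value N (u t) (uhat t) (w t) (z t))%:E) /\
    \int[lebesgue_measure]_(t in `[0, T])
       (<| - dt z t, w t |> + B (z t) (w t) +
        mean_value N (u t) (uhat t) (w t) (z t)) =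
    \int[lebesgue_measure]_(t in `[0, T]) (q t, iota (w t))_H.

Definition residual (uhat : R -> V) (t : R) (v : V) : R :=
  <| f t, v |> - <| dt uhat t, v |> - B (uhat t) v - <| N (uhat t), v |>.

Context (tm : nat -> R) (Nt : nat).
Local Notation tau k := (step tm k).

(* Either f is continuous on (0,T] with values in L^2 and is sampled at the
   nodes, or f is in L^2(0,T;L^2) and is averaged over the cells. *)
Definition source_samples (fs : nat -> H) :=
  (exists g : R -> H,
    [/\ {within `]0, T], continuous g},
        {ae lebesgue_measure, forall t : R, t \in `[0, T] -> represents (g t) (f t)} &
        forall k, (k < Nt)%N -> fs k.+1 = g (tm k.+1)]) \/
  (exists g : R -> H,
    [/\ inL2 T g,
        {ae lebesgue_measure, forall t : R, t \in `[0, T] -> represents (g t) (f t)} &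
        forall k, (k < Nt)%N ->
          is_integral `[tm k, tm k.+1] (fun=> (tau k.+1)^-1) g (fs k.+1)]).

(* q_k carries the factor 1/tau_k, except q_0, which carries 1/tau_1. *)
Definition dual_samples (qs : nat -> H) :=
  forall k, (k <= Nt)%N ->
    is_integral `[0, T] (fun t => (tau (maxn k 1))^-1 * hat tm Nt k t) q (qs k).

(* u_0 is only in L^2, the later u_k are in V. *)
Definition time_seq (u0t : H) (ut : nat -> V) (k : nat) : H :=
  if k is 0%N then u0t else iota (ut k).

Context (fs : nat -> H).

Definition primal_tau (u0t : H) (ut : nat -> V) :=
  (forall v, (u0t, v)_H = (u0, v)_H) /\
  forall k, (k < Nt)%N -> forall v : V,
    ((tau k.+1)^-1 *: (iota (ut k.+1) - time_seq u0t ut k), iota v)_H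
    + B (ut k.+1) v + <| Nc (ut k.+1), v |>
    - <| Ne (time_seq u0t ut k), iota v |> = (fs k.+1, iota v)_H.

Definition primal_tauh (S : nat -> set V) (uh : nat -> V) :=
  [/\ forall k, (k <= Nt)%N -> S k (uh k),
      forall v, S 0%N v -> (iota (uh 0%N), iota v)_H = (u0, iota v)_H &
      forall k, (k < Nt)%N -> forall v, S k.+1 v ->
        ((tau k.+1)^-1 *: (iota (uh k.+1) - iota (uh k)), iota v)_H
        + B (uh k.+1) v + <| Nc (uh k.+1), v |>
        - <| Ne (iota (uh k)), iota v |> = (fs k.+1, iota v)_H].

Definition dual_tau (qs : nat -> H) (u0t : H) (ut uh zt : nat -> V) :=
  forall w : V,
  [/\ (iota (zt Nt), iota w)_H + tau Nt * B (zt Nt) w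
      + tau Nt * mean_value Nc (ut Nt) (uh Nt) w (zt Nt)
      = tau Nt * (qs Nt, iota w)_H + (qbar, iota w)_H,
      forall k, (0 < k < Nt)%N ->
      - ((tau k)^-1 *: (iota (zt k.+1) - iota (zt k)), iota w)_H + B (zt k) w
      + mean_value Nc (ut k) (uh k) w (zt k)
      - tau k.+1 / tau k *
        mean_value Ne (iota (ut k)) (iota (uh k)) (iota w) (iota (zt k.+1))
      = (qs k, iota w)_H &
      - ((tau 1%N)^-1 *: (iota (zt 1%N) - iota (zt 0%N)), iota w)_H
      - mean_value Ne u0t (iota (uh 0%N)) (iota w) (iota (zt 1%N))
      = (qs 0%N, iota w)_H].

Context (uh : nat -> V).
Local Notation Iuh := (interp tm Nt uh).

Definition res_h (k : nat) (v : V) : R :=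
  (fs k, iota v)_H - ((tau k)^-1 *: (iota (uh k) - iota (uh k.-1)), iota v)_H
  - B (uh k) v - <| Nc (uh k), v |> + <| Ne (iota (uh k.-1)), iota v |>.

Definition res_tau (k : nat) (t : R) (v : V) : R :=
  B (uh k) v + <| Nc (uh k), v |> - <| Ne (iota (uh k.-1)), iota v |>
  - B (Iuh t) v - <| N (Iuh t), v |>.

Definition res_f (k : nat) (t : R) (v : V) : R :=
  <| f t, v |> - (fs k, iota v)_H.

Definition R_s (zt vh : nat -> V) : R :=
  (u0 - iota (uh 0%N), iota (zt 0%N) - iota (vh 0%N))_H +
  \sum_(1 <= k < Nt.+1) tau k * res_h k (zt k - vh k).

Definition R_t (z : R -> V) (zt : nat -> V) : R :=
  (u0 - iota (uh 0%N), value_at z 0 - iota (zt 0%N))_H +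
  \sum_(0 <= k < Nt) \int[lebesgue_measure]_(t in `[tm k, tm k.+1])
    (residual Iuh t (z t - zt k.+1) + res_tau k.+1 t (zt k.+1)).

Definition Osc (zt : nat -> V) : R :=
  \sum_(0 <= k < Nt) \int[lebesgue_measure]_(t in `[tm k, tm k.+1])
    res_f k.+1 t (zt k.+1).

End equations.
End problems.

(* Main.v *)
(* Put e = u - Iu. Testing the dual problem with e, testing the primal problem
   with z, and integrating by parts in time turns the goal error into
   (u^0 - u_0^h, z(0)) plus the time integral of R_PDE(Iu; z). On every cell R_PDE splits as
   r_h + r_tau + r_f, and Galerkin orthogonality inserts v_tau^h.
   The analytic core is the identity d/dt (u, z) = <u', z> + <z', u> in integrated form
   for functions with weak derivatives in V*. It is obtained without mollification:
   the forward differences of u tested with z and the backward differences of z tested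
   with u sum to averages of (u, z) over the two ends of [0, T], and each of the
   two difference quotients converges to a duality integral. *)

Require Import Defs.
From mathcomp Require Import all_boot all_order all_algebra.
From mathcomp Require Import all_classical all_reals all_analysis.
From mathcomp Require Import ring lra measurable_realfun.

Import Order.TTheory GRing.Theory Num.Theory.
Import numFieldNormedType.Exports.

Local Open Scope classical_set_scope.
Local Open Scope ring_scope.

Set Implicit Arguments.
Unset Strict Implicit.
Unset Printing Implicit Defensive.

(** * Integrals over intervals and moving averages *)

Section interval_integrals.
Context {R : realType}.
Local Notation mu := (@lebesgue_measure R).
Implicit Types (f g : R -> R) (a b c : R).

Local Notation Int f a b := (\int[mu]_(x in `[a, b]) f x).
Local Notation L1 a b f := (mu.-integrable `[a, b] (EFin \o f)).

(** The obstacle is that [weak_time_derivative] speaks of one fixed v at a time and of scalar test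
    functions, while both equations pair [dt] with a function of time. The scalar statement is
    therefore upgraded to increments: (uc t - uc s, v) is the integral of <du, v> over [s, t], for
    all 0 <= s <= t <= T and every v. In this form v may vary with t, because t is frozen when the
    identity is used: with v = z t, a difference quotient of u paired with z t is the average of <du
    r, z t> over a window of r around t. It remains to pass to the diagonal r = t under the integral
    in t, which uses only the square integrability of du and z. Increments also make it unnecessary
    to identify the chosen [dt] of the interpolant with its cellwise slopes: the slopes show that a
    weak derivative exists, and what enters a cell is the increment of nodal values. The mean-value
    linearization is exact on the difference u - Iu, which is why the final identity has no
    remainder. *)

Lemma within_continuousP (U : normedModType R) (A : set R) (f : R -> U) :
  {within A, continuous f} <->
  forall x, A x -> forall e : R, 0 < e -> exists2 d : R, 0 < d &
    forall y, A y -> `|y - x| < d -> `|f y - f x| < e.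
Proof.
split=> [/subspace_continuousP cf x Ax e e0|cf].
  have /cvgrPdist_lt/(_ e e0) := cf x Ax.
  rewrite near_withinE near_nbhs => /nbhs_ballP[d /= d0 H]; exists d => // y Ay yx.
  by rewrite distrC; apply: H => //; rewrite -ball_normE /= distrC.
apply/subspace_continuousP => x Ax; apply/cvgrPdist_lt => e e0.
have [d d0 H] := cf x Ax e e0.
rewrite near_withinE near_nbhs; apply/nbhs_ballP; exists d => //= y.
by rewrite -ball_normE /= distrC => yx Ay; rewrite distrC; exact: H.
Qed.

Lemma continuous_integrable f a b : {within `[a, b], continuous f} -> L1 a b f.
Proof. by move=> cf; apply: continuous_compact_integrable => //; exact: segment_compact. Qed.

Lemma cst_integrable a b c : L1 a b (fun=> c).
Proof. by apply: continuous_integrable; apply: continuous_subspaceT; exact: cst_continuous. Qed.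

Lemma integrable_itvS f a b c d : a <= c -> d <= b -> L1 a b f -> L1 c d f.
Proof.
move=> ac db; apply: integrableS => //.
by move=> x /=; rewrite !in_itv /= => /andP[cx xd]; rewrite (le_trans ac cx) (le_trans xd db).
Qed.

Lemma within_itvS (U : normedModType R) (f : R -> U) a b c d : a <= c -> d <= b ->
  {within `[a, b], continuous f} -> {within `[c, d], continuous f}.
Proof.
move=> ac db; apply: continuous_subspaceW.
by move=> x /=; rewrite !in_itv /= => /andP[cx xd]; rewrite (le_trans ac cx) (le_trans xd db).
Qed.

Lemma Int_split f a b c : a <= c -> c <= b -> L1 a b f ->
  Int f a b = Int f a c + Int f c b.
Proof.
move=> ac cb lf.
rewrite -(Rintegral_itv_obnd_cbnd (r := c)); last first.
  apply: integrableS lf => //; apply: subset_itv; by rewrite ?bnd_simp.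
by rewrite -(@Rintegral_itvB _ f (BLeft a) (BRight b) c lf) ?bnd_simp// addrC subrK.
Qed.

Lemma Int_cst a b c : a <= b -> Int (fun=> c) a b = c * (b - a).
Proof.
move=> ab; rewrite Rintegral_cst// [X in fine X]lebesgue_measure_itv/= lte_fin.
move: ab; rewrite le_eqVlt => /predU1P[->|ab]; first by rewrite ltxx subrr.
by rewrite ab -EFinB.
Qed.

Lemma Int_point f a : Int f a a = 0.
Proof. by rewrite set_itv1 Rintegral_set1. Qed.

Lemma eq_Int f g a b : (forall x, a <= x <= b -> f x = g x) -> Int f a b = Int g a b.
Proof. by move=> fg; apply: eq_Rintegral => x; rewrite inE /= in_itv /= => /fg. Qed.

Lemma eq_L1 f g a b : (forall x, a <= x <= b -> f x = g x) -> L1 a b f -> L1 a b g.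
Proof.
move=> fg; apply: eq_integrable => // x; rewrite inE /= in_itv /= => /fg ->//.
Qed.

Lemma le_Int f g a b : L1 a b f -> L1 a b g ->
  (forall x, a <= x <= b -> f x <= g x) -> Int f a b <= Int g a b.
Proof.
by move=> lf lg fg; apply: le_Rintegral => // x /=; rewrite in_itv /= => /fg.
Qed.

Lemma Int_ge0 f a b : (forall x, a <= x <= b -> 0 <= f x) -> 0 <= Int f a b.
Proof. by move=> f0; apply: Rintegral_ge0 => x /=; rewrite in_itv /= => /f0. Qed.

Lemma norm_Int f a b : L1 a b f -> `|Int f a b| <= Int (fun x => `|f x|) a b.
Proof. by move=> lf; exact: le_normr_Rintegral. Qed.

Lemma L1_norm f a b : L1 a b f -> L1 a b (fun x => `|f x|).
Proof. by move=> lf; exact: (integrable_abse lf). Qed.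

Lemma L1D f g a b : L1 a b f -> L1 a b g -> L1 a b (fun x => f x + g x).
Proof. by move=> lf lg; exact: (integrableD _ lf lg). Qed.

Lemma L1B f g a b : L1 a b f -> L1 a b g -> L1 a b (fun x => f x - g x).
Proof. by move=> lf lg; exact: (integrableB _ lf lg). Qed.

Lemma L1Z f a b c : L1 a b f -> L1 a b (fun x => c * f x).
Proof. by move=> lf; exact: (integrableZl _ c lf). Qed.

Lemma IntD f g a b : L1 a b f -> L1 a b g ->
  Int (fun x => f x + g x) a b = Int f a b + Int g a b.
Proof. by move=> lf lg; exact: RintegralD. Qed.

Lemma IntB f g a b : L1 a b f -> L1 a b g ->
  Int (fun x => f x - g x) a b = Int f a b - Int g a b.
Proof. by move=> lf lg; exact: RintegralB. Qed.

Lemma IntZ f a b c : L1 a b f -> Int (fun x => c * f x) a b = c * Int f a b.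
Proof. by move=> lf; exact: RintegralZl. Qed.

Lemma norm_Int_le f g a b : L1 a b f -> L1 a b g ->
  (forall x, a <= x <= b -> `|f x| <= g x) -> `|Int f a b| <= Int g a b.
Proof.
by move=> lf lg fg; apply: (le_trans (norm_Int lf)); apply: le_Int => //; exact: L1_norm.
Qed.

Lemma norm_Int_cst f a b c : a <= b -> L1 a b f ->
  (forall x, a <= x <= b -> `|f x| <= c) -> `|Int f a b| <= c * (b - a).
Proof.
by move=> ab lf fc; rewrite -Int_cst//; apply: norm_Int_le => //; exact: cst_integrable.
Qed.

Lemma measurable_dominated_L1 f g a b : measurable_fun `[a, b] f -> L1 a b g ->
  (forall x, a <= x <= b -> `|f x| <= g x) -> L1 a b f.
Proof.
move=> mf lg fg; apply: le_integrable lg => //; first exact/measurable_EFinP.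
move=> x /=; rewrite in_itv /= => /fg fgx.
by rewrite /= lee_fin; exact: le_trans fgx (ler_norm _).
Qed.

Lemma L1_measurable f a b : L1 a b f -> measurable_fun `[a, b] f.
Proof. by move=> /integrableP[/measurable_EFinP]. Qed.

(** Continuity is what the substitution rule asks for. Later uses respect it by translating only
    primitives and products of continuous representatives, never a merely integrable function. *)
Lemma Int_shift f a b c : {within `[a + c, b + c], continuous f} ->
  Int (fun x => f (x + c)) a b = Int f (a + c) (b + c).
Proof.
have [ab cf|ba _] := leP a b; last first.
  by rewrite !set_itv_ge ?bnd_simp -?ltNge ?ltrD2r// !Rintegral_set0.
pose F (x : R) := x + c.
have dF (x : R) : is_derive x (1 : R) F 1.
  by rewrite /F -[X in is_derive _ _ _ X](addr0 1); apply: is_deriveD.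
have F1 : derive1 F = cst 1 by apply/funext => x; rewrite derive1E; have [_ ->] := dF x.
have cF : continuous F.
  by move=> x; apply: differentiable_continuous; apply/derivable1_diffP; have [] := dF x.
rewrite /Rintegral (@integration_by_substitution_increasing _ F f a b)//.
- by congr fine; apply: eq_integral => x _; rewrite /= F1 /GRing.mul /= mulr1.
- by move=> x y _ _ xy; rewrite ltrD2r.
- by rewrite F1 => x _; exact: cst_continuous.
- by rewrite F1; apply: is_cvg_cst.
- by rewrite F1; apply: is_cvg_cst.
- split; first by move=> x _; have [] := dF x.
    by apply: cvg_at_right_filter; exact: cF.
  by apply: cvg_at_left_filter; exact: cF.
Qed.

Definition prim g (t : R) := Int g 0 t.

Lemma prim_continuous g T : 0 <= T -> L1 0 T g -> {within `[0, T], continuous (prim g)}.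
Proof. by move=> T0 lg; exact: parameterized_integral_continuous. Qed.

Lemma prim_diff g T s t : 0 <= s -> s <= t -> t <= T -> L1 0 T g ->
  prim g t - prim g s = Int g s t.
Proof.
move=> s0 st tT lg; rewrite /prim (@Int_split g 0 t s)//; first by rewrite addrC addKr.
exact: integrable_itvS lg.
Qed.

Lemma within_shift (U : normedModType R) (f : R -> U) a b c :
  {within `[a + c, b + c], continuous f} ->
  {within `[a, b], continuous (fun x => f (x + c))}.
Proof.
move=> /within_continuousP cf; apply/within_continuousP => x xab e e0.
have xab' : `[a + c, b + c]%classic (x + c).
  by move: xab; rewrite /= !in_itv /= !lerD2r.
have [d d0 H] := cf _ xab' e e0; exists d => // y yab yx; apply: H.
  by move: yab; rewrite /= !in_itv /= !lerD2r.
by rewrite opprD addrACA subrr addr0.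
Qed.

(** After translation the two integrals run over [a + b, T] and [0, T - (a + b)]. Each is completed
    to the integral over [0, T] by one end piece, so only the end pieces survive. *)
Lemma Int_increments (w : R -> R) T a b : 0 <= a -> 0 <= b -> a + b <= T ->
  {within `[0, T], continuous w} ->
  Int (fun t => w (t + b) - w (t - a)) a (T - b) =
  Int w (T - (a + b)) T - Int w 0 (a + b).
Proof.
move=> a0 b0 abT cw.
have lw : L1 0 T w by exact: continuous_integrable.
have cwb : {within `[a + b, T - b + b], continuous w}.
  by apply: within_itvS cw; rewrite ?subrK// addr_ge0.
have cwa : {within `[a - a, T - b - a], continuous w}.
  apply: within_itvS cw; rewrite ?subrr//; lra.
rewrite IntB; last 2 first.
- by apply: continuous_integrable; exact: within_shift.
- by apply: continuous_integrable; exact: within_shift.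
rewrite Int_shift// Int_shift// subrK subrr.
have -> : T - b - a = T - (a + b) by lra.
have /eqP := @Int_split w 0 T (a + b) (addr_ge0 a0 b0) abT lw.
have -> : Int w 0 T = Int w 0 (T - (a + b)) + Int w (T - (a + b)) T.
  by apply: Int_split => //; lra.
by move=> /eqP; lra.
Qed.

(** Two separate reaches let one theory serve forward differences (a = 0) and backward differences
    (b = 0). *)
Definition avg a b g (t : R) := (a + b)^-1 * Int g (t - a) (t + b).

Lemma avgE (T : R) a b g t : 0 <= a -> 0 <= b -> a <= t <= T - b -> L1 0 T g ->
  avg a b g t = (a + b)^-1 * (prim g (t + b) - prim g (t - a)).
Proof.
move=> a0 b0 /andP[ta tb] lg; rewrite /avg (@prim_diff _ T)//; lra.
Qed.

Lemma avg_continuous (T : R) a b g : 0 <= a -> 0 <= b -> a + b <= T -> L1 0 T g ->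
  {within `[a, T - b], continuous (avg a b g)}.
Proof.
move=> a0 b0 abT lg.
have cp : {within `[0, T], continuous (prim g)} by apply: prim_continuous => //; lra.
have c1 : {within `[a, T - b], continuous (fun t => prim g (t + b))}.
  by apply: within_shift; apply: within_itvS cp; lra.
have c2 : {within `[a, T - b], continuous (fun t => prim g (t - a))}.
  by apply: within_shift; apply: within_itvS cp; lra.
have : {within `[a, T - b], continuous (fun t => (a + b)^-1 * (prim g (t + b) - prim g (t - a)))}.
  by move=> x; apply: cvgM; [exact: cvg_cst|apply: cvgB; [exact: c1|exact: c2]].
apply: subspace_eq_continuous => x; rewrite inE /= in_itv /= => xab.
by rewrite /from_subspace (@avgE T).
Qed.

Lemma avg_L1 T a b g : 0 <= a -> 0 <= b -> a + b <= T -> L1 0 T g ->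
  L1 a (T - b) (avg a b g).
Proof. by move=> *; apply: continuous_integrable; exact: avg_continuous. Qed.

Lemma avg_contraction T a b g : 0 <= a -> 0 <= b -> 0 < a + b <= T -> L1 0 T g ->
  (forall x, 0 <= x <= T -> 0 <= g x) ->
  Int (avg a b g) a (T - b) <= Int g 0 T.
Proof.
move=> a0 b0 /andP[ab0 abT] lg g0.
have T0 : 0 <= T by lra.
rewrite (@eq_Int _ (fun t => (a + b)^-1 * (prim g (t + b) - prim g (t - a)))); last first.
  by move=> x xab; rewrite (@avgE T).
have cp : {within `[0, T], continuous (prim g)} by exact: prim_continuous.
rewrite IntZ; last first.
  by apply: L1B; apply: continuous_integrable; apply: within_shift;
    apply: within_itvS cp; lra.
rewrite (@Int_increments _ T)// ler_pdivrMl//.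
have pg t : 0 <= t -> t <= T -> 0 <= prim g t <= Int g 0 T.
  move=> t0 tT; rewrite Int_ge0/=; last by move=> x /andP[x0 xt]; rewrite g0// x0 (le_trans xt).
  rewrite -subr_ge0 [X in _ <= X - _](_ : _ = prim g T)// (@prim_diff _ T)//.
  by apply: Int_ge0 => x /andP[x0 xt]; rewrite g0// xt (le_trans t0).
have h1 : Int (prim g) (T - (a + b)) T <= Int (fun=> Int g 0 T) (T - (a + b)) T.
  apply: le_Int; [|exact: cst_integrable|].
    by apply: continuous_integrable; apply: within_itvS cp; lra.
  move=> x /andP[x0 xT]; have /pg/(_ xT) : 0 <= x by lra.
  by case/andP.
have h2 : 0 <= Int (prim g) 0 (a + b).
  apply: Int_ge0 => x /andP[x0 xT]; have /andP[] : 0 <= prim g x <= Int g 0 T.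
    by apply: pg => //; exact: le_trans abT.
  by [].
move: h1; rewrite Int_cst; last lra.
have -> : T - (T - (a + b)) = a + b by lra.
by move: h2; set X := Int _ _ _; set Y := Int _ _ _; set Z := Int g 0 T; lra.
Qed.

End interval_integrals.

(** * Convergence of moving averages in L^1 *)

Section average.
Context {R : realType}.
Local Notation mu := (@lebesgue_measure R).
Implicit Types (f g : R -> R) (a b c : R).

Local Notation Int f a b := (\int[mu]_(x in `[a, b]) f x).
Local Notation L1 a b f := (mu.-integrable `[a, b] (EFin \o f)).

(** Compactness in the form of [near_covering] makes the local radii uniform. The point y may leave
    [0, T]. *)
Lemma segment_unif_continuous (h : R -> R) (T e : R) : continuous h -> 0 < e ->
  exists2 d : R, 0 < d & forall x y, 0 <= x <= T -> `|y - x| < d -> `|h y - h x| < e.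
Proof.
move=> ch e0.
have cov : near_covering (`[0, T]%classic : set R).
  by apply/compact_near_coveringP; exact: segment_compact.
have F : Filter (0 : R)^'+ by exact: at_right_proper_filter.
have := cov R ((0 : R)^'+) (fun d x => forall y, `|y - x| < d -> `|h y - h x| < e) F.
have H : forall x, `[0, T]%classic x -> \forall x' \near x & d \near (0 : R)^'+,
    forall y, `|y - x'| < d -> `|h y - h x'| < e.
  move=> x _.
  have e20 : 0 < e / 2 by rewrite divr_gt0.
  have /cvgrPdist_lt/(_ _ e20)/nbhs_ballP[d /= d0 Hd] := ch x.
  have d20 : 0 < d / 2 by rewrite divr_gt0.
  exists (ball x (d / 2), [set r | r < d / 2]).
    split; first exact: nbhsx_ballx.
    exact: nbhs_right_lt.
  move=> [x' r] /= [xx' rd] y yx'.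
  have hx' : `|h x - h x'| < e / 2.
    by apply: Hd; rewrite -ball_normE /=; move: xx'; rewrite -ball_normE /=; lra.
  have hy : `|h x - h y| < e / 2.
    apply: Hd; rewrite -ball_normE /=; move: xx'; rewrite -ball_normE /= => xx'.
    rewrite -(subrK x' x) -addrA; apply: le_lt_trans (ler_normD _ _) _.
    by rewrite [`|x' - y|]distrC; lra.
  rewrite -(subrK (h x) (h y)) -addrA; apply: le_lt_trans (ler_normD _ _) _.
  by rewrite [`|h y - _|]distrC; lra.
move=> /(_ H) Hn.
have [d [/= d0 Hd]] := filter_ex (filterI (nbhs_right_gt (0 : R)) Hn).
by exists d => // x y xT; apply: Hd; rewrite /= in_itv.
Qed.

Lemma L1_approx_continuous (T e : R) g : L1 0 T g -> 0 < e ->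
  exists h : R -> R, continuous h /\ Int (fun x => `|g x - h x|) 0 T < e.
Proof.
move=> lg e0.
have fT : (mu `[0%R, T] < +oo)%E by apply: compact_finite_measure; exact: segment_compact.
have [h_ [ch lh hcv]] := approximation_continuous_integrable (measurable_itv `[0, T]) fT lg.
have /fine_cvgP[_ /cvgrPdist_lt/(_ e e0)[n _ /(_ n (leqnn n))]] := hcv.
rewrite /= sub0r normrN => hn; exists (h_ n); split => //.
apply: le_lt_trans (ler_norm _) _.
exact: hn.
Qed.

(** Density of continuous functions in L^1. For h continuous and close to g, the error splits into
    the average of g - h, bounded by [avg_contraction], the oscillation of h over a window, and h -
    g itself. *)
Lemma avg_cvg (T e : R) g : 0 < T -> L1 0 T g -> 0 < e ->
  exists2 d : R, 0 < d & forall a b, 0 <= a -> 0 <= b -> 0 < a + b -> a + b < d ->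
    a + b <= T -> Int (fun t => `|avg a b g t - g t|) a (T - b) <= e.
Proof.
move=> T0 lg e0.
have e30 : 0 < e / 3 by lra.
have [h [ch gh]] := L1_approx_continuous lg e30.
(* The oscillation bound is integrated over a length of at most T, hence the division by T. *)
have eT0 : 0 < e / 3 / T by rewrite divr_gt0.
have [d d0 Hd] := segment_unif_continuous T ch eT0.
exists d => // a b a0 b0 ab0 abd abT.
have lh : L1 0 T h by apply: continuous_integrable; exact: continuous_subspaceT.
have lgh : L1 0 T (fun x => `|g x - h x|) by apply: L1_norm; exact: L1B.
have lgh' : L1 a (T - b) (fun x => `|g x - h x|) by apply: integrable_itvS lgh; lra.
have lavg : L1 a (T - b) (avg a b (fun x => `|g x - h x|)) by apply: avg_L1.
have hbound t : a <= t <= T - b ->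
    `|avg a b g t - g t| <=
    avg a b (fun x => `|g x - h x|) t + `|g t - h t| + e / 3 / T.
  move=> /andP[at_ tb].
  have lgt : L1 (t - a) (t + b) g by apply: integrable_itvS lg; lra.
  have lht : L1 (t - a) (t + b) h by apply: integrable_itvS lh; lra.
  have h1 : `|avg a b g t - avg a b h t| <= avg a b (fun x => `|g x - h x|) t.
    rewrite /avg -mulrBr normrM gtr0_norm ?invr_gt0// ler_pM2l ?invr_gt0//.
    by rewrite -IntB//; apply: norm_Int; exact: L1B.
  have h2 : `|avg a b h t - h t| <= e / 3 / T.
    rewrite /avg -[X in _ - X](mulKf (lt0r_neq0 ab0)) -mulrBr normrM gtr0_norm ?invr_gt0//.
    rewrite ler_pdivrMl//.
    have -> : (a + b) * h t = Int (fun=> h t) (t - a) (t + b).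
      by rewrite Int_cst; [rewrite mulrC; congr (_ * _); lra|lra].
    rewrite -IntB//; last exact: cst_integrable.
    have -> : (a + b) * (e / 3 / T) = e / 3 / T * (t + b - (t - a)).
      by rewrite mulrC; congr (_ * _); lra.
    apply: norm_Int_cst; [lra|apply: L1B => //; exact: cst_integrable|].
    move=> x /andP[x1 x2]; apply/ltW/Hd; first by apply/andP; split; lra.
    by rewrite ltr_norml; apply/andP; split; lra.
  have -> : avg a b g t - g t =
      (avg a b g t - avg a b h t) + ((avg a b h t - h t) + (h t - g t)) by lra.
  apply: le_trans (ler_normD _ _) _; rewrite -[leRHS]addrA; apply: lerD => //.
  by apply: le_trans (ler_normD _ _) _; rewrite [leRHS]addrC; apply: lerD => //; rewrite distrC.
have l1 : L1 a (T - b) (fun t => `|avg a b g t - g t|).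
  apply: L1_norm; apply: L1B; first exact: avg_L1.
  by apply: integrable_itvS lg; lra.
apply: le_trans (le_Int (g := fun t => avg a b (fun x => `|g x - h x|) t + `|g t - h t| + e / 3 / T) l1 _ hbound) _.
  by apply: L1D; [exact: L1D|exact: cst_integrable].
rewrite IntD; [|exact: L1D|exact: cst_integrable].
rewrite IntD// Int_cst; last lra.
have i1 : Int (avg a b (fun x => `|g x - h x|)) a (T - b) <= e / 3.
  by apply: le_trans (avg_contraction _ _ _ lgh _) (ltW gh) => //; rewrite ab0.
have i2 : Int (fun x => `|g x - h x|) a (T - b) <= e / 3.
  apply: le_trans (ltW gh).
  rewrite (@Int_split _ (fun x => `|g x - h x|) 0 T a)//; [|lra].
  rewrite (@Int_split _ (fun x => `|g x - h x|) a T (T - b)); [|lra|lra|].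
    by rewrite addrCA lerDl addr_ge0// Int_ge0.
  by apply: integrable_itvS lgh; lra.
have i3 : e / 3 / T * (T - b - a) <= e / 3.
  by rewrite -[leRHS](divfK (lt0r_neq0 T0)) ler_wpM2l//; lra.
by lra.
Qed.

End average.

(** * Strongly measurable and square integrable functions *)

Section strong_measurability.
Import HBNNSimple.
Context {R : realType}.
Local Notation mu := (@lebesgue_measure R).
Local Notation Int f a b := (\int[mu]_(x in `[a, b]) f x).
Local Notation L1 a b f := (mu.-integrable `[a, b] (EFin \o f)).

Lemma simple_preimage (E : normedModType R) (s : R -> E) (Y : set E) :
  simple_fun s -> measurable (s @^-1` Y).
Proof.
move=> [fs ms].
have -> : s @^-1` Y = \bigcup_(x in range s `&` Y) s @^-1` [set x].
  apply/seteqP; split=> [t Yt|t [x [_ Yx] /= ->]//].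
  by exists (s t).
by apply: fin_bigcup_measurable => //; apply: sub_finite_set fs => x [].
Qed.

Lemma simple_comp2 (E F G : normedModType R) (phi : E -> F -> G) (s : R -> E) (r : R -> F) :
  simple_fun s -> simple_fun r -> simple_fun (fun t => phi (s t) (r t)).
Proof.
move=> ss sr; have [fs ms] := ss; split.
  apply: sub_finite_set (finite_image2 phi fs sr.1) => _ [t _ <-].
  by exists (s t); [exists t|exists (r t) => //; exists t].
move=> z; have -> : (fun t => phi (s t) (r t)) @^-1` [set z] =
    \bigcup_(x in range s) (s @^-1` [set x] `&` r @^-1` [set y | phi x y = z]).
  apply/seteqP; split=> [t /= <-|t [x _ /= [-> ->]]//].
  by exists (s t) => //; exists t.
apply: fin_bigcup_measurable => // x _; apply: measurableI => //.
exact: simple_preimage.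
Qed.

Lemma simple_cst (E : normedModType R) (x : E) : simple_fun (fun=> x).
Proof.
split; first by apply: sub_finite_set (finite_set1 x) => _ [t _ <-].
move=> y; have [<-|xy] := pselect (x = y).
  by rewrite (_ : _ @^-1` _ = setT)//; apply/seteqP; split.
by rewrite (_ : _ @^-1` _ = set0)//; apply/seteqP; split.
Qed.

Lemma simple_indic (A : set R) : measurable A -> simple_fun (\1_A : R -> R^o).
Proof.
move=> mA; split.
  apply: sub_finite_set (finite_set2 (0 : R) 1) => _ [t _ <-] /=.
  by rewrite indicE; case: (_ \in _); [right|left].
move=> y; rewrite -[X in measurable X]setTI.
by apply: measurable_indic.
Qed.

Lemma simple_measurable (s : R -> R^o) (D : set R) : measurable D ->
  simple_fun s -> measurable_fun D (s : R -> R).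
Proof.
by move=> mD ss _ Y mY; apply: measurableI => //; exact: simple_preimage.
Qed.

(** Sequences suffice, since a strongly measurable function is the pointwise limit of a sequence of
    simple functions. *)
Definition seq_continuous2 (E F G : normedModType R) (phi : E -> F -> G) :=
  forall (x_ : nat -> E) (y_ : nat -> F) x y,
    x_ n @[n --> \oo] --> x -> y_ n @[n --> \oo] --> y ->
    phi (x_ n) (y_ n) @[n --> \oo] --> phi x y.

Lemma strongly_measurable_comp2 (E F G : normedModType R) (phi : E -> F -> G) D
    (g : R -> E) (k : R -> F) : seq_continuous2 phi ->
  strongly_measurable D g -> strongly_measurable D k ->
  strongly_measurable D (fun t => phi (g t) (k t)).
Proof.
move=> cphi [s [ss sg]] [r [sr rk]].
exists (fun n t => phi (s n t) (r n t)); split.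
  by move=> n; exact: simple_comp2.
by move=> t Dt; apply: cphi; [exact: sg|exact: rk].
Qed.

Lemma strongly_measurable_cst (E : normedModType R) D (x : E) :
  strongly_measurable D (fun=> x).
Proof.
exists (fun _ _ => x); split; first by move=> _; exact: simple_cst.
by move=> t _; exact: cvg_cst.
Qed.

Lemma strongly_measurable_comp (E G : normedModType R) (phi : E -> G) D (g : R -> E) :
  continuous phi -> strongly_measurable D g ->
  strongly_measurable D (fun t => phi (g t)).
Proof.
move=> cphi sg.
have := @strongly_measurable_comp2 E E G (fun x _ => phi x) D g g.
by apply => // x_ y_ x y xx _; apply: continuous_cvg => //; exact: cphi.
Qed.

Lemma strongly_measurable_real D (g : R -> R^o) : measurable D ->
  strongly_measurable D g -> measurable_fun D (g : R -> R).
Proof.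
move=> mD [s [ss sg]]; apply: (@measurable_fun_cvg _ _ _ _ s) => //.
by move=> n; exact: simple_measurable.
Qed.

Lemma strongly_measurableB (E : normedModType R) D (g k : R -> E) :
  strongly_measurable D g -> strongly_measurable D k ->
  strongly_measurable D (fun t => g t - k t).
Proof.
by apply: (@strongly_measurable_comp2 E E E (fun x y => x - y)) => *; exact: cvgB.
Qed.

Lemma strongly_measurable_norm (E : normedModType R) D (g : R -> E) : measurable D ->
  strongly_measurable D g -> measurable_fun D (fun t => `|g t|).
Proof.
move=> mD sg; apply: strongly_measurable_real => //.
by apply: (@strongly_measurable_comp E R^o (fun x => `|x|)) sg; exact: norm_continuous.
Qed.

(** The approximations [nnsfun_approx] of t >= 0 supply the simple functions; composing them with a
    continuous g yields [strongly_measurable_continuous]. *)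
Lemma strongly_measurable_id (T : R) : strongly_measurable `[0, T] (id : R -> R^o).
Proof.
pose f (t : R) : \bar R := t%:E.
have mf : measurable_fun `[0, T]%classic f by exact/measurable_EFinP.
pose s (n : nat) : R -> R^o := nnsfun_approx (measurable_itv _) mf n.
exists s; split=> [n|t t0T].
  split; first exact: fimfunP.
  by move=> x; rewrite -[X in measurable X]setTI; exact: measurable_funP.
have f0 x : `[0, T]%classic x -> (0 <= f x)%E.
  by rewrite /= in_itv /= lee_fin => /andP[].
by have /fine_cvg := cvg_nnsfun_approx (measurable_itv _) mf f0 t0T.
Qed.

Lemma strongly_measurable_continuous (E : normedModType R) (T : R) (g : R -> E) :
  continuous g -> strongly_measurable `[0, T] g.
Proof.
move=> cg; have := @strongly_measurable_comp R^o E g `[0, T]%classic id cg.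
by apply; exact: strongly_measurable_id.
Qed.

End strong_measurability.

Section square_integrable.
Context {R : realType}.
Local Notation mu := (@lebesgue_measure R).
Local Notation Int f a b := (\int[mu]_(x in `[a, b]) f x).
Local Notation L1 a b f := (mu.-integrable `[a, b] (EFin \o f)).

Lemma inL2_L1_sqr (E : normedModType R) (T : R) (g : R -> E) : inL2 T g ->
  L1 0 T (fun t => `|g t| ^+ 2).
Proof. by case. Qed.

Lemma inL2_dominated (E : normedModType R) (T : R) (g : R -> E) (k : R -> R) :
  strongly_measurable `[0, T] g -> L1 0 T k ->
  (forall t, 0 <= t <= T -> `|g t| ^+ 2 <= k t) -> inL2 T g.
Proof.
move=> sg lk gk; split=> //; apply: measurable_dominated_L1 lk _.
  by apply: measurable_funX; exact: strongly_measurable_norm.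
by move=> t t0T; rewrite normrX normr_id; exact: gk.
Qed.

Lemma inL2B (E : normedModType R) (T : R) (g k : R -> E) : inL2 T g -> inL2 T k ->
  inL2 T (fun t => g t - k t).
Proof.
move=> [sg lg] [sk lk].
apply: (@inL2_dominated _ _ _ (fun t => 2 * (`|g t| ^+ 2 + `|k t| ^+ 2))).
- exact: strongly_measurableB.
- by apply: L1Z; exact: L1D.
move=> t _; apply: (@le_trans _ _ ((`|g t| + `|k t|) ^+ 2)).
  by rewrite lerXn2r ?nnegrE ?addr_ge0// ler_normB.
have := sqr_ge0 (`|g t| - `|k t|); lra.
Qed.

Lemma inL2_continuous (E : normedModType R) (T : R) (g : R -> E) : continuous g ->
  inL2 T g.
Proof.
move=> cg.
apply: (@inL2_dominated _ _ _ (fun t => `|g t| ^+ 2)) => //.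
  exact: strongly_measurable_continuous.
apply: continuous_integrable; apply: continuous_subspaceT => t.
apply: (@continuous_comp _ _ _ (fun s => `|g s|) (fun x : R => x ^+ 2)).
  by apply: continuous_comp; [exact: cg|exact: norm_continuous].
exact: exprn_continuous.
Qed.

Lemma inL2_cst (E : normedModType R) (T : R) (x : E) : inL2 T (fun=> x).
Proof. by apply: inL2_continuous; exact: cst_continuous. Qed.

Lemma inL2_pairing (E F : normedModType R) (T C : R) (phi : E -> F -> R^o)
    (g : R -> E) (k : R -> F) : seq_continuous2 phi ->
  (forall x y, `|phi x y| <= C * `|x| * `|y|) -> inL2 T g -> inL2 T k ->
  L1 0 T (fun t => phi (g t) (k t)).
Proof.
move=> cphi phiC [sg lg] [sk lk].
apply: (@measurable_dominated_L1 _ _ (fun t => `|C| * (`|g t| ^+ 2 + `|k t| ^+ 2))).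
- by apply: strongly_measurable_real => //; exact: strongly_measurable_comp2.
- by apply: L1Z; exact: L1D.
move=> t _; apply: le_trans (phiC _ _) _.
rewrite -mulrA; apply: (@le_trans _ _ (`|C| * (`|g t| * `|k t|))).
  by rewrite ler_wpM2r ?mulr_ge0 ?ler_norm.
rewrite ler_wpM2l//.
have := sqr_ge0 (`|g t| - `|k t|); have := mulr_ge0 (normr_ge0 (g t)) (normr_ge0 (k t)).
lra.
Qed.

(** Pointwise convergence gives no common bound, so s n is cut off to 0 where its norm exceeds twice
    that of g. Where g t = 0 the truncation vanishes; elsewhere it is eventually inactive. The
    squared error is then at most (1 + 2)^2 = 9 times |g t|^2, and dominated convergence applies. *)
Lemma inL2_simple_approx (E : normedModType R) (T e : R) (g : R -> E) : 0 < e ->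
  inL2 T g ->
  exists s : R -> E, [/\ simple_fun s, inL2 T s & Int (fun t => `|g t - s t| ^+ 2) 0 T < e].
Proof.
move=> e0 [sg lg]; have [s [ss s_g]] := sg.
have mg := strongly_measurable_norm (measurable_itv `[0, T]) sg.
have ms n := @simple_measurable R (fun t => `|s n t|) `[0, T]%classic (measurable_itv _)
  (@simple_comp2 R E E R^o (fun x _ => `|x|) _ _ (ss n) (ss n)).
pose A n : set R := `[0, T]%classic `&` [set t | `|s n t| <= 2 * `|g t|].
have mA n : measurable (A n).
  rewrite /A (_ : [set t | _] = (fun t => 2 * `|g t| - `|s n t|) @^-1` `[0, +oo[%classic).
    by apply: measurable_funB => //; exact: measurable_funM.
  by apply/seteqP; split=> t /=; rewrite in_itv /= andbT subr_ge0.
pose r n t : E := (\1_(A n) t : R) *: s n t.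
have sr n : simple_fun (r n).
  by apply: (@simple_comp2 R R^o E E (fun a x => a *: x)) => //; exact: simple_indic.
have rle n t : 0 <= t <= T -> `|r n t| <= 2 * `|g t|.
  move=> t0T; rewrite /r indicE; have [/set_mem[_ /=]|_] := boolP (t \in A n).
    by rewrite scale1r.
  by rewrite scale0r normr0 mulr_ge0.
have rcvg t : 0 <= t <= T -> r n t @[n --> \oo] --> g t.
  move=> t0T; have t0T' : `[0, T]%classic t by rewrite /= in_itv.
  have sgt := s_g t t0T'.
  have [g0|g0] := eqVneq (g t) 0.
    rewrite (_ : (fun n => r n t) = (fun=> 0)); first by rewrite g0; exact: cvg_cst.
    apply/funext => n; apply/eqP; rewrite -normr_le0.
    by have := rle n t t0T; rewrite g0 normr0 mulr0.
  apply: (cvg_trans _ sgt); apply: near_eq_cvg.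
  have gt0 : 0 < `|g t| by rewrite normr_gt0.
  have /cvgrPdist_lt/(_ _ gt0) := sgt.
  apply: filterS => n gsn; rewrite /r indicE mem_set ?scale1r//; split => //=.
  rewrite -[X in `|X|](subrK (g t)); apply: le_trans (ler_normD _ _) _.
  by move: gsn; rewrite distrC; lra.
have lr n : inL2 T (r n).
  apply: (@inL2_dominated _ _ _ (fun t => 4 * `|g t| ^+ 2)).
  - by exists (fun=> r n); split=> [_//|t _]; exact: cvg_cst.
  - exact: L1Z.
  move=> t t0T; have := rle n t t0T => h.
  have -> : 4 * `|g t| ^+ 2 = (2 * `|g t|) ^+ 2 by lra.
  by rewrite lerXn2r ?nnegrE ?mulr_ge0.
have lgr n : inL2 T (fun t => g t - r n t) by exact: inL2B.
have [] := @dominated_convergence _ _ _ mu `[0, T]%classic (measurable_itv _)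
  (fun n t => (`|g t - r n t| ^+ 2)%:E) (fun=> 0%E) (fun t => (9 * `|g t| ^+ 2)%:E).
- by move=> n; exact: (measurable_int mu (lgr n).2).
- exact: measurable_cst.
- apply: nearW => t; rewrite /= in_itv /= => t0T.
  apply: cvg_EFin; first exact: nearW.
  suff : `|g t - r n t| ^+ 2 @[n --> \oo] --> (0 : R) by [].
  rewrite (_ : 0 = `|(g t - g t : E)| ^+ 2 :> R); last by rewrite subrr normr0 expr0n.
  apply: (@cvg_comp _ _ _ (fun n => `|g t - r n t|) (fun x : R => x ^+ 2) _
    (nbhs `|g t - g t|)); last exact: exprn_continuous.
  by apply: cvg_norm; apply: cvgB; [exact: cvg_cst|exact: rcvg].
- exact: L1Z.
- apply: nearW => t n; rewrite /= in_itv /= => t0T.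
  rewrite lee_fin normrX normr_id.
  have -> : 9 * `|g t| ^+ 2 = (3 * `|g t|) ^+ 2 by lra.
  rewrite lerXn2r ?nnegrE ?mulr_ge0//.
  by apply: le_trans (ler_normB _ _) _; have := rle n t t0T; lra.
move=> _ + _.
under eq_fun do under eq_integral do rewrite sube0 gee0_abs ?lee_fin ?sqr_ge0//.
move=> /fine_cvgP[_ /cvgrPdist_lt/(_ e e0)[n _ /(_ n (leqnn n))]].
rewrite /= sub0r normrN => hn; exists (r n); split => //.
exact: le_lt_trans (ler_norm _) hn.
Qed.

End square_integrable.

(** * Smooth cut-off functions and weak derivatives on the line *)

Section smooth_functions.
Context {R : realType}.
Local Notation mu := (@lebesgue_measure R).
Local Notation Int f a b := (\int[mu]_(x in `[a, b]) f x).
Local Notation L1 a b f := (mu.-integrable `[a, b] (EFin \o f)).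
Implicit Types (f g : R -> R).

Lemma is_derive_affine (a b x : R) : is_derive x (1 : R) (fun t => a * t + b) a.
Proof.
have -> : (fun t => a * t + b) = (fun t : R => a *: (id t : R^o)) + cst b by [].
by apply: is_derive_eq; rewrite addr0 [a *: _]mulr1.
Qed.

(** The factor t^(-m) in front of exp(-1/t) makes the family closed under differentiation up to
    linear combinations, see [is_derive_flat]. *)
Definition flat (m : nat) (t : R) : R :=
  if 0 < t then t^-1 ^+ m * expR (- t^-1) else 0.

(** With y = 1/t, the Taylor bound exp y >= y^(m+2)/(m+2)! beats the pole of order m by two powers
    of t. *)
Lemma flat_le m t : 0 < t -> `|flat m t| <= m.+2`!%:R * t ^+ 2.
Proof.
move=> t0; rewrite /flat t0 ger0_norm; last by rewrite mulr_ge0 ?expR_ge0// exprn_ge0 ?invr_ge0 ?ltW.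
have y0 : 0 <= t^-1 by rewrite invr_ge0 ltW.
rewrite expRN ler_pdivrMr ?expR_gt0//.
have := expR_ge1Dxn m.+1 y0.
set F := (_`!)%:R => h.
have F0 : 0 < F :> R by rewrite ltr0n fact_gt0.
have h2 : t^-1 ^+ m.+2 / F <= expR t^-1 by apply: le_trans h; rewrite lerDr.
move: h2; rewrite ler_pdivrMr// => h2.
have -> : t^-1 ^+ m = t ^+ 2 * t^-1 ^+ m.+2.
  by rewrite !exprS expr0 -!mulrA !mulrA; field; exact: lt0r_neq0.
have -> : F * t ^+ 2 * expR t^-1 = t ^+ 2 * (expR t^-1 * F) by ring.
by rewrite ler_wpM2l// sqr_ge0.
Qed.

Lemma flat_le0 m t : t <= 0 -> flat m t = 0.
Proof. by rewrite /flat leNgt; case: ifP. Qed.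

Lemma flat_ge0 m t : 0 <= flat m t.
Proof.
rewrite /flat; case: ifP => // t0.
by rewrite mulr_ge0 ?expR_ge0// exprn_ge0 ?invr_ge0 ?ltW.
Qed.

Lemma flat_continuous0 m : {for 0, continuous (flat m)}.
Proof.
apply/cvgrPdist_lt => e e0; rewrite [flat m 0]flat_le0//.
set C : R := m.+2`!%:R.
have C0 : 0 < C by rewrite ltr0n fact_gt0.
near=> z; rewrite sub0r normrN; have [z0|z0] := leP z 0.
  by rewrite flat_le0// normr0.
apply: le_lt_trans (flat_le m z0) _.
have z1 : `|z| < 1 by near: z; apply: (@nbhs0_lt R R^o); exact: ltr01.
have ze : `|z| < e / C by near: z; apply: (@nbhs0_lt R R^o); rewrite divr_gt0.
move: z1 ze; rewrite gtr0_norm// ltr_pdivlMr// => z1 ze.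
by apply: le_lt_trans ze; rewrite mulrC ler_pM2r// expr2 ger_pMl// ltW.
Unshelve. all: by end_near. Qed.

Lemma is_derive_flat m t :
  is_derive t (1 : R) (flat m) (flat m.+2 t - m%:R * flat m.+1 t).
Proof.
have [t0|t0|->] := ltgtP t 0.
- rewrite !flat_le0 ?ltW// mulr0 subrr.
  apply: (@near_eq_is_derive _ _ _ (cst 0)).
  near=> x; rewrite flat_le0//; apply: ltW; near: x.
  exact: lt_nbhsl.
- have -> : flat m.+2 t - m%:R * flat m.+1 t =
     (t^-1 ^+ m.+2 - m%:R * t^-1 ^+ m.+1) * expR (- t^-1).
    by rewrite /flat t0 mulrBl mulrA.
  pose F (x : R) : R := x^-1 ^+ m * expR (- x^-1).
  apply: (@near_eq_is_derive _ _ _ F).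
    near=> x; rewrite /flat; suff -> : 0 < x by [].
    by near: x; exact: lt_nbhsr.
  have dV : is_derive t (1 : R) (fun x : R => x^-1) (- t ^- 2 *: 1).
    by apply: (@is_deriveV _ id) => //; exact: lt0r_neq0.
  have dE : is_derive t (1 : R) (expR \o (fun x : R => - x^-1)) (expR (- t^-1) * - (- t ^- 2 *: 1)).
    by apply: is_derive1_comp; exact: is_deriveN.
  have dP : is_derive t (1 : R) ((fun x : R => x^-1) ^+ m) _ := is_deriveX m dV.
  have -> : F = (fun x : R => x^-1) ^+ m * (expR \o (fun x : R => - x^-1)).
    by apply/funext => x; rewrite !fctE.
  apply: (is_derive_eq (is_deriveM dP dE)).
  rewrite /= !fctE /GRing.scale /=; case: m {dP F} => [|m].
    by rewrite !mul0r; field; exact: lt0r_neq0.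
  rewrite /= -!exprVn !exprS; ring.
(* At 0 the slope function of Caratheodory's criterion is [flat m.+1] itself, because flat m z =
   flat (m+1) z * z; it is continuous at 0 and vanishes there. *)
apply/is_derive1_caratheodory; exists (flat m.+1); split.
- move=> z; rewrite subr0 [flat m 0]flat_le0// subr0 /flat; case: ifP => z0; last by rewrite mul0r.
  by rewrite exprS; field; exact: lt0r_neq0.
- exact: flat_continuous0.
by rewrite !flat_le0// mulr0 subr0.
Unshelve. all: by end_near. Qed.

Definition smooth_bump (t : R) : R := flat 0 t * flat 0 (1 - t).

Lemma bump_ge0 t : 0 <= smooth_bump t.
Proof. by rewrite mulr_ge0 ?flat_ge0. Qed.

Lemma bump_out t : ~~ (0 < t < 1) -> smooth_bump t = 0.
Proof.
rewrite negb_and -!leNgt /smooth_bump => /orP[t0|t1]; first by rewrite flat_le0// mul0r.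
by rewrite (@flat_le0 _ (1 - t))// ?mulr0// subr_le0.
Qed.

Lemma flat_continuous m : continuous (flat m).
Proof.
move=> t; apply: differentiable_continuous; apply/derivable1_diffP.
by have [] := is_derive_flat m t.
Qed.

Lemma bump_continuous : continuous smooth_bump.
Proof.
move=> t; apply: cvgM; first exact: flat_continuous.
apply: (@cvg_comp _ _ _ (fun t : R => 1 - t) (flat 0) _ (nbhs (1 - t))).
  by apply: cvgB; [exact: cvg_cst|exact: cvg_id].
exact: flat_continuous.
Qed.

Lemma bump_L1 a b : L1 a b smooth_bump.
Proof.
by apply: continuous_integrable; apply: continuous_subspaceT; exact: bump_continuous.
Qed.

Lemma Int_bump_gt0 : 0 < Int smooth_bump (-1) 1.
Proof.
rewrite (@Int_split _ _ (-1) 1 (1 / 4)); [|lra|lra|exact: bump_L1].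
rewrite (@Int_split _ _ (1 / 4) 1 (3 / 4)); [|lra|lra|exact: bump_L1].
have i1 a b : 0 <= Int smooth_bump a b by apply: Int_ge0 => x _; exact: bump_ge0.
suff : 0 < Int smooth_bump (1 / 4) (3 / 4) by have := i1 (-1) (1 / 4); have := i1 (3 / 4) 1; lra.
(* On [1/4, 3/4] both 1/x and 1/(1 - x) are at most 4. *)
apply: (@lt_le_trans _ _ (Int (fun=> expR (- 4) * expR (- 4)) (1 / 4) (3 / 4))).
  by rewrite Int_cst ?mulr_gt0 ?expR_gt0//; lra.
apply: le_Int; [exact: cst_integrable|exact: bump_L1|move=> x /andP[x1 x2]].
have x0 : 0 < x by lra.
have x1' : 0 < 1 - x by lra.
rewrite /smooth_bump /flat x0 x1' !expr0 !mul1r ler_pM ?expR_ge0// ler_expR lerN2.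
  by rewrite -[leRHS]invrK lef_pV2 ?posrE ?invr_gt0//; lra.
by rewrite -[leRHS]invrK lef_pV2 ?posrE ?invr_gt0//; lra.
Qed.

(* The lower bound only has to lie to the left of the support of [smooth_bump]. *)
Definition ramp (t : R) : R := Int smooth_bump (-1) t / Int smooth_bump (-1) 1.

Lemma ramp_le0 t : t <= 0 -> ramp t = 0.
Proof.
move=> t0; rewrite /ramp (@eq_Int _ _ (fun=> 0)); last first.
  by move=> x /andP[_ xt]; rewrite bump_out// negb_and -leNgt (le_trans xt).
by rewrite Rintegral_cst// mul0r mul0r.
Qed.

Lemma ramp_ge1 t : 1 <= t -> ramp t = 1.
Proof.
move=> t1; rewrite /ramp (@Int_split _ _ (-1) t 1)//; last exact: bump_L1.
rewrite [X in _ + X](@eq_Int _ _ (fun=> 0)); last first.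
  by move=> x /andP[x1 _]; rewrite bump_out// negb_and -!leNgt x1 orbT.
by rewrite Rintegral_cst// mul0r addr0 divff// lt0r_neq0// Int_bump_gt0.
Qed.

Lemma ramp_itv t : 0 <= ramp t <= 1.
Proof.
have i1 a b : 0 <= Int smooth_bump a b by apply: Int_ge0 => x _; exact: bump_ge0.
apply/andP; split; first by rewrite divr_ge0.
have [t1|/ltW t1] := leP 1 t; first by rewrite ramp_ge1.
have [t0|t0] := leP t 0; first by rewrite ramp_le0.
rewrite /ramp ler_pdivrMr ?Int_bump_gt0// mul1r.
rewrite (@Int_split _ _ (-1) 1 t); [by rewrite lerDl|lra|done|exact: bump_L1].
Qed.

Lemma is_derive_ramp t : is_derive t (1 : R) ramp ((Int smooth_bump (-1) 1)^-1 * smooth_bump t).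
Proof.
set c := (Int smooth_bump (-1) 1)^-1.
(* For t < 0 the ramp vanishes near t. For t >= 0 the point lies strictly above the lower limit -1,
   where the fundamental theorem applies. *)
have [t0|t0] := ltP t 0.
  rewrite bump_out ?mulr0; last by rewrite negb_and -leNgt ltW.
  apply: (@near_eq_is_derive _ _ _ (cst 0)).
  near=> x; rewrite ramp_le0//; apply: ltW; near: x; exact: lt_nbhsl.
have t1 : t < t + 1 by lra.
have tm : -1 < t by lra.
have [d1 d2] := continuous_FTC1_closed t1 (bump_L1 _ _) tm (@bump_continuous t).
have -> : ramp = c *: (fun x => Int smooth_bump (-1) x : R^o).
  by apply/funext => x; rewrite /ramp mulrC.
have dI : is_derive t (1 : R) (fun x => Int smooth_bump (-1) x : R^o) (smooth_bump t).
  by apply: DeriveDef; [exact: d1|rewrite -derive1E; exact: d2].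
by have := is_deriveZ c dI.
Unshelve. all: by end_near. Qed.

(** [test_fun] asks for derivatives of every order. Instead of computing them, one exhibits a class
    that contains with each function a derivative of it. Products are included because the
    derivative of [ramp] is, up to a constant, a product of two [flat] functions. *)
Inductive smooth_gen : (R -> R) -> Prop :=
| gen_flat m a b : smooth_gen (fun t => flat m (a * t + b))
| gen_ramp a b : smooth_gen (fun t => ramp (a * t + b))
| gen_scale c f : smooth_gen f -> smooth_gen (fun t => c * f t)
| gen_add f g : smooth_gen f -> smooth_gen g -> smooth_gen (fun t => f t + g t)
| gen_mul f g : smooth_gen f -> smooth_gen g -> smooth_gen (fun t => f t * g t).

Lemma is_derive_compA f (a b t d : R) : is_derive (a * t + b) (1 : R) f d ->
  is_derive t (1 : R) (fun t => f (a * t + b)) (a * d).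
Proof.
move=> df; have dA := is_derive_affine a b t.
have := @is_derive1_comp R f (fun t => a * t + b) t d a df dA.
by rewrite mulrC.
Qed.

Lemma smooth_gen_derive f : smooth_gen f ->
  exists2 f', smooth_gen f' & forall t : R, is_derive t (1 : R) f (f' t).
Proof.
elim=> {f} [m a b|a b|c f _ [f' sf' df]|f g _ [f' sf' df] _ [g' sg' dg]
           |f g sf [f' sf' df] sg [g' sg' dg]].
- exists (fun t => a * (flat m.+2 (a * t + b) + (- m%:R) * flat m.+1 (a * t + b))).
    by apply: gen_scale; apply: gen_add; [exact: gen_flat|apply: gen_scale; exact: gen_flat].
  move=> t; apply: is_derive_compA; rewrite mulNr; exact: is_derive_flat.
- exists (fun t => a * ((Int smooth_bump (-1) 1)^-1 *
    (flat 0 (a * t + b) * flat 0 ((- a) * t + (1 - b))))).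
    apply: gen_scale; apply: gen_scale; apply: gen_mul; exact: gen_flat.
  move=> t; apply: is_derive_compA.
  have -> : - a * t + (1 - b) = 1 - (a * t + b) by lra.
  exact: is_derive_ramp.
- exists (fun t => c * f' t); first exact: gen_scale.
  by move=> t; have := is_deriveZ c (df t).
- exists (fun t => f' t + g' t); first exact: gen_add.
  by move=> t; have := is_deriveD (df t) (dg t).
- exists (fun t => f t * g' t + g t * f' t).
    by apply: gen_add; apply: gen_mul.
  by move=> t; have := is_deriveM (df t) (dg t).
Qed.

Lemma smooth_gen_derivable f : smooth_gen f ->
  forall n (t : R), derivable (derive1n n f : R -> R^o) t 1.
Proof.
move=> sf n; have : smooth_gen (derive1n n f).
  elim: n => // n IH; rewrite derive1nS.
  have [f' sf' df] := smooth_gen_derive IH.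
  have -> // : derive1 (derive1n n f) = f'.
  by apply/funext => t; rewrite derive1E; have [_ ->] := df t.
by move=> /smooth_gen_derive[f' _ df] t; have [] := df t.
Qed.

End smooth_functions.

(** * From weak derivatives on the line to increments (du Bois-Reymond) *)

Section du_bois_reymond.
Context {R : realType}.
Local Notation mu := (@lebesgue_measure R).
Local Notation Int f a b := (\int[mu]_(x in `[a, b]) f x).
Local Notation L1 a b f := (mu.-integrable `[a, b] (EFin \o f)).
Implicit Types (f g : R -> R).

Lemma is_derive_continuous f (f' : R -> R) :
  (forall t : R, is_derive t (1 : R) f (f' t)) -> continuous f.
Proof.
move=> df t; apply: differentiable_continuous; apply/derivable1_diffP.
by have [] := df t.
Qed.

Lemma Int_derive f (f' : R -> R) a b : a <= b ->
  (forall t : R, is_derive t (1 : R) f (f' t)) -> {within `[a, b], continuous f'} ->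
  Int f' a b = f b - f a.
Proof.
rewrite le_eqVlt => /predU1P[<- _ _|ab df cf']; first by rewrite Int_point subrr.
have cf := is_derive_continuous df.
rewrite /Rintegral (@continuous_FTC2 _ f' f)//.
- split; first by move=> x _; have [] := df x.
    by apply: cvg_at_right_filter; exact: cf.
  by apply: cvg_at_left_filter; exact: cf.
- by move=> x _; rewrite derive1E; have [_ ->] := df x.
Qed.

Lemma L1M_continuous f g a b : {within `[a, b], continuous f} -> L1 a b g ->
  L1 a b (fun t => f t * g t).
Proof.
move=> cf lg.
have [C Cf] : exists C, forall t, a <= t <= b -> `|f t| <= C.
  have [ab|ab] := leP a b; last first.
    by exists 0 => t /andP[at_ tb]; move: (le_trans at_ tb); rewrite leNgt ab.
  have cnf : {within `[a, b], continuous (fun t => `|f t|)}.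
    by move=> t; apply: cvg_norm; exact: cf.
  have [c cab Hc] := EVT_max ab cnf.
  by exists `|f c| => t tab; apply: Hc; rewrite in_itv.
apply: (@measurable_dominated_L1 _ _ (fun t => C * `|g t|)).
- apply: measurable_funM; last exact: L1_measurable.
  exact: subspace_continuous_measurable_fun.
- by apply: L1Z; exact: L1_norm.
- by move=> t /Cf h; rewrite normrM ler_wpM2r.
Qed.

(** As k has mass 1, both w x and e are integrals against k, and the estimate becomes a pointwise
    one on the support of k. *)
Lemma Int_approximate_delta (k w : R -> R) (T x e c d : R) : 0 <= T ->
  continuous k -> {within `[0, T], continuous w} ->
  (forall t, 0 <= k t) -> (forall t, ~~ (c <= t <= d) -> k t = 0) -> Int k 0 T = 1 ->
  (forall t, c <= t <= d -> `|w t - w x| <= e) ->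
  `|Int (fun t => k t * w t) 0 T - w x| <= e.
Proof.
move=> T0 ck cw k0 kout k1 we.
have ck' : {within `[0, T], continuous k} by exact: continuous_subspaceT.
have lw : L1 0 T w by exact: continuous_integrable.
have lk : L1 0 T k by exact: continuous_integrable.
have lkw := L1M_continuous ck' lw.
have lkx := L1Z (w x) lk.
have -> : w x = Int (fun t => w x * k t) 0 T by rewrite IntZ// k1 mulr1.
rewrite -IntB//.
have -> : e = Int (fun t => e * k t) 0 T by rewrite IntZ// k1 mulr1.
apply: norm_Int_le; [exact: L1B|exact: L1Z|move=> t _].
have -> : k t * w t - w x * k t = k t * (w t - w x) by ring.
have [tcd|tcd] := boolP (c <= t <= d); last by rewrite kout// mul0r normr0 mulr0.
by rewrite normrM ger0_norm// mulrC ler_wpM2r// we.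
Qed.

(** A smoothed indicator of [s, t]: it rises on [s, s + e] and, thanks to the offset 1, falls on
    [t - e, t], so that it vanishes outside [s, t]. Its derivative is a difference of two
    approximate delta functions. *)
Definition plateau (s t e r : R) : R := ramp ((r - s) / e) - ramp ((r - t) / e + 1).

Lemma plateau_test (T s t e : R) : 0 < s -> t < T -> 0 < e -> e <= t - s ->
  test_fun T (plateau s t e).
Proof.
move=> s0 tT e0 est.
have g1 : smooth_gen (plateau s t e).
  have -> : plateau s t e = fun r => ramp (e^-1 * r + (- s / e)) +
      (-1) * ramp (e^-1 * r + (1 - t / e)).
    apply/funext => r; rewrite /plateau mulN1r; congr (ramp _ - ramp _).
      by rewrite mulrBl mulrC mulNr.
    by rewrite mulrBl mulrC; ring.
  by apply: gen_add; [exact: gen_ramp|apply: gen_scale; exact: gen_ramp].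
split; first exact: smooth_gen_derivable.
exists s, t; split=> // r; apply: contraNT; rewrite negb_and -!ltNge /plateau => /orP[rs|tr].
  rewrite !ramp_le0 ?subrr//.
    rewrite -lerBrDr sub0r ler_pdivrMr// mulN1r; lra.
  by rewrite ler_pdivrMr// mul0r; lra.
rewrite !ramp_ge1 ?subrr//.
  by rewrite lerDr divr_ge0; lra.
by rewrite ler_pdivlMr// mul1r; lra.
Qed.

(** The offset b lets one computation serve both edges of the plateau: b = 0 for the rise that
    starts at s, b = 1 for the fall that ends at t. *)
Lemma is_derive_ramp_scaled (s e b r : R) :
  is_derive r (1 : R) (fun r => ramp ((r - s) / e + b))
    (e^-1 * ((Int smooth_bump (-1) 1)^-1 * smooth_bump ((r - s) / e + b))).
Proof.
have -> : (fun r => ramp ((r - s) / e + b)) = fun r => ramp (e^-1 * r + (b - s / e)).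
  by apply/funext => y; congr (ramp _); rewrite mulrBl; ring.
have -> : (r - s) / e + b = e^-1 * r + (b - s / e) by ring.
by apply: is_derive_compA; exact: is_derive_ramp.
Qed.

Section ramp_kernel.
Variables (s e b : R).
Hypothesis e0 : 0 < e.
Let k (r : R) := e^-1 * ((Int smooth_bump (-1) 1)^-1 * smooth_bump ((r - s) / e + b)).

Lemma ramp_kernel_continuous : continuous k.
Proof.
move=> r; apply: cvgM; first exact: cvg_cst.
apply: cvgM; first exact: cvg_cst.
apply: (@cvg_comp _ _ _ (fun r => (r - s) / e + b) smooth_bump _ (nbhs ((r - s) / e + b))).
  apply: cvgD; last exact: cvg_cst.
  by apply: cvgM; [apply: cvgB; [exact: cvg_id|exact: cvg_cst]|exact: cvg_cst].
exact: bump_continuous.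
Qed.

Lemma ramp_kernel_ge0 r : 0 <= k r.
Proof.
have c0 := @Int_bump_gt0 R.
rewrite /k; apply: mulr_ge0; first by rewrite invr_ge0 ltW.
by apply: mulr_ge0; [rewrite invr_ge0 ltW|exact: bump_ge0].
Qed.

Lemma ramp_kernel_out r : ~~ (s - b * e <= r <= s - b * e + e) -> k r = 0.
Proof.
move=> h; rewrite /k bump_out ?mulr0//; apply: contra h => /andP[h0 h1].
have : 0 < (r - s) + b * e.
  have -> : (r - s) + b * e = ((r - s) / e + b) * e by field; exact: lt0r_neq0.
  by rewrite mulr_gt0.
have : (r - s) + b * e < e.
  have -> : (r - s) + b * e = ((r - s) / e + b) * e by field; exact: lt0r_neq0.
  by rewrite gtr_pMl.
by move=> *; apply/andP; split; lra.
Qed.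

Lemma Int_ramp_kernel (T : R) : 0 <= s - b * e -> s - b * e + e <= T -> Int k 0 T = 1.
Proof.
move=> h0 hT.
have T0 : 0 <= T by exact: (le_trans (addr_ge0 h0 (ltW e0))).
have ck : {within `[0, T], continuous k}.
  by apply: continuous_subspaceT; exact: ramp_kernel_continuous.
rewrite (Int_derive T0 (fun t => is_derive_ramp_scaled s e b t) ck).
rewrite ramp_ge1 ?ramp_le0 ?subr0//.
  rewrite sub0r -(ler_pM2r e0) mul0r mulrDl divfK ?lt0r_neq0//; lra.
rewrite -(ler_pM2r e0) mul1r mulrDl divfK ?lt0r_neq0//; lra.
Qed.

End ramp_kernel.

Lemma ramp_kernel_approx (T s h b x e d : R) (w : R -> R) : 0 < h -> h < d ->
  0 <= s - b * h -> s - b * h <= x <= s - b * h + h -> s - b * h + h <= T ->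
  {within `[0, T], continuous w} ->
  (forall y, `[0, T]%classic y -> `|y - x| < d -> `|w y - w x| < e) ->
  `|Int (fun r => h^-1 * ((Int smooth_bump (-1) 1)^-1 * smooth_bump ((r - s) / h + b)) * w r)
     0 T - w x| <= e.
Proof.
move=> h0 hd; set l := s - b * h => l0 /andP[lx xl] lT cw we.
apply: (@Int_approximate_delta _ _ _ _ _ l (l + h)) => //.
- by clear -l0 h0 lT; lra.
- exact: ramp_kernel_continuous.
- by move=> r; exact: ramp_kernel_ge0.
- by move=> r; exact: ramp_kernel_out.
- exact: Int_ramp_kernel.
- move=> r /andP[r1 r2]; apply/ltW/we.
    by rewrite /= in_itv /=; apply/andP; split; [clear -l0 r1|clear -lT r2]; lra.
  by rewrite ltr_norml; clear -r1 r2 lx xl hd; apply/andP; split; lra.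
Qed.

Lemma derive_plateau (s t h r : R) : derive1 (plateau s t h) r =
  h^-1 * ((Int smooth_bump (-1) 1)^-1 * smooth_bump ((r - s) / h + 0)) -
  h^-1 * ((Int smooth_bump (-1) 1)^-1 * smooth_bump ((r - t) / h + 1)).
Proof.
rewrite derive1E; apply: derive_val.
have -> : plateau s t h = (fun r => ramp ((r - s) / h + 0)) - (fun r => ramp ((r - t) / h + 1)).
  by apply/funext => x; rewrite /plateau !fctE /= addr0.
by apply: is_deriveB; exact: is_derive_ramp_scaled.
Qed.

Lemma plateau_continuous (s t h : R) : continuous (plateau s t h).
Proof.
have d r : is_derive r (1 : R) (plateau s t h)
    (h^-1 * ((Int smooth_bump (-1) 1)^-1 * smooth_bump ((r - s) / h + 0)) -
     h^-1 * ((Int smooth_bump (-1) 1)^-1 * smooth_bump ((r - t) / h + 1))).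
  have -> : plateau s t h = (fun r => ramp ((r - s) / h + 0)) - (fun r => ramp ((r - t) / h + 1)).
    by apply/funext => x; rewrite /plateau !fctE /= addr0.
  by apply: is_deriveB; exact: is_derive_ramp_scaled.
exact: is_derive_continuous d.
Qed.

Lemma plateau1 (s t h r : R) : 0 < h -> s + h <= r <= t - h -> plateau s t h r = 1.
Proof.
move=> h0 /andP[r1 r2]; rewrite /plateau ramp_ge1 ?ramp_le0 ?subr0//.
  by rewrite -lerBrDr sub0r ler_pdivrMr// mulN1r; lra.
by rewrite ler_pdivlMr// mul1r; lra.
Qed.

Lemma plateau0 (s t h r : R) : 0 < h -> h <= t - s -> ~~ (s < r < t) -> plateau s t h r = 0.
Proof.
move=> h0 hst; rewrite negb_and -!leNgt /plateau => /orP[rs|tr].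
  rewrite !ramp_le0 ?subrr//.
    by rewrite -lerBrDr sub0r ler_pdivrMr// mulN1r; lra.
  by rewrite ler_pdivrMr// mul0r; lra.
rewrite !ramp_ge1 ?subrr//.
  by rewrite lerDr divr_ge0; lra.
by rewrite ler_pdivlMr// mul1r; lra.
Qed.

Lemma plateau_dist (s t h r : R) : `|plateau s t h r - 1| <= 2.
Proof.
rewrite /plateau; have /andP[u1 u2] := ramp_itv ((r - s) / h).
have /andP[v1 v2] := ramp_itv ((r - t) / h + 1).
by rewrite ler_norml; apply/andP; split; lra.
Qed.

(** The two integrands differ only on the two edges, where the plateau is within 2 of 1; each edge
    therefore costs at most 2 e. *)
Lemma Int_plateau (T s t h e : R) g : 0 <= s -> t <= T -> 0 < h -> h + h <= t - s ->
  L1 0 T g -> Int (fun r => `|g r|) s (s + h) <= e -> Int (fun r => `|g r|) (t - h) t <= e ->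
  `|Int (fun r => plateau s t h r * g r) 0 T - Int g s t| <= 4 * e.
Proof.
move=> s0 tT h0 hhst lg g1 g2.
have sht : s + h <= t - h by clear -hhst; lra.
have hst : h <= t - s by clear -hhst h0; lra.
have st : s <= t by clear -hst h0; lra.
have sh : s <= s + h by clear -h0; lra.
have th : t - h <= t by clear -h0; lra.
have sht' : s + h <= t by clear -sht h0; lra.
have lpg : L1 0 T (fun r => plateau s t h r * g r).
  by apply: L1M_continuous => //; apply: continuous_subspaceT; exact: plateau_continuous.
have E0 a b : (forall r, a <= r <= b -> ~~ (s < r < t)) ->
    Int (fun r => plateau s t h r * g r) a b = 0.
  move=> out; rewrite (@eq_Int _ _ (fun=> 0)); last first.
    by move=> r /out /(plateau0 h0 hst) ->; rewrite mul0r.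
  by rewrite Rintegral_cst// mul0r.
have lst : L1 s t (fun r => plateau s t h r * g r) by exact: integrable_itvS lpg.
have lgst : L1 s t g by exact: integrable_itvS lg.
have -> : Int (fun r => plateau s t h r * g r) 0 T = Int (fun r => plateau s t h r * g r) s t.
  rewrite (@Int_split _ _ 0 T s)//; last exact: le_trans tT.
  rewrite (@Int_split _ _ s T t)//; last exact: integrable_itvS lpg.
  rewrite E0 ?add0r; last by move=> r /andP[_ rs]; rewrite negb_and -leNgt rs.
  by rewrite [X in _ + X]E0 ?addr0// => r /andP[tr _]; rewrite negb_and -!leNgt tr orbT.
rewrite -IntB//.
set k := fun r => plateau s t h r * g r - g r.
have lk : L1 s t k by exact: L1B.
have hk a b : s <= a -> b <= t -> `|Int k a b| <= 2 * Int (fun r => `|g r|) a b.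
  move=> sa bt.
  have lab : L1 a b (fun r => `|g r|) by apply: L1_norm; exact: integrable_itvS lgst.
  rewrite -IntZ//; apply: norm_Int_le; [exact: integrable_itvS lk|exact: L1Z|].
  move=> r _; have -> : k r = (plateau s t h r - 1) * g r by rewrite [RHS]mulrBl mul1r.
  by rewrite normrM ler_wpM2r// plateau_dist.
rewrite (@Int_split _ _ s t (s + h))// (@Int_split _ _ (s + h) t (t - h))//; last first.
  exact: integrable_itvS lk.
rewrite [X in _ + (X + _)](@eq_Int _ _ (fun=> 0)); last first.
  by move=> r /(plateau1 h0) pr; rewrite /k pr mul1r subrr.
rewrite Rintegral_cst// mul0r add0r; apply: le_trans (ler_normD _ _) _.
have := hk s (s + h) (lexx _) sht'.
have st' : s <= t - h by exact: le_trans sht.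
have := hk (t - h) t st' (lexx _).
move: g1 g2; set I1 := Int _ s _; set I2 := Int _ _ t; set J1 := `|_|; set J2 := `|_|.
by clear; lra.
Qed.

(** Half the minimum makes all four inequalities strict. *)
Lemma min_pos4 (a b c d : R) : 0 < a -> 0 < b -> 0 < c -> 0 < d ->
  exists h : R, [/\ 0 < h, h < a, h < b, h < c & h < d].
Proof.
move=> a0 b0 c0 d0; exists (Num.min (Num.min a b) (Num.min c d) / 2).
set m := Num.min _ _.
have m0 : 0 < m by rewrite !lt_min a0 b0 c0 d0.
have : m <= m by []; rewrite {2}/m !le_min => /andP[/andP[? ?] /andP[? ?]].
by split; lra.
Qed.

(** The test function is the plateau over [s, t]: its derivative concentrates at s and at t and
    picks out w s - w t, while the plateau itself tends to the indicator of [s, t]. *)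
Lemma weak_derivative_interior (T s t : R) w g : 0 < s -> s < t -> t < T ->
  {within `[0, T], continuous w} -> L1 0 T g ->
  (forall phi, test_fun T phi ->
     Int (fun r => derive1 phi r * w r) 0 T = - Int (fun r => phi r * g r) 0 T) ->
  w t - w s = Int g s t.
Proof.
move=> s0 st tT cw lg weak.
have T0 : 0 <= T by clear -s0 st tT; lra.
have sT : s <= T by clear -st tT; lra.
have t0 : 0 <= t by clear -s0 st; lra.
have sI : `[0, T]%classic s by rewrite /= in_itv /= (ltW s0).
have tI : `[0, T]%classic t by rewrite /= in_itv /= t0 (ltW tT).
have lag : L1 0 T (fun r => `|g r|) by exact: L1_norm.
(* The primitive of |g| is continuous, so short edges carry little mass of g. *)
have cp : {within `[0, T], continuous (prim (fun r => `|g r|))} by exact: prim_continuous.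
apply/eqP; rewrite -subr_eq0 -normr_le0; apply/ler_addgt0Pr => e e0; rewrite add0r.
(* Two kernels with error e/4 each, and edges of mass e/8, a bound that [Int_plateau] multiplies by
   4, add up to e. *)
have e4 : 0 < e / 4 by rewrite divr_gt0.
have e8 : 0 < e / 8 by rewrite divr_gt0.
move/within_continuousP: (cw) => cw'; move/within_continuousP: (cp) => cp'.
have [d1 d10 H1] := cw' s sI _ e4; have [d2 d20 H2] := cw' t tI _ e4.
have [d3 d30 H3] := cp' s sI _ e8; have [d4 d40 H4] := cp' t tI _ e8.
have [d [d0 dd1 dd2 dd3 dd4]] := min_pos4 d10 d20 d30 d40.
have st2 : 0 < (t - s) / 2 by clear -st; lra.
have [h [h0 hd hst _ _]] := min_pos4 d0 st2 d0 d0.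
have hhst : h + h <= t - s by clear -hst; lra.
have hst1 : h <= t - s by clear -hst st; lra.
have shT : s + h <= T by clear -hst1 tT; lra.
have th0 : 0 <= t - h by clear -hst1 s0; lra.
have := weak _ (plateau_test s0 tT h0 hst1).
set k1 := fun r => h^-1 * ((Int smooth_bump (-1) 1)^-1 * smooth_bump ((r - s) / h + 0)).
set k2 := fun r => h^-1 * ((Int smooth_bump (-1) 1)^-1 * smooth_bump ((r - t) / h + 1)).
have lk1 : L1 0 T (fun r => k1 r * w r).
  apply: L1M_continuous; last exact: continuous_integrable.
  by apply: continuous_subspaceT; exact: ramp_kernel_continuous.
have lk2 : L1 0 T (fun r => k2 r * w r).
  apply: L1M_continuous; last exact: continuous_integrable.
  by apply: continuous_subspaceT; exact: ramp_kernel_continuous.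
have -> : Int (fun r => derive1 (plateau s t h) r * w r) 0 T =
    Int (fun r => k1 r * w r - k2 r * w r) 0 T.
  by apply: eq_Int => x _; rewrite derive_plateau mulrBl.
rewrite IntB// => weak_h.
have a1 : `|Int (fun r => k1 r * w r) 0 T - w s| <= e / 4.
  apply: (ramp_kernel_approx h0 (lt_trans hd dd1)) => //; rewrite ?mul0r ?subr0//.
    exact: ltW.
  by rewrite lexx lerDl ltW.
have a2 : `|Int (fun r => k2 r * w r) 0 T - w t| <= e / 4.
  apply: (ramp_kernel_approx h0 (lt_trans hd dd2)) => //; rewrite ?mul1r// ?subrK ?lexx ?andbT.
    by rewrite gerBl ltW.
  exact: ltW.
have g1 : Int (fun r => `|g r|) s (s + h) <= e / 8.
  rewrite -(@prim_diff _ _ T)//; [|exact: ltW|by rewrite lerDl ltW].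
  apply/ltW/ltr_normlW/H3; first by rewrite /= in_itv /= shT andbT addr_ge0// ltW.
  by rewrite addrC addKr gtr0_norm//; exact: lt_trans hd dd3.
have g2 : Int (fun r => `|g r|) (t - h) t <= e / 8.
  rewrite -(@prim_diff _ _ T)//; [|by rewrite gerBl ltW|exact: ltW].
  apply/ltW/ltr_normlW; rewrite distrC; apply: H4.
    by rewrite /= in_itv /= th0 /= (le_trans _ (ltW tT))// gerBl ltW.
  by rewrite addrC addKr normrN gtr0_norm//; exact: lt_trans hd dd4.
have k12 := Int_plateau (ltW s0) (ltW tT) h0 hhst lg g1 g2.
have aux (I1 I2 I3 I4 x y : R) : I1 - I2 = - I3 -> `|I3 - I4| <= 4 * (e / 8) ->
    `|I1 - x| <= e / 4 -> `|I2 - y| <= e / 4 -> `|y - x - I4| <= e.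
  rewrite !ler_norml; clear => ? /andP[? ?] /andP[? ?] /andP[? ?].
  by apply/andP; split; lra.
exact: aux weak_h k12 a1 a2.
Qed.

(** Test functions see only the open interval. There w minus the primitive of g is constant by
    [weak_derivative_interior], and continuity carries the constant to the end points. *)
Lemma weak_derivative_increment (T s t : R) w g : 0 < T -> 0 <= s -> s <= t -> t <= T ->
  {within `[0, T], continuous w} -> L1 0 T g ->
  (forall phi, test_fun T phi ->
     Int (fun r => derive1 phi r * w r) 0 T = - Int (fun r => phi r * g r) 0 T) ->
  w t - w s = Int g s t.
Proof.
move=> T0 s0 st tT cw lg weak.
have cp : {within `[0, T], continuous (prim g)} by apply: prim_continuous => //; lra.
have cD : {within `[0, T], continuous (fun r => w r - prim g r)}.
  by move=> r; apply: cvgB; [exact: cw|exact: cp].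
have interior r r' : 0 < r -> r < T -> 0 < r' -> r' < T ->
    w r - prim g r = w r' - prim g r'.
  wlog rr : r r' / r <= r' => [H *|].
    by have [rr|/ltW rr] := leP r r'; [|apply/esym]; exact: H.
  move: rr; rewrite le_eqVlt => /predU1P[->//|rr r0 rT r0' rT'].
  have := weak_derivative_interior r0 rr rT' cw lg weak.
  rewrite -(@prim_diff _ _ T)//; [|exact: ltW..].
  by clear; lra.
have const r : 0 <= r -> r <= T -> w r - prim g r = w (T / 2) - prim g (T / 2).
  move=> r0 rT; apply/eqP; rewrite -subr_eq0 -normr_le0; apply/ler_addgt0Pr => e e0.
  rewrite add0r; move/within_continuousP: cD => /(_ r).
  have rT' : `[0, T]%classic r by rewrite /= in_itv /= r0 rT.
  move=> /(_ rT' e e0)[d d0 Hd].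
  pose m := Num.min d T; have m0 : 0 < m by rewrite lt_min d0 T0.
  have : m <= m by []; rewrite {2}/m le_min => /andP[md mT].
  (* A point close to r on the side of the midpoint, hence inside (0, T) even when r is an end
     point. *)
  pose r' := if r <= T / 2 then r + m / 4 else r - m / 4.
  have r'0 : 0 < r' < T.
    rewrite /r'; clear -r0 rT m0 mT T0.
    by case: (leP r (T / 2)) => h; apply/andP; split; lra.
  have [T20 T2T] : 0 < T / 2 /\ T / 2 < T by clear -T0; split; lra.
  rewrite (@interior (T / 2) r')//; [|by case/andP: r'0|by case/andP: r'0].
  rewrite distrC; apply/ltW/Hd.
    by move: r'0; rewrite /= in_itv /= => /andP[/ltW -> /ltW ->].
  rewrite /r'; clear -m0 md.
  by case: ifP => _; rewrite ltr_norml; apply/andP; split; lra.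
have h1 : w s - prim g s = w (T / 2) - prim g (T / 2) by apply: const => //; exact: le_trans tT.
have h2 : w t - prim g t = w (T / 2) - prim g (T / 2) by apply: const => //; exact: le_trans st.
rewrite -(@prim_diff _ _ T)//; move: h1 h2; clear; lra.
Qed.

End du_bois_reymond.

(** * The inner product of L^2 and duality pairings *)

Section L2_inner_product.
Context dX (X : measurableType dX) (R : realType) (nu : {measure set X -> \bar R}).
Implicit Types f g h : L2 nu.

Lemma L2dot_integrable f g : nu.-integrable setT (EFin \o (fun x => L2fun f x * L2fun g x)).
Proof.
apply/Lfun1_integrable.
exact: (Lfun2_mul_Lfun1 (LfunP (L2fun f)) (LfunP (L2fun g))).
Qed.

Lemma L2dotC f g : L2dot f g = L2dot g f.
Proof. by apply: eq_Rintegral => x _; rewrite mulrC. Qed.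

(** [L2fun] picks representatives and is not linear as a map to functions; linearity holds almost
    everywhere by [L2class_repr], which is enough under the integral. *)
Lemma L2dot_linearl a f g h : L2dot (a *: f + g) h = a * L2dot f h + L2dot g h.
Proof.
rewrite /L2dot -RintegralZl//; last exact: L2dot_integrable.
rewrite -RintegralD//; last 2 first.
- exact: (integrableZl _ a (L2dot_integrable f h)).
- exact: L2dot_integrable.
congr fine; apply: ae_eq_integral => //.
- exact: measurable_int (L2dot_integrable _ _).
- apply/measurable_EFinP; apply: measurable_funD.
    apply: measurable_funM => //.
    by apply/measurable_EFinP; exact: measurable_int (L2dot_integrable _ _).
  by apply/measurable_EFinP; exact: measurable_int (L2dot_integrable _ _).
have := L2class_repr (a *: L2fun f + L2fun g).
rewrite L2classD L2funK; apply: filterS => x /= + _.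
by move=> ->; congr (_%:E); rewrite mulrA -mulrDl.
Qed.

Lemma L2dotDl f g h : L2dot (f + g) h = L2dot f h + L2dot g h.
Proof. by rewrite -[f]scale1r L2dot_linearl mul1r scale1r. Qed.

Lemma L2dot0l h : L2dot 0 h = 0.
Proof. by have := L2dotDl 0 0 h; rewrite addr0; lra. Qed.

Lemma L2dotZl a f h : L2dot (a *: f) h = a * L2dot f h.
Proof. by rewrite -[a *: f]addr0 L2dot_linearl L2dot0l addr0. Qed.

Lemma L2dotBl f g h : L2dot (f - g) h = L2dot f h - L2dot g h.
Proof. by rewrite -scaleN1r addrC L2dot_linearl mulN1r addrC. Qed.

Lemma L2dotBr f g h : L2dot h (f - g) = L2dot h f - L2dot h g.
Proof. by rewrite L2dotC L2dotBl !(L2dotC h). Qed.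

Lemma L2dotDr f g h : L2dot h (f + g) = L2dot h f + L2dot h g.
Proof. by rewrite L2dotC L2dotDl !(L2dotC h). Qed.

Lemma L2dotZr a f h : L2dot h (a *: f) = a * L2dot h f.
Proof. by rewrite L2dotC L2dotZl (L2dotC h). Qed.

Lemma L2dot_le f g : `|L2dot f g| <= `|f| * `|g|.
Proof.
apply: le_trans (le_normr_Rintegral _ (L2dot_integrable f g)) _ => //.
have mL k : measurable_fun setT (L2fun (k : L2 nu)).
  by have := LfunP (L2fun k); rewrite inE => /andP[/[!inE]].
have h22 : (2^-1 + 2^-1 = 1 :> R)%R by rewrite [RHS]splitr !div1r.
(* Cauchy-Schwarz as Hoelder's inequality with both exponents 2. The norms are finite, so the
   inequality descends from the extended reals. *)
have := @hoelder _ _ _ nu (L2fun f) (L2fun g) 2 2 (mL f) (mL g) (ltr0n _ 2) (ltr0n _ 2) h22.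
rewrite Lnorm1 -(finite_norm_fine (L2fun f)) -(finite_norm_fine (L2fun g)).
rewrite -EFinM; set I := integral _ _ _ => hI.
have Ifin : I \is a fin_num.
  by rewrite ge0_fin_numE ?integral_ge0//; apply: le_lt_trans hI _; exact: ltry.
by rewrite -(fineK Ifin) lee_fin in hI.
Qed.

End L2_inner_product.

Section pairings.
Context {R : realType}.

Lemma cvg0_le (a b : nat -> R) : (forall n, `|a n| <= b n) ->
  b n @[n --> \oo] --> (0 : R) -> a n @[n --> \oo] --> (0 : R).
Proof.
move=> ab b0; apply/cvgrPdist_lt => e e0; move/cvgrPdist_lt: b0 => /(_ e e0).
apply: filterS => n; rewrite !sub0r !normrN; apply: le_lt_trans.
exact: le_trans (ab n) (ler_norm _).
Qed.

Lemma bounded_bilinear_seq_continuous (E F : normedModType R) (phi : E -> F -> R^o) (C : R) :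
  (forall x x' y, phi (x - x') y = phi x y - phi x' y) ->
  (forall x y y', phi x (y - y') = phi x y - phi x y') ->
  (forall x y, `|phi x y| <= C * `|x| * `|y|) -> seq_continuous2 phi.
Proof.
move=> lin1 lin2 phiC x_ y_ x y xx yy.
apply/subr_cvg0.
have -> : (fun n => phi (x_ n) (y_ n) - phi x y) =
    (fun n => phi (x_ n - x) (y_ n) + phi x (y_ n - y)).
  by apply/funext => n; rewrite lin1 lin2 addrA subrK.
suff h1 : phi (x_ n - x) (y_ n) @[n --> \oo] --> (0 : R).
  suff h2 : phi x (y_ n - y) @[n --> \oo] --> (0 : R).
    have := cvgD h1 h2; rewrite addr0; exact.
  apply: (@cvg0_le _ (fun n => C * `|x| * `|y_ n - y|)) => //.
  have : C * `|x| * `|y_ n - y| @[n --> \oo] --> C * `|x| * `|y - y|.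
    apply: cvgM; first exact: cvg_cst.
    by apply: cvg_norm; apply: cvgB => //; exact: cvg_cst.
  by rewrite subrr normr0 mulr0.
apply: (@cvg0_le _ (fun n => C * `|x_ n - x| * `|y_ n|)) => //.
have : C * `|x_ n - x| * `|y_ n| @[n --> \oo] --> C * `|x - x| * `|y|.
  apply: cvgM; last exact: cvg_norm.
  apply: cvgM; first exact: cvg_cst.
  by apply: cvg_norm; apply: cvgB => //; exact: cvg_cst.
by rewrite subrr normr0 mulr0 mul0r.
Qed.

Lemma dual_pairBl (E : normedModType R) (F G : topdual E) (v : E) :
  <| F - G, v |> = <| F, v |> - <| G, v |>.
Proof. by []. Qed.

Lemma dual_pairBr (E : normedModType R) (F : topdual E) (v w : E) :
  <| F, v - w |> = <| F, v |> - <| F, w |>.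
Proof. exact: (raddfB F). Qed.

Lemma dual_pair_le (E : normedModType R) (F : topdual E) (v : E) :
  `|<| F, v |>| <= 1 * `|F| * `|v|.
Proof. by rewrite mul1r; exact: ler_dual_norm. Qed.

Lemma dual_pair_seq_continuous (E : normedModType R) :
  seq_continuous2 (fun (F : topdual E) v => <| F, v |> : R^o).
Proof.
apply: (@bounded_bilinear_seq_continuous _ _ _ 1).
- exact: dual_pairBl.
- exact: dual_pairBr.
- exact: dual_pair_le.
Qed.

Lemma L2dot_seq_continuous dX (X : measurableType dX) (nu : {measure set X -> \bar R}) :
  seq_continuous2 (fun f g : L2 nu => L2dot f g : R^o).
Proof.
apply: (@bounded_bilinear_seq_continuous _ _ _ 1).
- by move=> f g h; rewrite L2dotBl.
- by move=> f g h; rewrite L2dotBr.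
- by move=> f g; rewrite mul1r; exact: L2dot_le.
Qed.

Lemma inL2_dual_pair (E : normedModType R) (T : R) (G : R -> topdual E) (Z : R -> E) :
  inL2 T G -> inL2 T Z ->
  lebesgue_measure.-integrable `[0, T] (EFin \o (fun t => <| G t, Z t |>)).
Proof.
exact: (inL2_pairing (@dual_pair_seq_continuous E) (@dual_pair_le E)).
Qed.

Lemma within_L2dot dX (X : measurableType dX) (nu : {measure set X -> \bar R})
    (A : set R) (f g : R -> L2 nu) :
  {within A, continuous f} -> {within A, continuous g} ->
  {within A, continuous (fun t => L2dot (f t) (g t))}.
Proof.
move=> /within_continuousP cf /within_continuousP cg.
apply/(@within_continuousP R R^o) => x Ax e e0.
pose M := `|f x| + `|g x| + 1.
have M0 : 0 < M by rewrite /M ltr_wpDl// addr_ge0.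
have e1 : 0 < Num.min 1 (e / (2 * M)) by rewrite lt_min ltr01 divr_gt0// mulr_gt0.
have [d1 d10 H1] := cf x Ax _ e1; have [d2 d20 H2] := cg x Ax _ e1.
exists (Num.min d1 d2); first by rewrite lt_min d10.
move=> y Ay; rewrite lt_min => /andP[y1 y2].
have := H1 y Ay y1; have := H2 y Ay y2; rewrite !lt_min => /andP[g1 g2] /andP[f1 f2].
have -> : L2dot (f y) (g y) - L2dot (f x) (g x) =
    L2dot (f y - f x) (g y) + L2dot (f x) (g y - g x).
  by rewrite L2dotBl L2dotBr addrA subrK.
apply: le_lt_trans (ler_normD _ _) _.
have gy : `|g y| <= M.
  rewrite -[X in `|X|](subrK (g x)); apply: le_trans (ler_normD _ _) _.
  by rewrite /M; have := normr_ge0 (f x); lra.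
have fx : `|f x| <= M by rewrite /M; have := normr_ge0 (g x); lra.
have b1 : `|L2dot (f y - f x) (g y)| < e / 2.
  apply: le_lt_trans (L2dot_le _ _) _.
  apply: (@le_lt_trans _ _ (`|f y - f x| * M)); first by rewrite ler_wpM2l.
  by move: f2; rewrite -(ltr_pM2r M0) invfM mulrA mulfVK// lt0r_neq0.
have b2 : `|L2dot (f x) (g y - g x)| < e / 2.
  apply: le_lt_trans (L2dot_le _ _) _.
  apply: (@le_lt_trans _ _ (M * `|g y - g x|)); first by rewrite ler_wpM2r.
  by rewrite mulrC; move: g2; rewrite -(ltr_pM2r M0) invfM mulrA mulfVK// lt0r_neq0.
by lra.
Qed.

End pairings.

(** * Integration by parts in the Gelfand triple *)

Section integral_sums.
Context {R : realType}.
Local Notation mu := (@lebesgue_measure R).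
Local Notation Int f a b := (\int[mu]_(x in `[a, b]) f x).
Local Notation L1 a b f := (mu.-integrable `[a, b] (EFin \o f)).

Lemma L1_sum (I : eqType) (F : seq I) (f : I -> R -> R) a b :
  (forall i, i \in F -> L1 a b (f i)) -> L1 a b (fun x => \sum_(i <- F) f i x).
Proof.
elim: F => [_|i F IH lf].
  by apply: (eq_L1 _ (cst_integrable a b 0)) => x _; rewrite big_nil.
have li : L1 a b (f i) by apply: lf; rewrite mem_head.
have lF : L1 a b (fun x => \sum_(i <- F) f i x).
  by apply: IH => k kF; apply: lf; rewrite inE kF orbT.
by apply: (eq_L1 _ (L1D li lF)) => x _; rewrite big_cons.
Qed.

Lemma Int_sum (I : eqType) (F : seq I) (f : I -> R -> R) a b :
  (forall i, i \in F -> L1 a b (f i)) ->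
  Int (fun x => \sum_(i <- F) f i x) a b = \sum_(i <- F) Int (f i) a b.
Proof.
elim: F => [_|i F IH lf].
  rewrite big_nil (@eq_Int _ _ (fun=> 0)); last by move=> x _; rewrite big_nil.
  by rewrite Rintegral_cst// mul0r.
have lF k : k \in F -> L1 a b (f k) by move=> kF; apply: lf; rewrite inE kF orbT.
rewrite big_cons -IH// -IntD//; [|by apply: lf; rewrite mem_head|exact: L1_sum].
by apply: eq_Int => x _; rewrite big_cons.
Qed.

Lemma Int_subitv (f : R -> R) (a b c d : R) : a <= c -> c <= d -> d <= b -> L1 a b f ->
  (forall x, a <= x <= b -> 0 <= f x) -> Int f c d <= Int f a b.
Proof.
move=> ac cd db lf f0.
have ldb : L1 c b f by apply: integrable_itvS lf; lra.
rewrite (@Int_split _ _ a b c)//; [|exact: le_trans db].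
rewrite (@Int_split _ _ c b d)// addrCA lerDl addr_ge0//.
  by apply: Int_ge0 => x /andP[ax xc]; apply: f0; apply/andP; split; lra.
by apply: Int_ge0 => x /andP[ax xc]; apply: f0; apply/andP; split; lra.
Qed.

Lemma lebesgue_ae_filter : Filter (almost_everywhere mu).
Proof. exact: ae_filter_ringOfSetsType. Qed.

Lemma ae_eq_Int (f g : R -> R) (a b : R) : measurable_fun `[a, b] f ->
  measurable_fun `[a, b] g -> {ae mu, forall t : R, t \in `[a, b] -> f t = g t} ->
  Int f a b = Int g a b.
Proof.
move=> mf mg fg; congr fine; apply: ae_eq_integral => //.
- exact/measurable_EFinP.
- exact/measurable_EFinP.
- move: fg; apply: (@filterS _ _ lebesgue_ae_filter) => x fgx /=.
  by rewrite in_itv /= => xab; rewrite fgx// in_itv.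
Qed.

End integral_sums.

(** * Diagonal limits of averaged duality pairings *)

Section diagonal.
Context {R : realType} (V : normedModType R) (T : R).
Local Notation mu := (@lebesgue_measure R).
Local Notation Int f a b := (\int[mu]_(x in `[a, b]) f x).
Local Notation L1 a b f := (mu.-integrable `[a, b] (EFin \o f)).
Hypothesis T0 : 0 < T.

(** A simple function takes finitely many values, so one window length can serve all of them. *)
Lemma avg_cvg_seq (I : Type) (F : seq I) (g : I -> R -> R) (e : R) :
  (forall i, L1 0 T (g i)) -> 0 < e ->
  exists2 d : R, 0 < d & forall a b : R, 0 <= a -> 0 <= b -> 0 < a + b -> a + b < d ->
    a + b <= T ->
    \sum_(i <- F) Int (fun t => `|avg a b (g i) t - g i t|) a (T - b) <= e.
Proof.
move=> lg; elim: F e => [|i F IH] e e0.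
  by exists 1 => // *; rewrite big_nil ltW.
have e2 : 0 < e / 2 by rewrite divr_gt0.
have [d1 d10 H1] := avg_cvg T0 (lg i) e2; have [d2 d20 H2] := IH _ e2.
exists (Num.min d1 d2); first by rewrite lt_min d10.
move=> a b a0 b0 ab0; rewrite lt_min => /andP[ab1 ab2] abT.
by rewrite big_cons; have := H1 a b a0 b0 ab0 ab1 abT; have := H2 a b a0 b0 ab0 ab2 abT; lra.
Qed.

Lemma young (x y eta : R) : 0 < eta -> x * y <= eta * x ^+ 2 + eta^-1 * y ^+ 2.
Proof.
move=> eta0; rewrite -subr_ge0.
have -> : eta * x ^+ 2 + eta^-1 * y ^+ 2 - x * y =
    eta * ((x - eta^-1 * y / 2) ^+ 2 + 3 / 4 * (eta^-1 * y) ^+ 2).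
  by field; exact: lt0r_neq0.
apply: mulr_ge0; first exact: ltW.
by apply: addr_ge0; [exact: sqr_ge0|apply: mulr_ge0; [lra|exact: sqr_ge0]].
Qed.

(* The pairing of G and Z is approximated by replacing Z by a simple function, for
   which only finitely many scalar averages are involved; Young's inequality
   and [avg_contraction] make the error uniform in the averaging length. *)
Lemma diagonal_limit (G : R -> topdual V) (Z : R -> V) (e : R) :
  inL2 T G -> inL2 T Z -> 0 < e ->
  exists2 d : R, 0 < d & forall (a b : R) (A : R -> R), 0 <= a -> 0 <= b -> 0 < a + b ->
    a + b < d -> a + b <= T -> L1 a (T - b) A ->
    (forall t, a <= t <= T - b ->
       A t = (a + b)^-1 * Int (fun r => <| G r, Z t |>) (t - a) (t + b)) ->
    `|Int A a (T - b) - Int (fun t => <| G t, Z t |>) a (T - b)| <= e.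
Proof.
move=> hG hZ e0.
have lG2 := inL2_L1_sqr hG.
pose NG := Int (fun t => `|G t| ^+ 2) 0 T.
have NG0 : 0 <= NG by apply: Int_ge0 => t _; exact: sqr_ge0.
(* The weight in Young's inequality: eta NG <= e/8 makes the terms in |G|^2 small, and the summand 1
   covers NG = 0. The price eta^-1 falls on |Z - S|^2, which is why S is chosen within eta e/8 of
   Z. *)
pose eta := e / (8 * (NG + 1)).
have eta0 : 0 < eta by rewrite divr_gt0// mulr_gt0// ltr_wpDl.
have etaNG : eta * NG <= e / 8.
  rewrite /eta mulrAC ler_pdivrMr ?mulr_gt0 ?ltr_wpDl//.
  have -> : e / 8 * (8 * (NG + 1)) = e * NG + e by clear; field.
  by rewrite lerDl ltW.
have del0 : 0 < eta * (e / 8) by rewrite mulr_gt0// divr_gt0.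
have [S [sS hS ZS]] := inL2_simple_approx del0 hZ.
have [F rF] : exists F : seq V, range S = [set` F] by apply/finite_seqP; exact: sS.1.
have SF t : S t \in F.
  by have : range S (S t) by []; rewrite rF.
pose g (v : V) t := <| G t, v |>.
have lg v : L1 0 T (g v) by apply: inL2_dual_pair => //; exact: inL2_cst.
have e2 : 0 < e / 2 by rewrite divr_gt0.
have [d d0 Hd] := avg_cvg_seq F lg e2.
(* The averaged pairing enters as an abstract A, which leaves its integrability to the caller. *)
exists d => // a b A a0 b0 ab0 abd abT lA AE.
have hdom : 0 <= a /\ T - b <= T by clear -a0 b0; split; lra.
have aTb : a <= T - b by clear -abT; lra.
pose Y t := `|Z t - S t| ^+ 2.
have lY : L1 0 T Y by exact: inL2_L1_sqr (inL2B hZ hS).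
have sub f : L1 0 T f -> L1 a (T - b) f by move=> lf; apply: integrable_itvS lf; case: hdom.
have abV : 0 < (a + b)^-1 by rewrite invr_gt0.
pose K1 t := eta * avg a b (fun r => `|G r| ^+ 2) t + eta * `|G t| ^+ 2.
pose K2 t := 2 * eta^-1 * Y t.
pose K3 t := \sum_(v <- F) `|avg a b (g v) t - g v t|.
have lavgG : L1 a (T - b) (avg a b (fun r => `|G r| ^+ 2)) by exact: avg_L1.
have lK1 : L1 a (T - b) K1 by apply: L1D; apply: L1Z => //; exact: sub.
have lK2 : L1 a (T - b) K2 by apply: L1Z; exact: sub.
have lavg v : L1 a (T - b) (fun t => `|avg a b (g v) t - g v t|).
  by apply: L1_norm; apply: L1B; [exact: avg_L1|exact: sub].
have lK3 : L1 a (T - b) K3 by exact: L1_sum.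
have lGZ : L1 a (T - b) (fun t => <| G t, Z t |>) by apply: sub; exact: inL2_dual_pair.
have pairing_young r y : `|<| G r, y |>| <= eta * `|G r| ^+ 2 + eta^-1 * `|y| ^+ 2.
  by apply: le_trans (dual_pair_le _ _) _; rewrite mul1r; exact: young.
(* Replacing Z t by S t, in the average and on the diagonal, costs K1 and K2. What is left is the
   averaging error of the scalar function <G, S t>, one of the finitely many collected in K3. *)
have pointwise t : a <= t <= T - b -> `|A t - <| G t, Z t |>| <= K1 t + K2 t + K3 t.
  move=> tab; rewrite AE//; have [ta tb] : 0 <= t - a /\ t + b <= T.
    by clear -tab; move/andP: tab => [? ?]; split; lra.
  have tatb : t - a <= t + b by clear -a0 b0; lra.
  have lgt v : L1 (t - a) (t + b) (g v) by exact: integrable_itvS (lg v).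
  have lGt : L1 (t - a) (t + b) (fun r => `|G r| ^+ 2) by exact: integrable_itvS lG2.
  have -> : (a + b)^-1 * Int (fun r => <| G r, Z t |>) (t - a) (t + b) =
      (a + b)^-1 * Int (g (Z t - S t)) (t - a) (t + b) + avg a b (g (S t)) t.
    rewrite /avg -mulrDr -IntD//; congr (_ * _); apply: eq_Int => r _.
    by rewrite /g dual_pairBr subrK.
  have b1 : `|(a + b)^-1 * Int (g (Z t - S t)) (t - a) (t + b)| <=
      eta * avg a b (fun r => `|G r| ^+ 2) t + eta^-1 * Y t.
    rewrite normrM gtr0_norm// /avg.
    have -> : eta * ((a + b)^-1 * Int (fun r => `|G r| ^+ 2) (t - a) (t + b)) + eta^-1 * Y t =
        (a + b)^-1 * Int (fun r => eta * `|G r| ^+ 2 + eta^-1 * Y t) (t - a) (t + b).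
      rewrite IntD; [|exact: L1Z|exact: cst_integrable].
      rewrite IntZ// Int_cst// mulrDr [eta * (_ * _)]mulrCA; congr (_ + _).
      have -> : t + b - (t - a) = a + b by clear; lra.
      by rewrite [RHS]mulrC mulfK// lt0r_neq0.
    rewrite ler_pM2l//; apply: norm_Int_le => //; last by move=> r _; exact: pairing_young.
    by apply: L1D; [exact: L1Z|exact: cst_integrable].
  have b2 : `|<| G t, Z t |> - g (S t) t| <= eta * `|G t| ^+ 2 + eta^-1 * Y t.
    by rewrite /g -dual_pairBr; exact: pairing_young.
  have b3 : `|avg a b (g (S t)) t - g (S t) t| <= K3 t.
    rewrite /K3 (big_rem _ (SF t)) /= lerDl; exact: sumr_ge0.
  have aux (x1 x2 x3 x4 y1 y2 y3 y4 : R) : `|x1| <= y1 + y3 -> `|x3 - x4| <= y2 + y3 ->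
      `|x2 - x4| <= y4 -> `|x1 + x2 - x3| <= y1 + y2 + (2 * y3) + y4.
    rewrite !ler_norml; clear => /andP[? ?] /andP[? ?] /andP[? ?].
    by apply/andP; split; lra.
  by rewrite /K1 /K2 -[2 * _ * _]mulrA; exact: aux b1 b2 b3.
rewrite -IntB//.
apply: le_trans (norm_Int_le (L1B lA lGZ) (L1D (L1D lK1 lK2) lK3) pointwise) _.
rewrite IntD//; last exact: L1D.
rewrite IntD//.
have i1 : Int K1 a (T - b) <= e / 4.
  rewrite IntD; [|exact: L1Z|by apply: L1Z; exact: sub].
  rewrite (IntZ _ lavgG) (IntZ _ (sub _ lG2)).
  have c1 : Int (avg a b (fun r => `|G r| ^+ 2)) a (T - b) <= NG.
    by apply: (avg_contraction a0 b0 _ lG2) => [|x _]; [rewrite ab0|exact: sqr_ge0].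
  have c2 : Int (fun r => `|G r| ^+ 2) a (T - b) <= NG.
    by apply: Int_subitv => //; case: hdom.
  apply: (@le_trans _ _ (eta * NG + eta * NG)).
    by apply: lerD; rewrite ler_pM2l.
  by move: etaNG; clear; set x := eta * NG; lra.
have i2 : Int K2 a (T - b) <= e / 4.
  rewrite IntZ; last exact: sub.
  have c2 : Int Y a (T - b) <= eta * (e / 8).
    apply: le_trans _ (ltW ZS); have [_ Tb] := hdom.
    by apply: Int_subitv => // x _; exact: sqr_ge0.
  apply: (@le_trans _ _ (2 * eta^-1 * (eta * (e / 8)))).
    apply: ler_wpM2l; last exact: c2.
    by apply: mulr_ge0 => //; rewrite invr_ge0 ltW.
  have -> : 2 * eta^-1 * (eta * (e / 8)) = e / 4 by field; exact: lt0r_neq0.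
  by [].
have i3 : Int K3 a (T - b) <= e / 2 by rewrite Int_sum//; exact: Hd.
have -> : e = e / 4 + e / 4 + e / 2 by field.
by rewrite !lerD.
Qed.

End diagonal.

Section clamp.
Context {R : realType}.

Definition clamp (a b t : R) : R := Num.max a (Num.min t b).

Lemma clamp_itv a b t : a <= b -> a <= clamp a b t <= b.
Proof. by move=> ab; rewrite /clamp le_max lexx ge_max ab ge_min lexx orbT. Qed.

Lemma clamp_id a b t : a <= t <= b -> clamp a b t = t.
Proof. by move=> /andP[at_ tb]; rewrite /clamp min_l// max_r. Qed.

Lemma clamp_lipschitz a b s t : a <= b -> `|clamp a b s - clamp a b t| <= `|s - t|.
Proof.
move=> ab; have := ler_norm (s - t); have := ler_norm (t - s); rewrite (distrC t s).
set n := `|s - t| => n1 n2; rewrite ler_norml /clamp.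
case: (leP s b) => sb; case: (leP t b) => tb; case: (leP a s) => as_;
  case: (leP a t) => at_; case: (leP a b) => ab_; apply/andP; split; lra.
Qed.

Lemma clamp_continuous a b : a <= b -> continuous (clamp a b).
Proof.
move=> ab t; apply/cvgrPdist_lt => e e0.
have /cvgrPdist_lt/(_ e e0) : x @[x --> t] --> t by exact: cvg_id.
by apply: filterS => s; apply: le_lt_trans; exact: clamp_lipschitz.
Qed.

(** This extends f from [a, b] to the whole line, where [strongly_measurable_continuous] applies. *)
Lemma continuous_comp_clamp (U : normedModType R) (f : R -> U) a b : a <= b ->
  {within `[a, b], continuous f} -> continuous (fun t => f (clamp a b t)).
Proof.
move=> ab /within_continuousP cf t; apply/cvgrPdist_lt => e e0.
have tab : `[a, b]%classic (clamp a b t) by rewrite /= in_itv /= clamp_itv.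
have [d d0 Hd] := cf _ tab _ e0.
have /cvgrPdist_lt/(_ d d0) : x @[x --> t] --> t by exact: cvg_id.
apply: filterS => s; rewrite distrC => std.
rewrite distrC; apply: Hd; first by rewrite /= in_itv /= clamp_itv.
exact: le_lt_trans (clamp_lipschitz _ _ ab) std.
Qed.

End clamp.

Section arithmetic.
Context {R : realType}.

(** Linear arithmetic is stated on plain variables, so that [lra] does not meet the integrals they
    stand for. *)
Lemma telescope_halves (a b c d f g : R) : a = b + c -> a = d + f -> g - d + (c - g) = f - b.
Proof. by lra. Qed.

Lemma six_errors (e x1 x2 y1 y2 a1 a2 i1 i2 b1 b2 : R) : x1 + x2 = y1 - y2 ->
  `|x1 - a1| <= e / 6 -> `|x2 - a2| <= e / 6 -> `|a1 - i1| <= e / 6 ->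
  `|a2 - i2| <= e / 6 -> `|y1 - b1| <= e / 6 -> `|y2 - b2| <= e / 6 ->
  `|i1 + i2 - (b1 - b2)| <= e.
Proof.
rewrite !ler_norml => ? /andP[? ?] /andP[? ?] /andP[? ?] /andP[? ?] /andP[? ?] /andP[? ?].
by apply/andP; split; lra.
Qed.

End arithmetic.

Section integration_by_parts.
Context {dX : measure_display} {X : measurableType dX} {R : realType}
        {nu : {measure set X -> \bar R}} {V : normedModType R}
        (iota : {linear V -> L2 nu}) (T : R).
Local Notation mu := (@lebesgue_measure R).
Local Notation Int f a b := (\int[mu]_(x in `[a, b]) f x).
Local Notation L1 a b f := (mu.-integrable `[a, b] (EFin \o f)).
Hypothesis T0 : 0 < T.
Hypothesis ciota : continuous iota.

Lemma inL2_iota_sm (u : R -> V) : inL2 T u -> strongly_measurable `[0, T] (fun t => iota (u t)).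
Proof. by case=> su _; exact: strongly_measurable_comp ciota su. Qed.

(** Du Bois-Reymond for the scalar function (uc, v). The weak derivative is stated for iota (u t),
    which agrees with uc only almost everywhere, so its left-hand integral is first rewritten. *)
Lemma weak_time_derivative_increment (u : R -> V) (uc : R -> L2 nu) (du : R -> topdual V)
    (v : V) (s t : R) :
  inL2 T u -> inL2 T du -> weak_time_derivative iota T u du ->
  continuous_representative iota T u uc -> 0 <= s -> s <= t -> t <= T ->
  L2dot (uc t - uc s) (iota v) = Int (fun r => <| du r, v |>) s t.
Proof.
move=> hu hdu weak [cuc aeu] s0 st tT; rewrite L2dotBl.
have cw : {within `[0, T], continuous (fun r => L2dot (uc r) (iota v))}.
  by apply: within_L2dot => //; apply: continuous_subspaceT; exact: cst_continuous.
have lg : L1 0 T (fun r => <| du r, v |>) by apply: inL2_dual_pair => //; exact: inL2_cst.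
apply: (@weak_derivative_increment _ T s t (fun r => L2dot (uc r) (iota v))
  (fun r => <| du r, v |>)) => // phi tphi.
rewrite -(weak phi tphi v); apply: ae_eq_Int.
- apply: measurable_funM; last exact: subspace_continuous_measurable_fun.
  apply: subspace_continuous_measurable_fun => //; apply: continuous_subspaceT => r.
  apply: differentiable_continuous; apply/derivable1_diffP.
  by case: tphi => /(_ 1%N r).
- apply: measurable_funM.
    apply: subspace_continuous_measurable_fun => //; apply: continuous_subspaceT => r.
    apply: differentiable_continuous; apply/derivable1_diffP.
    by case: tphi => /(_ 1%N r).
  apply: strongly_measurable_real => //.
  apply: (strongly_measurable_comp2 (@L2dot_seq_continuous _ _ _ nu)).
    exact: inL2_iota_sm.
  exact: strongly_measurable_cst.
- by move: aeu; apply: (@filterS _ _ lebesgue_ae_filter) => r h rT; rewrite h.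
Qed.

Definition weak_pair (u : R -> V) (uc : R -> L2 nu) (du : R -> topdual V) :=
  [/\ inL2 T u, inL2 T du, weak_time_derivative iota T u du &
      continuous_representative iota T u uc].

(** With t frozen, taking v = z t in [weak_time_derivative_increment] turns the quotient into an
    average of <du r, z t> over r, the situation of [diagonal_limit]. *)
Lemma weak_pair_diagonal (u z : R -> V) (uc zc : R -> L2 nu) (du : R -> topdual V) (e : R) :
  weak_pair u uc du -> inL2 T z -> continuous_representative iota T z zc -> 0 < e ->
  exists2 d : R, 0 < d & forall a b : R, 0 <= a -> 0 <= b -> 0 < a + b ->
    a + b < d -> a + b <= T ->
    `|(a + b)^-1 * Int (fun t => L2dot (uc (t + b) - uc (t - a)) (zc t)) a (T - b) -
      Int (fun t => <| du t, z t |>) a (T - b)| <= e.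
Proof.
move=> [hu hdu weak ru] hz rz e0.
have [d d0 Hd] := diagonal_limit T0 hdu hz e0; exists d => // a b a0 b0 ab0 abd abT.
have [cuc _] := ru; have [czc aez] := rz.
have [ab0' aab Tbb Tba] : [/\ 0 <= a + b, 0 <= a - a, T - b + b <= T & T - b - a <= T].
  by split; lra.
have cd : {within `[a, T - b], continuous (fun t => uc (t + b) - uc (t - a))}.
  have c1 : {within `[a, T - b], continuous (fun t => uc (t + b))}.
    by apply: within_shift; exact: within_itvS ab0' Tbb cuc.
  have c2 : {within `[a, T - b], continuous (fun t => uc (t - a))}.
    by apply: within_shift; exact: within_itvS aab Tba cuc.
  by move=> t; apply: cvgB; [exact: c1|exact: c2].
have sub : `[a, T - b] `<=` `[0, T].
  move=> x /=; rewrite !in_itv /= => /andP[h1 h2].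
  by apply/andP; split; lra.
have czc' : {within `[a, T - b], continuous zc} by exact: continuous_subspaceW czc.
pose D t := L2dot (uc (t + b) - uc (t - a)) (zc t).
(* zc is traded for iota (z t), since the increment identity tests with elements of V only. D and D'
   agree almost everywhere, and D' inherits integrability from D once it is known to be
   measurable. *)
pose D' t := L2dot (uc (t + b) - uc (t - a)) (iota (z t)).
have lD : L1 a (T - b) D by apply: continuous_integrable; exact: within_L2dot.
have D'E t : a <= t <= T - b -> D' t = Int (fun r => <| du r, z t |>) (t - a) (t + b).
  move=> /andP[t1 t2]; apply: (weak_time_derivative_increment _ hu hdu weak ru).
  - by lra.
  - by lra.
  - by lra.
have T0' : 0 <= T by exact: ltW.
have mD' : measurable_fun `[a, T - b] D'.
  (* Clamping makes the increment of uc continuous on the whole line without changing it on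
     [a, T - b]. *)
  pose cl t := uc (clamp 0 T (t + b)) - uc (clamp 0 T (t - a)).
  have ccl : continuous cl.
    have cc := continuous_comp_clamp T0' cuc.
    move=> t; apply: cvgB.
      apply: (@cvg_comp _ _ _ (fun t : R => t + b) (fun t => uc (clamp 0 T t)) _ (nbhs (t + b))).
        by apply: cvgD; [exact: cvg_id|exact: cvg_cst].
      exact: cc.
    apply: (@cvg_comp _ _ _ (fun t : R => t - a) (fun t => uc (clamp 0 T t)) _ (nbhs (t - a))).
      by apply: cvgB; [exact: cvg_id|exact: cvg_cst].
    exact: cc.
  have m : measurable_fun `[0, T]%classic (fun t => L2dot (cl t) (iota (z t))).
    apply: strongly_measurable_real => //.
    apply: (strongly_measurable_comp2 (@L2dot_seq_continuous _ _ _ nu)).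
      exact: strongly_measurable_continuous.
    exact: inL2_iota_sm.
  apply: eq_measurable_fun (measurable_funS _ sub m) => //.
  move=> t; rewrite inE /= in_itv /= => /andP[t1 t2]; rewrite /cl /D' !clamp_id//.
    by apply/andP; split; lra.
  by apply/andP; split; lra.
have DD' : Int D a (T - b) = Int D' a (T - b).
  apply: ae_eq_Int => //; first exact: L1_measurable.
  move: aez; apply: (@filterS _ _ lebesgue_ae_filter) => t h tab.
  by rewrite /D /D' h//; exact: sub.
have lD' : L1 a (T - b) D'.
  apply/integrableP; split; first exact/measurable_EFinP.
  have /integrableP[_] := lD; apply: le_lt_trans.
  rewrite le_eqVlt; apply/orP; left; apply/eqP.
  apply: ae_eq_integral; [exact: measurable_itv| | |].
  - by apply: measurableT_comp => //; exact/measurable_EFinP.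
  - by apply: measurableT_comp => //; apply/measurable_EFinP; exact: L1_measurable.
  move: aez; apply: (@filterS _ _ lebesgue_ae_filter) => t h tab /=.
  by rewrite /D /D' h//; exact: sub.
rewrite -[Int (fun t => L2dot _ _) _ _]/(Int D _ _) DD' -IntZ//.
apply: Hd => //; first exact: L1Z.
by move=> t tab; rewrite D'E.
Qed.

(* The forward differences of [u] against [z] and the backward differences of [z]
   against [u] have cancelling mixed terms, so that their sum is an
   integral over the two end pieces of the interval. *)
Lemma Int_cross_differences (uc zc : R -> L2 nu) (h : R) :
  {within `[0, T], continuous uc} -> {within `[0, T], continuous zc} ->
  0 < h -> h <= T ->
  Int (fun t => L2dot (uc (t + h) - uc (t - 0)) (zc t)) 0 (T - h) +
  Int (fun t => L2dot (zc (t + 0) - zc (t - h)) (uc t)) h (T - 0) =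
  Int (fun t => L2dot (uc t) (zc t)) (T - h) T - Int (fun t => L2dot (uc t) (zc t)) 0 h.
Proof.
move=> cu cz h0 hT; rewrite subr0.
have h0' : 0 <= h by exact: ltW.
have Th0 : 0 <= T - h by rewrite subr_ge0.
have ThT : T - h <= T by rewrite gerBl.
have cuz : {within `[0, T], continuous (fun t => L2dot (uc t) (zc t))} by exact: within_L2dot.
have luz : L1 0 T (fun t => L2dot (uc t) (zc t)) by exact: continuous_integrable.
have sub1 : {within `[0, T - h], continuous (fun t => uc (t + h))}.
  by apply: within_shift; apply: within_itvS cu; rewrite ?add0r// subrK.
have sub2 : {within `[h, T], continuous (fun t => zc (t - h))}.
  by apply: within_shift; apply: within_itvS cz; rewrite ?subrr.
have cz1 : {within `[0, T - h], continuous zc} by apply: within_itvS cz.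
have cu2 : {within `[h, T], continuous uc} by apply: within_itvS cu.
pose F t := L2dot (uc t) (zc (t - h)).
have cF : {within `[h, T], continuous F} by exact: within_L2dot.
have lF : L1 h T F by exact: continuous_integrable.
have lF1 : L1 0 (T - h) (fun t => L2dot (uc (t + h)) (zc t)).
  by apply: continuous_integrable; exact: within_L2dot.
have -> : Int (fun t => L2dot (uc (t + h) - uc (t - 0)) (zc t)) 0 (T - h) =
    Int F h T - Int (fun t => L2dot (uc t) (zc t)) 0 (T - h).
  have -> : Int F h T = Int (fun t => L2dot (uc (t + h)) (zc t)) 0 (T - h).
    have hs := @Int_shift R F 0 (T - h) h; rewrite add0r subrK in hs.
    by rewrite -(hs cF); apply: eq_Int => t _; rewrite /F addrK.
  rewrite -IntB//; last exact: integrable_itvS luz.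
  by apply: eq_Int => t _; rewrite subr0 L2dotBl.
have -> : Int (fun t => L2dot (zc (t + 0) - zc (t - h)) (uc t)) h T =
    Int (fun t => L2dot (uc t) (zc t)) h T - Int F h T.
  rewrite -IntB//; last exact: integrable_itvS luz.
  by apply: eq_Int => t _; rewrite addr0 L2dotC L2dotBr.
have e1 := @Int_split _ (fun t => L2dot (uc t) (zc t)) 0 T h h0' hT luz.
have e2 := @Int_split _ (fun t => L2dot (uc t) (zc t)) 0 T (T - h) Th0 ThT luz.
exact: telescope_halves e1 e2.
Qed.

(** The window need not be centred at c, which may be one of its ends; traces at 0 and T require
    this. *)
Lemma avg_endpoint (w : R -> R) (c e : R) : {within `[0, T], continuous w} ->
  0 <= c <= T -> 0 < e ->
  exists2 d : R, 0 < d & forall a b : R, 0 <= a -> a < b -> b <= T -> a <= c <= b ->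
    b - a < d -> `|(b - a)^-1 * Int w a b - w c| <= e.
Proof.
move=> cw c0T e0; have lw : L1 0 T w by exact: continuous_integrable.
have cI : `[0, T]%classic c by rewrite /= in_itv.
have [d d0 Hd] := (within_continuousP _ _).1 cw c cI e e0.
exists d => // a b a0 ab bT /andP[ac cb] abd.
have lab : L1 a b w by exact: integrable_itvS lw.
have ba0 : 0 < b - a by rewrite subr_gt0.
have -> : w c = (b - a)^-1 * Int (fun=> w c) a b.
  by rewrite Int_cst ?(ltW ab)// [RHS]mulrC mulfK// lt0r_neq0.
rewrite -mulrBr -IntB//; last exact: cst_integrable.
rewrite normrM gtr0_norm ?invr_gt0// ler_pdivrMl// mulrC.
apply: norm_Int_cst; [exact: ltW|by apply: L1B => //; exact: cst_integrable|].
move=> x /andP[ax xb]; apply/ltW/Hd.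
  by rewrite /= in_itv /= (le_trans a0 ax) (le_trans xb bT).
by rewrite ltr_norml; apply/andP; split; lra.
Qed.

(** [Int_cross_differences] divided by h, with six errors of e/6: two difference quotients (reaches
    0 and h for u, h and 0 for z), two integrals that lack an end piece of length h, and two
    averages of (uc, zc) at the ends. *)
Theorem gelfand_integration_by_parts (u z : R -> V) (uc zc : R -> L2 nu)
    (du dz : R -> topdual V) : weak_pair u uc du -> weak_pair z zc dz ->
  Int (fun t => <| du t, z t |>) 0 T + Int (fun t => <| dz t, u t |>) 0 T =
  L2dot (uc T) (zc T) - L2dot (uc 0) (zc 0).
Proof.
move=> pu pz; have [hu hdu _ ru] := pu; have [hz hdz _ rz] := pz.
have [cu _] := ru; have [cz _] := rz.
have luz : L1 0 T (fun t => <| du t, z t |>) by exact: inL2_dual_pair.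
have lzu : L1 0 T (fun t => <| dz t, u t |>) by exact: inL2_dual_pair.
have T0' : 0 <= T by exact: ltW.
have TI : `[0, T]%classic T by rewrite /= in_itv /= lexx T0'.
have OI : `[0, T]%classic 0 by rewrite /= in_itv /= lexx T0'.
have cuz : {within `[0, T], continuous (fun t => L2dot (uc t) (zc t))} by exact: within_L2dot.
apply/eqP; rewrite -subr_eq0 -normr_le0; apply/ler_addgt0Pr => e e0; rewrite add0r.
have e6 : 0 < e / 6 by rewrite divr_gt0.
have [d1 d10 H1] := weak_pair_diagonal pu hz rz e6.
have [d2 d20 H2] := weak_pair_diagonal pz hu ru e6.
have [d3 d30 H3] := (within_continuousP _ _).1 (prim_continuous T0' luz) T TI _ e6.
have [d4 d40 H4] := (within_continuousP _ _).1 (prim_continuous T0' lzu) 0 OI _ e6.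
have T0T : 0 <= T <= T by rewrite T0' lexx.
have O0T : 0 <= (0 : R) <= T by apply/andP; split.
have [d5 d50 H5] := avg_endpoint cuz T0T e6.
have [d6 d60 H6] := avg_endpoint cuz O0T e6.
have [d [d0 dd1 dd2 dd3 dd4]] := min_pos4 d10 d20 d30 d40.
have [h [h0 hd hd5 hd6 hT]] := min_pos4 d0 d50 d60 T0.
have h0' := ltW h0; have hT' := ltW hT.
have ThT : T - h < T by rewrite gtrBl.
have Th0 : 0 <= T - h by rewrite subr_ge0.
have k1 := H1 0 h (lexx 0); rewrite add0r in k1.
have {}k1 := k1 h0' h0 (lt_trans hd dd1) hT'.
have k2 := H2 h 0 h0' (lexx 0); rewrite addr0 subr0 in k2.
have {}k2 := k2 h0 (lt_trans hd dd2) hT'.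
have k3 : `|Int (fun t => <| du t, z t |>) 0 (T - h) - Int (fun t => <| du t, z t |>) 0 T| <= e / 6.
  apply/ltW/H3; first by rewrite /= in_itv /= Th0 ltW.
  by rewrite addrAC subrr add0r normrN gtr0_norm//; exact: lt_trans hd dd3.
have k4 : `|Int (fun t => <| dz t, u t |>) h T - Int (fun t => <| dz t, u t |>) 0 T| <= e / 6.
  rewrite -(@prim_diff _ _ T)//; rewrite addrAC /prim subrr add0r normrN.
  have /ltW : `|prim (fun t => <| dz t, u t |>) h - prim (fun t => <| dz t, u t |>) 0| < e / 6.
    apply: H4; first by rewrite /= in_itv /= h0' hT'.
    by rewrite subr0 gtr0_norm//; exact: lt_trans hd dd4.
  by rewrite /prim Int_point subr0.
have k5 := H5 (T - h) T Th0 ThT (lexx T).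
have ThTT : T - h <= T <= T by rewrite lexx ltW.
have ThE : T - (T - h) = h by rewrite opprB addrC subrK.
rewrite ThE in k5; have {}k5 := k5 ThTT hd5.
have k6 := H6 0 h (lexx 0) h0 hT'; rewrite subr0 in k6.
have O0h : 0 <= (0 : R) <= h by apply/andP; split.
have {}k6 := k6 O0h hd6.
have := Int_cross_differences cu cz h0 hT'; rewrite subr0.
move=> /(congr1 (fun x => h^-1 * x)); rewrite mulrDr mulrBr.
by move=> key; exact: six_errors key k1 k2 k3 k4 k5 k6.
Qed.

End integration_by_parts.

(** * Mean-value linearization and piecewise linear interpolants *)

Section mean_value.
Context {R : realType} {E : normedModType R}.
Local Notation mu := (@lebesgue_measure R).
Local Notation Int f a b := (\int[mu]_(x in `[a, b]) f x).

(** The fundamental theorem of calculus for s -> <M (c s), v> on the segment c from y to x; the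
    derivative is continuous by [smooth_form]. *)
Lemma mean_value_increment (M : E -> topdual E) (x y v : E) : smooth_form M ->
  mean_value M x y (x - y) v = <| M x, v |> - <| M y, v |>.
Proof.
move=> [_ dM cM].
pose c (s : R) := s *: x + (1 - s) *: y.
have cE (h s : R) : c (h + s) = h *: (x - y) + c s.
  rewrite /c; have -> : 1 - (h + s) = - h + (1 - s) by ring.
  by rewrite (scalerDl x h s) (scalerDl y (- h) (1 - s)) scaleNr scalerBr addrACA.
pose psi (s : R) : R := <| M (c s), v |>.
have dpsi (s : R) : is_derive s (1 : R) psi (gateaux M (c s) (x - y) v).
  (* Along a segment the two difference quotients coincide for every h, so directional derivatives
     suffice and no chain rule for differentiable maps is invoked. *)
  have dq : (fun h : R => h^-1 *: ((psi \o shift s) (h *: (1 : R)) - psi s)) =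
      (fun h : R => h^-1 *: (((fun y => <| M y, v |> : R^o) \o shift (c s)) (h *: (x - y)) -
        <| M (c s), v |>)).
    by apply/funext => h; rewrite /= /psi [h *: 1]mulr1 cE.
  apply: DeriveDef; first by rewrite /derivable dq; exact: dM.
  by rewrite /derive dq.
have cc : continuous c.
  move=> s; apply: cvgD.
    by apply: cvgZr_tmp; exact: cvg_id.
  by apply: cvgZr_tmp; apply: cvgB; [exact: cvg_cst|exact: cvg_id].
have cg : {within `[0, 1], continuous (fun s => gateaux M (c s) (x - y) v)}.
  apply: continuous_subspaceT => s.
  apply: (@cvg_comp _ _ _ c (fun z => gateaux M z (x - y) v : R^o) _ (nbhs (c s))).
    exact: cc.
  exact: cM.
rewrite /mean_value (Int_derive ler01 dpsi cg) /psi /c.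
by rewrite scale1r subrr scale0r addr0 scale0r add0r subr0 scale1r.
Qed.

End mean_value.

Section clamped_interpolation.
Context {R : realType}.
Local Notation mu := (@lebesgue_measure R).
Local Notation Int f a b := (\int[mu]_(x in `[a, b]) f x).
Local Notation L1 a b f := (mu.-integrable `[a, b] (EFin \o f)).

(** The ramp is 0 before c and 1 after d, where phi' integrates to - phi d because phi T = 0.
    Integration by parts on [c, d] produces the boundary term phi d, which cancels it. *)
Lemma Int_derive_clamp (phi phi' : R -> R) (T c d : R) : 0 <= c -> c < d -> d <= T ->
  (forall t : R, is_derive t (1 : R) phi (phi' t)) -> continuous phi' -> phi T = 0 ->
  Int (fun t => phi' t * ((clamp c d t - c) / (d - c))) 0 T =
  - Int (fun t => phi t * (d - c)^-1) c d.
Proof.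
move=> c0 cd dT dphi cphi' phiT.
have dc0 : 0 < d - c by rewrite subr_gt0.
have cphi := is_derive_continuous dphi.
have ccl := @clamp_continuous R c d (ltW cd).
have cint : continuous (fun t => phi' t * ((clamp c d t - c) / (d - c))).
  move=> t; apply: cvgM; first exact: cphi'.
  by apply: cvgM; [apply: cvgB; [exact: ccl|exact: cvg_cst]|exact: cvg_cst].
have lint a b : L1 a b (fun t => phi' t * ((clamp c d t - c) / (d - c))).
  by apply: continuous_integrable; exact: continuous_subspaceT.
have cd' := ltW cd.
rewrite (@Int_split _ _ 0 T c)//; last exact: le_trans dT.
rewrite (@Int_split _ _ c T d)//.
rewrite (@eq_Int _ _ (fun=> 0) 0 c); last first.
  move=> t /andP[t0 tc]; rewrite /clamp min_l; last exact: le_trans tc cd'.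
  by rewrite max_l// subrr mul0r mulr0.
rewrite Rintegral_cst// mul0r add0r.
rewrite [X in _ + X](@eq_Int _ _ phi'); last first.
  move=> t /andP[t0 tc]; rewrite /clamp min_r// max_r//.
  by rewrite divff ?mulr1// lt0r_neq0.
rewrite (Int_derive dT dphi); last exact: continuous_subspaceT.
rewrite phiT sub0r.
pose g' t := phi' t * ((t - c) / (d - c)) + phi t * (d - c)^-1.
have dg (t : R) : is_derive t (1 : R) (fun t => phi t * ((t - c) / (d - c))) (g' t).
  have dl : is_derive t (1 : R) (fun t => (t - c) / (d - c)) (d - c)^-1.
    have -> : (fun t => (t - c) / (d - c)) = fun t => (d - c)^-1 * t + (- c / (d - c)).
      by apply/funext => r; rewrite mulrBl mulrC mulNr.
    exact: is_derive_affine.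
  apply: (is_derive_eq (is_deriveM (dphi t) dl)).
  by rewrite /g' /GRing.scale /= addrC; congr (_ + _); rewrite mulrC.
have cphiV : continuous (fun t => phi t * (d - c)^-1).
  by move=> t; apply: cvgM; [exact: cphi|exact: cvg_cst].
have cphi'V : continuous (fun t => phi' t * ((t - c) / (d - c))).
  move=> t; apply: cvgM; first exact: cphi'.
  by apply: cvgM; [apply: cvgB; [exact: cvg_id|exact: cvg_cst]|exact: cvg_cst].
have cg' : {within `[c, d], continuous g'}.
  by apply: continuous_subspaceT => t; apply: cvgD; [exact: cphi'V|exact: cphiV].
have := Int_derive cd' dg cg'; rewrite divff ?lt0r_neq0// subrr mul0r mulr0 subr0 mulr1.
rewrite IntD; last 2 first.
- by apply: continuous_integrable; exact: continuous_subspaceT.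
- by apply: continuous_integrable; exact: continuous_subspaceT.
rewrite (@eq_Int _ (fun t => phi' t * ((clamp c d t - c) / (d - c)))
  (fun t => phi' t * ((t - c) / (d - c)))); last by move=> t /clamp_id ->.
by move=> <-; rewrite opprD addrA subrr add0r.
Qed.

End clamped_interpolation.

(** * Time grids and interpolation *)

Section grid.
Context {R : realType} (tm : nat -> R) (Nt : nat) (T : R).
Hypothesis htm : time_grid tm Nt T.

Lemma grid_le i j : (i <= j <= Nt)%N -> tm i <= tm j.
Proof.
have [_ _ lt_tm] := htm => /andP[ij jN].
elim: j ij jN => [|j IH]; first by rewrite leqn0 => /eqP ->.
rewrite leq_eqVlt => /predU1P[->//|ij] jN.
by apply: le_trans (IH ij (ltnW jN)) (ltW (lt_tm _ jN)).
Qed.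

Lemma grid_ge0 i : (i <= Nt)%N -> 0 <= tm i.
Proof. by move=> iN; have [<- _ _] := htm; apply: grid_le; rewrite leq0n. Qed.

Lemma grid_leT i : (i <= Nt)%N -> tm i <= T.
Proof. by move=> iN; have [_ <- _] := htm; apply: grid_le; rewrite iN leqnn. Qed.

Lemma step_gt0 k : (k < Nt)%N -> 0 < step tm k.+1.
Proof. by move=> kN; have [_ _ lt_tm] := htm; rewrite /step /= subr_gt0 lt_tm. Qed.

Lemma grid_cell s : 0 < T -> 0 <= s <= T -> exists2 k, (k < Nt)%N & tm k <= s <= tm k.+1.
Proof.
have [t0 tN lt_tm] := htm => T0 /andP[s0 sT].
have : exists k, (k <= Nt)%N && (s <= tm k) by exists Nt; rewrite leqnn tN.
(* The first node not before s is the right end of the cell. If it is node 0, then s = 0 and the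
   first cell serves. *)
move=> /ex_minnP[[|k] /andP[kN sk] kmin].
  exists 0%N.
    by rewrite lt0n; apply: contraTneq T0 => N0; rewrite -tN N0 t0 ltxx.
  rewrite t0 s0 /=; apply: le_trans sk _; apply: grid_le => //=.
  by rewrite lt0n; apply: contraTneq T0 => N0; rewrite -tN N0 t0 ltxx.
exists k => //; rewrite sk andbT leNgt; apply/negP => skm.
by have := kmin k; rewrite (ltnW kN) (ltW skm) => /(_ isT); rewrite ltnn.
Qed.

Lemma find_iota (P : pred nat) k : (k < Nt)%N -> P k -> (forall j, (j < k)%N -> ~~ P j) ->
  find P (iota 0 Nt) = k.
Proof.
move=> kN Pk nP; have -> : Nt = (k + (Nt - k).-1.+1)%N.
  by rewrite prednK ?subn_gt0// subnKC// ltnW.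
rewrite iotaD find_cat ifF; first by rewrite /= add0n Pk size_iota addn0.
apply/negbTE/hasPn => j; rewrite mem_iota add0n => /andP[_ jk]; exact: nP.
Qed.

Lemma interp_cell (E : normedModType R) (w : nat -> E) k s : (k < Nt)%N ->
  tm k <= s <= tm k.+1 ->
  interp tm Nt w s = ((tm k.+1 - s) / step tm k.+1) *: w k +
                     ((s - tm k) / step tm k.+1) *: w k.+1.
Proof.
move=> kN /andP[ks sk].
(* [interp] works in the first cell whose right end reaches s, so at a node tm k with k > 0 it uses
   cell k - 1; both cells give w k there. *)
have [sk0|sk0] := eqVneq s (tm k); last first.
  rewrite /interp (@find_iota _ k)// => j jk; rewrite -ltNge.
  have : tm j.+1 <= tm k by apply: grid_le; rewrite jk ltnW.
  by move/le_lt_trans; apply; rewrite lt_neqAle eq_sym sk0.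
case: k kN ks sk sk0 => [|k] kN ks sk sk0.
  by rewrite /interp (@find_iota _ 0%N).
rewrite /interp (@find_iota _ k (ltnW kN)); last 2 first.
- by rewrite sk0.
- move=> j jk; rewrite -ltNge sk0.
  have [_ _ lt_tm] := htm; apply: le_lt_trans (lt_tm _ (ltnW kN)).
  by apply: grid_le; rewrite jk (ltnW (ltnW kN)).
rewrite sk0 !subrr mul0r scale0r add0r mul0r scale0r addr0.
by rewrite -/(step tm k.+1) !divff ?lt0r_neq0 ?step_gt0// ltnW.
Qed.

Lemma interp_node (E : normedModType R) (w : nat -> E) k : (k <= Nt)%N -> 0 < T ->
  interp tm Nt w (tm k) = w k.
Proof.
have [t0 tN lt_tm] := htm => kN T0; case: k kN => [|k] kN.
  have N0 : (0 < Nt)%N.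
    by rewrite lt0n; apply: contraTneq T0 => N0; rewrite -tN N0 t0 ltxx.
  rewrite (@interp_cell _ _ 0%N)//; last by rewrite lexx (ltW (lt_tm _ N0)).
  by rewrite subrr mul0r scale0r addr0 divff ?scale1r// lt0r_neq0// step_gt0.
rewrite (@interp_cell _ _ k)//; last by rewrite lexx (ltW (lt_tm _ kN)).
by rewrite subrr mul0r scale0r add0r divff ?scale1r// lt0r_neq0// step_gt0.
Qed.

Definition ramp_up k (s : R) : R := (clamp (tm k) (tm k.+1) s - tm k) / step tm k.+1.

(** A formula without case distinction on the cell, continuous on the whole line, whose terms can be
    differentiated one by one. *)
Definition interp_ext (E : normedModType R) (w : nat -> E) (s : R) : E :=
  w 0%N + \sum_(0 <= k < Nt) ramp_up k s *: (w k.+1 - w k).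

(** Ramps of earlier cells are 1 and telescope to w k; those of later cells are 0. *)
Lemma interp_extE (E : normedModType R) (w : nat -> E) s : 0 < T -> 0 <= s <= T ->
  interp tm Nt w s = interp_ext w s.
Proof.
move=> T0 /(grid_cell T0)[k kN ks]; rewrite (interp_cell _ kN ks) /interp_ext.
have [_ _ lt_tm] := htm; have [ks1 ks2] := andP ks.
rewrite (@big_cat_nat _ _ _ k)//=; last exact: ltnW.
rewrite [X in _ + (_ + X)]big_ltn//.
rewrite [X in _ + (X + _)](eq_big_nat _ _ (F2 := fun j => w j.+1 - w j)); last first.
  move=> j /andP[_ jk]; rewrite /ramp_up /clamp.
  have jN : (j < Nt)%N by exact: ltn_trans kN.
  rewrite min_r; last by apply: le_trans ks1; apply: grid_le; rewrite jk ltnW.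
  rewrite max_r; last exact: ltW (lt_tm _ jN).
  by rewrite -/(step tm j.+1) divff ?scale1r// lt0r_neq0// step_gt0.
rewrite [X in _ + (_ + (_ + X))](eq_big_nat _ _ (F2 := fun j => 0)); last first.
  move=> j /andP[kj jN]; rewrite /ramp_up /clamp.
  have sj : s <= tm j by apply: le_trans ks2 _; apply: grid_le; rewrite kj ltnW.
  rewrite min_l; last exact: le_trans sj (ltW (lt_tm _ jN)).
  by rewrite max_l// subrr mul0r scale0r.
rewrite big1_eq addr0 telescope_sumr// addrA [w 0%N + _]addrC subrK /ramp_up clamp_id//.
have -> : (tm k.+1 - s) / step tm k.+1 = 1 - (s - tm k) / step tm k.+1.
  rewrite -[in RHS](divff (lt0r_neq0 (step_gt0 kN))) -mulrBl.
  by congr (_ / _); rewrite /step /=; ring.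
by rewrite scalerBl scale1r scalerBr addrAC -!addrA.
Qed.

Lemma interp_ext_continuous (E : normedModType R) (w : nat -> E) : continuous (interp_ext w).
Proof.
have [_ _ lt_tm] := htm => s; apply: cvgD; first exact: cvg_cst.
suff H n : (n <= Nt)%N ->
    continuous (fun s => \sum_(0 <= k < n) ramp_up k s *: (w k.+1 - w k)) by exact: H.
elim: n => [_|n IH nN] r.
  by under eq_fun do rewrite big_geq//; exact: cvg_cst.
rewrite [X in continuous_at _ X](_ : _ = fun s =>
    \sum_(0 <= k < n) ramp_up k s *: (w k.+1 - w k) + ramp_up n s *: (w n.+1 - w n)); last first.
  by apply/funext => x; rewrite big_nat_recr.
apply: cvgD; first by apply: IH; exact: ltnW.
apply: cvgZr_tmp; apply: cvgM; last exact: cvg_cst.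
apply: cvgB; last exact: cvg_cst.
by apply: clamp_continuous; exact/ltW/lt_tm.
Qed.

End grid.

Section inL2_sums.
Context {R : realType} {E : normedModType R} (T : R).

Lemma eq_inL2 (g k : R -> E) : (forall t, 0 <= t <= T -> g t = k t) -> inL2 T g -> inL2 T k.
Proof.
move=> gk [[s [ss sg]] lg]; split.
  exists s; split=> // t tT; have := tT; rewrite /= in_itv /= => /gk <-; exact: sg.
by apply: (eq_L1 _ lg) => t /gk ->.
Qed.

Lemma inL2D (g k : R -> E) : inL2 T g -> inL2 T k -> inL2 T (fun t => g t + k t).
Proof.
move=> hg hk; have := inL2B hg (inL2B (inL2_cst T (0 : E)) hk).
by apply: eq_inL2 => t _; rewrite sub0r opprK.
Qed.

Lemma inL2_sum n (g : nat -> R -> E) : (forall k, (k < n)%N -> inL2 T (g k)) ->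
  inL2 T (fun t => \sum_(0 <= k < n) g k t).
Proof.
elim: n => [_|n IH hg].
  by apply: (eq_inL2 _ (inL2_cst T (0 : E))) => t _; rewrite big_geq.
have IH' : inL2 T (fun t => \sum_(0 <= k < n) g k t).
  by apply: IH => k kn; apply: hg; exact: ltnW.
by apply: (eq_inL2 _ (inL2D IH' (hg n (ltnSn n)))) => t _; rewrite big_nat_recr.
Qed.

Lemma inL2_indic (A : set R) (x : E) : measurable A ->
  inL2 T (fun t => (\1_A t : R) *: x).
Proof.
move=> mA; apply: (@inL2_dominated _ _ _ _ (fun=> `|x| ^+ 2)).
- exists (fun _ t => (\1_A t : R) *: x); split=> [_|t _]; last exact: cvg_cst.
  apply: (@simple_comp2 R R^o E E (fun a x => a *: x)); first exact: simple_indic.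
  exact: simple_cst.
- exact: cst_integrable.
move=> t _; rewrite indicE; case: (_ \in _); first by rewrite scale1r.
by rewrite scale0r normr0 expr0n sqr_ge0.
Qed.

End inL2_sums.

Section riesz.
Context {dX : measure_display} {X : measurableType dX} {R : realType}
        {nu : {measure set X -> \bar R}} {V : normedModType R}
        (iota : {linear V -> L2 nu}).
Hypothesis ciota : continuous iota.

Lemma L2_functional_subproof (g : L2 nu) :
  (fun v : V => L2dot g (iota v) : R^o) \in @dual_pred R V.
Proof.
apply/asboolP; split=> [a x y|v].
  by rewrite linearP L2dotDr L2dotZr.
apply/cvgrPdist_lt => e e0.
have M0 : 0 < `|g| + 1 by rewrite ltr_wpDl.
have /cvgrPdist_lt/(_ _ (divr_gt0 e0 M0)) : iota x @[x --> v] --> iota v by exact: ciota.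
apply: filterS => w h; rewrite -L2dotBr; apply: le_lt_trans (L2dot_le _ _) _.
apply: (@le_lt_trans _ _ ((`|g| + 1) * `|iota v - iota w|)).
  by rewrite ler_wpM2r// lerDl.
by rewrite mulrC -ltr_pdivlMr.
Qed.

(** The embedding of L^2 into the dual of V from the Gelfand triple; the slopes of an interpolant
    become functionals through it. *)
Definition L2_functional (g : L2 nu) : topdual V := Dual (L2_functional_subproof g).

End riesz.

Section interpolant.
Context {dX : measure_display} {X : measurableType dX} {R : realType}
        {nu : {measure set X -> \bar R}} {V : normedModType R}
        (iota : {linear V -> L2 nu}) (T : R) (tm : nat -> R) (Nt : nat).
Local Notation mu := (@lebesgue_measure R).
Local Notation Int f a b := (\int[mu]_(x in `[a, b]) f x).
Local Notation L1 a b f := (mu.-integrable `[a, b] (EFin \o f)).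
Hypothesis T0 : 0 < T.
Hypothesis ciota : continuous iota.
Hypothesis htm : time_grid tm Nt T.

Lemma L2dot_suml n (g : nat -> L2 nu) h :
  L2dot (\sum_(0 <= k < n) g k) h = \sum_(0 <= k < n) L2dot (g k) h.
Proof.
elim: n => [|n IH]; first by rewrite !big_geq// L2dot0l.
by rewrite !big_nat_recr//= L2dotDl IH.
Qed.

Lemma dual_pair_suml n (F : nat -> topdual V) v :
  <| \sum_(0 <= k < n) F k, v |> = \sum_(0 <= k < n) <| F k, v |>.
Proof.
elim: n => [|n IH]; first by rewrite !big_geq.
rewrite !big_nat_recr//= -IH //.
Qed.

Lemma Int_indic_itv (f : R -> R) (c d : R) : 0 <= c -> d <= T ->
  Int (fun t => (\1_(`[c, d]) t : R) * f t) 0 T = Int f c d.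
Proof.
move=> c0 dT.
have E : `[c, d]%classic = `[0, T]%classic `&` `[c, d]%classic.
  rewrite setIC setIidl// => x /=; rewrite !in_itv /= => /andP[cx xd].
  by rewrite (le_trans c0 cx) (le_trans xd dT).
rewrite [in RHS]E Rintegral_mkcondr; apply: eq_Int => t _.
by rewrite patchE indicE; case: (_ \in _); rewrite ?mul1r ?mul0r.
Qed.

Lemma interp_inL2 (w : nat -> V) : inL2 T (interp tm Nt w).
Proof.
apply: (eq_inL2 _ (inL2_continuous T (@interp_ext_continuous _ _ _ _ htm V w))) => t tT.
by rewrite (interp_extE htm).
Qed.

(** The closed cells overlap, so at an inner node two slopes are added. This is harmless, as each
    term is integrated over its own cell. *)
Definition interp_dt (w : nat -> V) (t : R) : topdual V :=
  \sum_(0 <= k < Nt) (\1_(`[tm k, tm k.+1]) t : R) *: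
    L2_functional ciota ((step tm k.+1)^-1 *: (iota (w k.+1) - iota (w k))).

Lemma test_fun_derive phi : test_fun T phi ->
  [/\ forall t : R, is_derive t (1 : R) phi (derive1 phi t), continuous (derive1 phi),
      phi 0 = 0 & phi T = 0].
Proof.
move=> [sphi [a [b [a0 bT supp]]]]; split.
- by move=> t; apply: DeriveDef; [exact: (sphi 0%N)|rewrite derive1E].
- move=> t; apply: differentiable_continuous; apply/derivable1_diffP; exact: (sphi 1%N).
- apply/eqP; apply: contraT => /supp /andP[a0' _].
  by move: (lt_le_trans a0 a0'); rewrite ltxx.
- apply/eqP; apply: contraT => /supp /andP[_ Tb].
  by move: (lt_le_trans bT Tb); rewrite ltxx.
Qed.

(** Term by term in [interp_ext]: the constant w 0 contributes phi T - phi 0 = 0, and every ramp is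
    handled by [Int_derive_clamp]. *)
Lemma interp_weak_derivative (w : nat -> V) :
  weak_time_derivative iota T (interp tm Nt w) (interp_dt w).
Proof.
move=> phi tphi v; have [dphi cphi' phi0 phiT] := test_fun_derive tphi.
have [_ _ lt_tm] := htm.
have cphi := is_derive_continuous dphi.
have lphi a b : L1 a b phi by apply: continuous_integrable; exact: continuous_subspaceT.
pose al k := L2dot (iota (w k.+1) - iota (w k)) (iota v).
have lphi' a b : L1 a b (derive1 phi).
  by apply: continuous_integrable; exact: continuous_subspaceT.
have step0 k : (k < Nt)%N -> 0 < step tm k.+1 by exact: step_gt0 htm k.
have lru k : k \in index_iota 0 Nt -> L1 0 T (fun t => al k * (derive1 phi t * ramp_up tm k t)).
  rewrite mem_index_iota => /andP[_ kN]; apply: L1Z; apply: continuous_integrable.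
  apply: continuous_subspaceT => t; apply: cvgM; first exact: cphi'.
  apply: cvgM; last exact: cvg_cst.
  apply: cvgB; last exact: cvg_cst.
  by apply: clamp_continuous; exact/ltW/lt_tm.
have -> : Int (fun t => derive1 phi t * L2dot (iota (interp tm Nt w t)) (iota v)) 0 T =
    \sum_(0 <= k < Nt) Int (fun t => al k * (derive1 phi t * ramp_up tm k t)) 0 T.
  have -> : Int (fun t => derive1 phi t * L2dot (iota (interp tm Nt w t)) (iota v)) 0 T =
      Int (fun t => L2dot (iota (w 0%N)) (iota v) * derive1 phi t +
        \sum_(0 <= k < Nt) al k * (derive1 phi t * ramp_up tm k t)) 0 T.
    apply: eq_Int => t tT; rewrite (interp_extE htm)// /interp_ext linearD linear_sum.
    rewrite L2dotDl mulrDr mulrC; congr (_ + _).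
    rewrite L2dot_suml mulr_sumr; apply: eq_bigr => k _.
    by rewrite linearZ /= linearB L2dotZl /al; ring.
  rewrite IntD; [|exact: L1Z|exact: L1_sum].
  rewrite IntZ// (Int_derive (ltW T0) dphi); last exact: continuous_subspaceT.
  by rewrite phi0 phiT subrr mulr0 add0r Int_sum.
have lind k : k \in index_iota 0 Nt ->
    L1 0 T (fun t => (\1_(`[tm k, tm k.+1]) t : R) * (phi t * ((step tm k.+1)^-1 * al k))).
  move=> _; apply: (@measurable_dominated_L1 _ _ (fun t => `|phi t * ((step tm k.+1)^-1 * al k)|)).
  - apply: measurable_funM; first exact: measurable_indic.
    by apply: measurable_funM => //; exact: L1_measurable (lphi _ _).
  - apply: L1_norm; apply: (eq_L1 _ (L1Z ((step tm k.+1)^-1 * al k) (lphi 0 T))) => t _.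
    by rewrite mulrC.
  - move=> t _; rewrite normrM ler_piMl// indicE.
    by case: (_ \in _); rewrite ?normr1 ?normr0.
have -> : Int (fun t => phi t * <| interp_dt w t, v |>) 0 T =
    \sum_(0 <= k < Nt) Int (fun t => (\1_(`[tm k, tm k.+1]) t : R) *
      (phi t * ((step tm k.+1)^-1 * al k))) 0 T.
  rewrite -Int_sum//; apply: eq_Int => t _.
  rewrite /interp_dt dual_pair_suml mulr_sumr; apply: eq_bigr => k _.
  rewrite -[<| _ *: _, v |>]/(_ * L2dot _ (iota v)) L2dotZl -/(al k).
  by ring.
rewrite -sumrN; apply: eq_big_nat => k /andP[_ kN].
have kN1 := ltnW kN.
have tk0 := grid_ge0 htm kN1; have tkT := grid_leT htm kN.
have lcell : L1 0 T (fun t => derive1 phi t * ramp_up tm k t).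
  apply: continuous_integrable; apply: continuous_subspaceT => t.
  apply: cvgM; first exact: cphi'.
  apply: cvgM; last exact: cvg_cst.
  apply: cvgB; last exact: cvg_cst.
  by apply: clamp_continuous; exact/ltW/lt_tm.
rewrite IntZ// Int_indic_itv//.
rewrite /ramp_up /step /= (Int_derive_clamp tk0 (lt_tm _ kN) tkT dphi cphi' phiT).
have -> : Int (fun t => phi t * ((tm k.+1 - tm k)^-1 * al k)) (tm k) (tm k.+1) =
    Int (fun t => al k * (phi t * (tm k.+1 - tm k)^-1)) (tm k) (tm k.+1).
  by apply: eq_Int => t _; ring.
rewrite IntZ ?mulrN//.
by apply: (eq_L1 _ (L1Z (tm k.+1 - tm k)^-1 (lphi _ _))) => t _; rewrite mulrC.
Qed.

Lemma interp_weak_pair (w : nat -> V) :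
  weak_pair iota T (interp tm Nt w) (fun t => iota (interp tm Nt w t)) (interp_dt w).
Proof.
split; [exact: interp_inL2| |exact: interp_weak_derivative|split; last exact: (@nearW _ _ _ lebesgue_ae_filter)].
  by apply: inL2_sum => k _; exact: inL2_indic.
apply/within_continuousP => s sT e e0.
have ce : continuous (fun t => iota (interp_ext tm Nt w t)).
  move=> t; apply: (@cvg_comp _ _ _ (interp_ext tm Nt w) iota _ (nbhs (interp_ext tm Nt w t))).
    exact: (@interp_ext_continuous _ _ _ _ htm V w t).
  exact: ciota.
have /within_continuousP/(_ s sT e e0)[d d0 Hd] :
    {within `[0, T], continuous (fun t => iota (interp_ext tm Nt w t))}.
  exact: continuous_subspaceT.
exists d => // y yT ys; have := Hd y yT ys.
by rewrite -!(interp_extE htm) //; move: sT yT; rewrite /= !in_itv.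
Qed.

End interpolant.

(** * Uniqueness of traces and the chosen time derivative *)

Section traces.
Context {dX : measure_display} {X : measurableType dX} {R : realType}
        {nu : {measure set X -> \bar R}} {V : normedModType R}
        (iota : {linear V -> L2 nu}) (T : R).
Local Notation mu := (@lebesgue_measure R).
Local Notation Int f a b := (\int[mu]_(x in `[a, b]) f x).
Local Notation L1 a b f := (mu.-integrable `[a, b] (EFin \o f)).
Hypothesis T0 : 0 < T.

(** The distance of the two representatives is continuous and zero almost everywhere, so its means
    over short intervals at s vanish while they approximate its value at s. *)
Lemma continuous_representative_unique (u : R -> V) (uc vc : R -> L2 nu) s :
  continuous_representative iota T u uc -> continuous_representative iota T u vc ->
  0 <= s <= T -> uc s = vc s.
Proof.
move=> [cu aeu] [cv aev] sT; apply/eqP; rewrite -subr_eq0 -normr_le0.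
apply/ler_addgt0Pr => e e0; rewrite add0r.
have cd : {within `[0, T], continuous (fun t => `|uc t - vc t|)}.
  by move=> t; apply: cvg_norm; apply: cvgB; [exact: cu|exact: cv].
have [d d0 Hd] := avg_endpoint cd sT e0.
have [h [h0 hd hT _ _]] := min_pos4 d0 (divr_gt0 T0 (ltr0n R 2)) d0 d0.
(* The interval extends from s towards the midpoint, so it stays in [0, T] also for s = 0 and s =
   T. *)
pose a := if s <= T / 2 then s else s - h.
have [/andP[s0 sT'] T20] : 0 <= s <= T /\ 0 < T / 2 by split=> //; rewrite divr_gt0.
have [a0 ab abT /andP[as_ sb]] :
    [/\ 0 <= a, a < a + h, a + h <= T & a <= s <= a + h].
  by rewrite /a; case: (leP s (T / 2)) => ?; split; rewrite ?lexx; try (apply/andP; split); lra.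
have abh : a + h - a = h by rewrite addrAC subrr add0r.
have := Hd a (a + h) a0 ab abT; rewrite abh as_ sb => /(_ isT hd).
have ld : L1 0 T (fun t => `|uc t - vc t|) by exact: continuous_integrable.
have -> : Int (fun t => `|uc t - vc t|) a (a + h) = Int (fun=> 0) a (a + h).
  apply: ae_eq_Int; [|exact: measurable_cst|].
    by apply: L1_measurable; exact: integrable_itvS ld.
  have := @filterI _ _ lebesgue_ae_filter _ _ aeu aev.
  apply: (@filterS _ _ lebesgue_ae_filter) => t [h1 h2] tab.
  have tT : t \in `[0, T].
    move: tab; rewrite !in_itv /= => /andP[t1 t2].
    by rewrite (le_trans a0 t1) (le_trans t2 abT).
  by rewrite h1// h2// subrr normr0.
by rewrite Rintegral_cst// mul0r mulr0 sub0r normrN normr_id.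
Qed.

Lemma value_atE (u : R -> V) (uc : R -> L2 nu) s :
  continuous_representative iota T u uc -> 0 <= s <= T -> value_at iota T u s = uc s.
Proof.
move=> ru sT; rewrite /value_at; case: xgetP => [vc _ rv|/(_ uc)//].
exact: continuous_representative_unique rv ru sT.
Qed.

(** [dt] is picked by [xget], with default 0; membership in [W] supplies the witness that gives the
    pick its defining property. *)
Lemma W_dt (u : R -> V) (uc : R -> L2 nu) : W iota T u ->
  continuous_representative iota T u uc -> weak_pair iota T u uc (dt iota T u).
Proof.
move=> [hu [du hdu wdu]] ru.
have [h1 h2] : inL2 T (dt iota T u) /\ weak_time_derivative iota T u (dt iota T u).
  by rewrite /dt; case: xgetP => [dv _ //|/(_ du)]; case.
by split.
Qed.

End traces.

(** * Error representation *)

(** The indices match the integrability facts [i1] to [i11] of [goal_error_residual]. The hypotheses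
    are the primal equation, the dual equation and two integrations by parts; x, y are the terms at
    T and v, w those at 0. *)
Lemma goal_arith (R : realType) (a1 a2 a3 a4 a5 a6 a7 a8 a9 a10 a11 x y v w : R) :
  a1 + a2 + a3 = a4 -> - a8 + a9 + (a2 - a6) + (a3 - a7) = a10 - a11 ->
  a1 + a8 = x - v -> a5 + a9 = y - w ->
  x + a10 - (y + a11) = v - w + (a4 - a5 - a6 - a7).
Proof. by lra. Qed.

Lemma dual_pairNl (R : realType) (E : normedModType R) (F : topdual E) (v : E) :
  <| - F, v |> = - <| F, v |>.
Proof. by []. Qed.

Lemma residual_arith (R : realType) (C fz fy dz dy bz by_ nz ny : R) :
  fz - fy - (dz - dy) - (bz - by_) - (nz - ny) + (C - by_ - ny) =
  fz - dz - bz - nz + (dy - fy + C).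
Proof. by ring. Qed.

Lemma cell_arith (R : realType) (tau g C D F Z : R) : tau != 0 ->
  tau * (g - tau^-1 * D - C) + (Z + (D - F + C * tau)) + (F - g * tau) = Z.
Proof. by move=> tau0; field. Qed.

Lemma galerkin_arith (R : realType) (d1 d2 b1 b2 n1 n2 e1 e2 f1 f2 : R) :
  d2 + b2 + n2 - e2 = f2 ->
  f1 - f2 - (d1 - d2) - (b1 - b2) - (n1 - n2) + (e1 - e2) = f1 - d1 - b1 - n1 + e1.
Proof. by lra. Qed.

Lemma final_arith (R : realType) (a b s1 s2 s3 : R) :
  a + (s1 + s2 + s3) = b + s1 + (a - b + s2) + s3.
Proof. by ring. Qed.

Section error_representation.
Context {dX : measure_display} {X : measurableType dX} {R : realType}
        {nu : {measure set X -> \bar R}} {V : normedModType R}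
        (iota : {linear V -> L2 nu}) (T : R) (tm : nat -> R) (Nt : nat).
Local Notation mu := (@lebesgue_measure R).
Local Notation Int f a b := (\int[mu]_(x in `[a, b]) f x).
Local Notation L1 a b f := (mu.-integrable `[a, b] (EFin \o f)).
Hypothesis T0 : 0 < T.
Hypothesis ciota : continuous iota.
Hypothesis htm : time_grid tm Nt T.
Context (B : V -> V -> R) (N : V -> topdual V).
Hypothesis hB : elliptic_form iota B.
Hypothesis hN : smooth_form N.

Lemma elliptic_seq_continuous : seq_continuous2 (B : V -> V -> R^o).
Proof.
have [linB symB [C BC] _] := hB.
have B0 v : B 0 v = 0 by have := linB 1 0 0 v; rewrite scaler0 addr0; lra.
have BZ a x v : B (a *: x) v = a * B x v by have := linB a x 0 v; rewrite addr0 B0 addr0.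
have BBl x x' v : B (x - x') v = B x v - B x' v.
  by rewrite addrC -scaleN1r linB mulN1r addrC.
apply: (@bounded_bilinear_seq_continuous _ _ _ _ C) => // x y y'.
by rewrite !(symB x) BBl.
Qed.

Lemma elliptic_Bl x x' v : B (x - x') v = B x v - B x' v.
Proof.
have [linB _ _ _] := hB.
by rewrite addrC -scaleN1r linB mulN1r addrC.
Qed.

Lemma elliptic_Br v x x' : B v (x - x') = B v x - B v x'.
Proof. by have [_ symB _ _] := hB; rewrite !(symB v) elliptic_Bl. Qed.

Lemma elliptic_L1 (g k : R -> V) : inL2 T g -> inL2 T k -> L1 0 T (fun t => B (g t) (k t)).
Proof.
have [_ _ [C BC] _] := hB.
exact: (inL2_pairing elliptic_seq_continuous BC).
Qed.

Lemma L2dot_iota_L1 (g : R -> L2 nu) (k : R -> V) : inL2 T g -> inL2 T k ->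
  L1 0 T (fun t => L2dot (g t) (iota (k t))).
Proof.
have /linear_boundedP/pinfty_ex_gt0[C C0 iotaC] :=
  @continuous_linear_bounded _ _ _ 0 iota (@ciota 0).
have bnd (x : L2 nu) (v : V) : `|L2dot x (iota v)| <= C * `|x| * `|v|.
  apply: le_trans (L2dot_le _ _) _; rewrite mulrAC [C * _ * _]mulrC.
  by rewrite ler_wpM2l//; exact: iotaC.
apply: (inL2_pairing (C := C) (phi := fun x v => L2dot x (iota v) : R^o)) => //.
apply: (bounded_bilinear_seq_continuous (C := C)) => // [x x' v|x v v'].
  by rewrite L2dotBl.
by rewrite linearB L2dotBr.
Qed.

Context (uh : nat -> V).
Local Notation Iuh := (interp tm Nt uh).

(** Along the interpolant N is a continuous function on a compact time interval. For the exact
    solution, by contrast, integrability of the nonlinear term is part of [primal]. *)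
Lemma nonlinear_interp_inL2 : inL2 T (fun t => N (Iuh t)).
Proof.
have [cN _ _] := hN.
have c : continuous (fun t => N (interp_ext tm Nt uh t)).
  move=> t; apply: (@cvg_comp _ _ _ (interp_ext tm Nt uh) N _ (nbhs (interp_ext tm Nt uh t))).
    exact: (@interp_ext_continuous _ _ _ _ htm V uh t).
  exact: cN.
apply: (eq_inL2 _ (inL2_continuous T c)) => t tT.
by rewrite (interp_extE htm).
Qed.

Context (f : R -> topdual V).
Hypothesis hf : inL2 T f.

Lemma interp_dt_weak_pair :
  weak_pair iota T Iuh (fun t => iota (Iuh t)) (dt iota T Iuh).
Proof.
have [h1 h2 h3 h4] := interp_weak_pair T0 ciota htm uh.
by apply: W_dt => //; split=> //; exists (interp_dt tm Nt ciota uh).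
Qed.

Lemma residual_L1 (z : R -> V) : inL2 T z ->
  L1 0 T (fun t => residual iota T B N f Iuh t (z t)).
Proof.
move=> hz; have [hI hdI _ _] := interp_dt_weak_pair.
apply: L1B; last exact: inL2_dual_pair nonlinear_interp_inL2 hz.
apply: L1B; last exact: elliptic_L1 hI hz.
by apply: L1B; [exact: inL2_dual_pair hf hz|exact: inL2_dual_pair hdI hz].
Qed.

(** By [mean_value_increment] the nonlinear term of the dual problem, tested with u - Iu, equals
    N(u; z) - N(Iu; z). Subtracting the primal equation then leaves the terms of the residual of Iu
    and no linearization remainder. *)
Lemma goal_error_residual (u0 qbar : L2 nu) (q : R -> L2 nu) (u z : R -> V) :
  inL2 T q -> primal iota T B N u0 f u -> dual_problem iota T B N qbar q u Iuh z ->
  QoI iota T qbar q u - QoI iota T qbar q Iuh =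
  L2dot (u0 - iota (uh 0%N)) (value_at iota T z 0) +
  Int (fun t => residual iota T B N f Iuh t (z t)) 0 T.
Proof.
move=> hq [[Wu [uc ru ruc0]] pu] [[Wz [zc rz zcT]] dz].
have pairu := W_dt Wu ru; have pairz := W_dt Wz rz; have pairI := interp_dt_weak_pair.
have [hu hdu _ _] := pairu; have [hz hdz _ _] := pairz; have [hI hdI _ rI] := pairI.
have TT : 0 <= T <= T by rewrite (ltW T0) lexx.
have OT : 0 <= (0 : R) <= T by rewrite lexx (ltW T0).
have he : inL2 T (fun t => u t - Iuh t) by exact: inL2B.
have [lNu eqP] := pu z hz; have [lmv eqD] := dz _ he.
have i1 : L1 0 T (fun t => <| dt iota T u t, z t |>) by exact: inL2_dual_pair hdu hz.
have i2 : L1 0 T (fun t => B (u t) (z t)) by exact: elliptic_L1 hu hz.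
have i3 : L1 0 T (fun t => <| N (u t), z t |>) by exact: lNu.
have i4 : L1 0 T (fun t => <| f t, z t |>) by exact: inL2_dual_pair hf hz.
have i5 : L1 0 T (fun t => <| dt iota T Iuh t, z t |>) by exact: inL2_dual_pair hdI hz.
have i6 : L1 0 T (fun t => B (Iuh t) (z t)) by exact: elliptic_L1 hI hz.
have i7 : L1 0 T (fun t => <| N (Iuh t), z t |>).
  exact: inL2_dual_pair nonlinear_interp_inL2 hz.
have i8 : L1 0 T (fun t => <| dt iota T z t, u t |>) by exact: inL2_dual_pair hdz hu.
have i9 : L1 0 T (fun t => <| dt iota T z t, Iuh t |>) by exact: inL2_dual_pair hdz hI.
have i10 : L1 0 T (fun t => L2dot (q t) (iota (u t))) by exact: L2dot_iota_L1 hq hu.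
have i11 : L1 0 T (fun t => L2dot (q t) (iota (Iuh t))) by exact: L2dot_iota_L1 hq hI.
have ibpu := gelfand_integration_by_parts T0 ciota pairu pairz.
have ibpI := gelfand_integration_by_parts T0 ciota pairI pairz.
have {}eqP : Int (fun t => <| dt iota T u t, z t |>) 0 T + Int (fun t => B (u t) (z t)) 0 T
    + Int (fun t => <| N (u t), z t |>) 0 T = Int (fun t => <| f t, z t |>) 0 T.
  by rewrite -(IntD i1 i2) -(IntD (L1D i1 i2) i3); exact: eqP.
have {}eqD : - Int (fun t => <| dt iota T z t, u t |>) 0 T
    + Int (fun t => <| dt iota T z t, Iuh t |>) 0 T
    + (Int (fun t => B (u t) (z t)) 0 T - Int (fun t => B (Iuh t) (z t)) 0 T)
    + (Int (fun t => <| N (u t), z t |>) 0 T - Int (fun t => <| N (Iuh t), z t |>) 0 T)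
    = Int (fun t => L2dot (q t) (iota (u t))) 0 T - Int (fun t => L2dot (q t) (iota (Iuh t))) 0 T.
  rewrite (addrC (- Int (fun t => <| dt iota T z t, u t |>) 0 T)) -(IntB i9 i8) -(IntB i2 i6) -(IntB i3 i7).
  rewrite -(IntD (L1B i9 i8) (L1B i2 i6)) -(IntD (L1D (L1B i9 i8) (L1B i2 i6)) (L1B i3 i7)).
  rewrite -(IntB i10 i11).
  transitivity (Int (fun t => L2dot (q t) (iota (u t - Iuh t))) 0 T); last first.
    by apply: eq_Int => t _; rewrite linearB L2dotBr.
  rewrite -[RHS]eqD; apply: eq_Int => t _.
  rewrite (mean_value_increment _ _ _ hN); congr (_ + _ + _).
    by rewrite dual_pairBr !dual_pairNl opprK addrC.
  by have [_ symB _ _] := hB; rewrite (symB (z t)) elliptic_Bl.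
have -> : Int (fun t => residual iota T B N f Iuh t (z t)) 0 T =
    Int (fun t => <| f t, z t |>) 0 T - Int (fun t => <| dt iota T Iuh t, z t |>) 0 T
    - Int (fun t => B (Iuh t) (z t)) 0 T - Int (fun t => <| N (Iuh t), z t |>) 0 T.
  by rewrite -(IntB i4 i5) -(IntB (L1B i4 i5) i6) -(IntB (L1B (L1B i4 i5) i6) i7).
rewrite /QoI (value_atE T0 ru TT) (value_atE T0 rI TT) (value_atE T0 rz OT).
have [t00 _ _] := htm.
have I0 : Iuh 0 = uh 0%N by rewrite -[X in interp _ _ _ X]t00 (interp_node htm).
rewrite I0 in ibpI.
(* The traces uc 0 = u0 and zc T = qbar enter here; the end values at T become the first part of the
   quantity of interest. *)
rewrite ruc0 zcT in ibpu; rewrite zcT in ibpI.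
rewrite L2dotBl (L2dotC qbar) (L2dotC qbar).
exact: goal_arith eqP eqD ibpu ibpI.
Qed.


Lemma Int_cells (g : R -> R) : L1 0 T g ->
  Int g 0 T = \sum_(0 <= k < Nt) Int g (tm k) (tm k.+1).
Proof.
move=> lg; have [t0 tN lt_tm] := htm.
suff H n : (n <= Nt)%N -> Int g 0 (tm n) = \sum_(0 <= k < n) Int g (tm k) (tm k.+1).
  by rewrite -(H Nt (leqnn _)) tN.
elim: n => [_|n IH nN]; first by rewrite big_geq// t0 Int_point.
rewrite big_nat_recr//= -IH ?(ltnW nN)//; apply: Int_split.
- exact: grid_ge0 htm _ (ltnW nN).
- exact/ltW/lt_tm.
- exact: integrable_itvS (lexx 0) (grid_leT htm nN) lg.
Qed.

Context (Nc : V -> topdual V) (Ne : L2 nu -> topdual (L2 nu)) (fs : nat -> L2 nu).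

(** For any fixed y, the parts of [residual] tested with y are returned by the other three
    residuals: r_tau compensates B and N, r_f the source, and the time derivative integrates to the
    difference quotient in r_h. *)
Lemma cell_residual (z : R -> V) (y : V) k : inL2 T z -> (k < Nt)%N ->
  step tm k.+1 * res_h iota B Nc Ne tm fs uh k.+1 y +
  Int (fun t => residual iota T B N f Iuh t (z t - y) +
    res_tau iota B N Nc Ne tm Nt uh k.+1 t y) (tm k) (tm k.+1) +
  Int (fun t => res_f iota f fs k.+1 t y) (tm k) (tm k.+1) =
  Int (fun t => residual iota T B N f Iuh t (z t)) (tm k) (tm k.+1).
Proof.
move=> hz kN; have [_ _ lt_tm] := htm; have kN1 := ltnW kN.
have k0 := grid_ge0 htm kN1; have kT := grid_leT htm kN; have kk := ltW (lt_tm _ kN).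
have [hI hdI wI rI] := interp_dt_weak_pair; have hy := inL2_cst T y.
have lz : L1 (tm k) (tm k.+1) (fun t => residual iota T B N f Iuh t (z t)).
  exact: integrable_itvS k0 kT (residual_L1 hz).
have ld : L1 (tm k) (tm k.+1) (fun t => <| dt iota T Iuh t, y |>).
  exact: integrable_itvS k0 kT (inL2_dual_pair hdI hy).
have lf : L1 (tm k) (tm k.+1) (fun t => <| f t, y |>).
  exact: integrable_itvS k0 kT (inL2_dual_pair hf hy).
pose C := B (uh k.+1) y + <| Nc (uh k.+1), y |> - <| Ne (iota (uh k)), iota y |>.
pose g := L2dot (fs k.+1) (iota y).
have lC c : L1 (tm k) (tm k.+1) (fun=> c) by exact: cst_integrable.
have -> : Int (fun t => residual iota T B N f Iuh t (z t - y) +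
    res_tau iota B N Nc Ne tm Nt uh k.+1 t y) (tm k) (tm k.+1) =
    Int (fun t => residual iota T B N f Iuh t (z t)) (tm k) (tm k.+1) +
    (Int (fun t => <| dt iota T Iuh t, y |>) (tm k) (tm k.+1) -
     Int (fun t => <| f t, y |>) (tm k) (tm k.+1) + C * step tm k.+1).
  rewrite -(Int_cst C kk) -(IntB ld lf) -(IntD (L1B ld lf) (lC C)).
  rewrite -(IntD lz (L1D (L1B ld lf) (lC C))); apply: eq_Int => t _.
  rewrite /residual /res_tau !dual_pairBr elliptic_Br /= -/C.
  exact: residual_arith.
have -> : Int (fun t => res_f iota f fs k.+1 t y) (tm k) (tm k.+1) =
    Int (fun t => <| f t, y |>) (tm k) (tm k.+1) - g * step tm k.+1.
  by rewrite -(Int_cst g kk) -(IntB lf (lC g)).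
(* Only the integral of <dt Iuh, y> over the cell occurs, and it is an increment of nodal values
   whichever weak derivative [dt] selects. *)
rewrite -(weak_time_derivative_increment T0 ciota y hI hdI wI rI k0 kk kT).
rewrite (interp_node htm _ kN T0) (interp_node htm _ kN1 T0).
have st0 : step tm k.+1 != 0 by exact/lt0r_neq0/(step_gt0 htm kN).
rewrite /res_h /= L2dotZl -/g; move: (L2dot (iota (uh k.+1) - iota (uh k)) (iota y)) => D.
have -> : g - (step tm k.+1)^-1 * D - B (uh k.+1) y - <| Nc (uh k.+1), y |> +
    <| Ne (iota (uh k)), iota y |> = g - (step tm k.+1)^-1 * D - C.
  by rewrite /C; ring.
exact: cell_arith.
Qed.

End error_representation.

Theorem theorem3p6 (R : realType)
  (d : nat) (hd : (1 <= d <= 3)%N)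
  (Om : set (Rn R d)) (mOm : measurable Om) (bOm : edist_bounded Om)
  (T : R) (hT : 0 < T)
  (V : completeNormedModType R) (hV : hilbert V)
  (iota : {linear V -> L2_on mOm})
  (hiota : gelfand_triple iota)
  (B : V -> V -> R) (hB : elliptic_form iota B)
  (N Nc : V -> topdual V)
  (Ne : L2_on mOm -> topdual (L2_on mOm))
  (hN : smooth_form N) (hNc : smooth_form Nc)
  (hNe : smooth_form Ne) (bNe : bounded_form Ne)
  (hsplit : forall u v, <| N u, v |> = <| Nc u, v |> - <| Ne (iota u), iota v |>)
  (u0 : L2_on mOm)
  (f : R -> topdual V) (hf : inL2 T f)
  (qbar : L2_on mOm)
  (q : R -> L2_on mOm) (hq : inL2 T q)
  (Nt : nat) (tm : nat -> R) (htm : time_grid tm Nt T)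
  (fs : nat -> L2_on mOm)
  (hfs : source_samples iota T f tm Nt fs)
  (qs : nat -> L2_on mOm)
  (hqs : dual_samples T q tm Nt qs)
  (p : nat) (sigma : R) (K : nat -> seq (set (Rn R d)))
  (hK : forall k, (k <= Nt)%N -> mesh Om sigma (K k))
  (u : R -> V) (hu : primal iota T B N u0 f u)
  (u0t : L2_on mOm) (ut : nat -> V)
  (hut : primal_tau iota B Nc Ne u0 tm Nt fs u0t ut)
  (uh : nat -> V)
  (huh : primal_tauh iota B Nc Ne u0 tm Nt fs
           (fun k => fe_space iota (K k) p) uh)
  (z : R -> V)
  (hz : dual_problem iota T B N qbar q u (interp tm Nt uh) z)
  (zt : nat -> V)
  (hzt : dual_tau iota B Nc Ne qbar tm Nt qs u0t ut uh zt)
  (vh : nat -> V)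
  (hvh : forall k, (k <= Nt)%N -> fe_space iota (K k) p (vh k)) :
  QoI iota T qbar q u - QoI iota T qbar q (interp tm Nt uh) =
    R_s iota B Nc Ne u0 tm Nt fs uh zt vh
    + R_t iota T B N Nc Ne u0 f tm Nt uh z zt
    + Osc iota f tm Nt fs zt.
Proof.
have [_ ciota _] := hiota; have [[[hz2 _] _] _] := hz.
have [_ orth0 orth] := huh.
rewrite (goal_error_residual hT ciota htm hB hN hf hq hu hz).
rewrite (Int_cells htm (residual_L1 hT ciota htm hB hN uh hf hz2)).
have galerkin0 : L2dot (u0 - iota (uh 0%N)) (iota (vh 0%N)) = 0.
  by rewrite L2dotBl (orth0 _ (hvh 0%N (leq0n _))) subrr.
have galerkin k : (k < Nt)%N -> res_h iota B Nc Ne tm fs uh k.+1 (zt k.+1 - vh k.+1) =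
    res_h iota B Nc Ne tm fs uh k.+1 (zt k.+1).
  move=> kN; have := orth k kN _ (hvh k.+1 kN).
  rewrite /res_h /= (linearB iota (zt k.+1)) !L2dotBr !dual_pairBr (elliptic_Br hB).
  exact: galerkin_arith.
(* The sum over k = 1, ..., Nt in [R_s] is shifted to the cells 0, ..., Nt - 1 of the other sums. *)
rewrite /R_s /R_t /Osc big_add1 /=.
have -> : \sum_(0 <= k < Nt) step tm k.+1 *
      res_h iota B Nc Ne tm fs uh k.+1 (zt k.+1 - vh k.+1) =
    \sum_(0 <= k < Nt) step tm k.+1 * res_h iota B Nc Ne tm fs uh k.+1 (zt k.+1).
  by apply: eq_big_nat => k /andP[_ kN]; rewrite galerkin.
have -> : \sum_(0 <= k < Nt) \int[lebesgue_measure]_(t in `[tm k, tm k.+1])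
      residual iota T B N f (interp tm Nt uh) t (z t) =
    \sum_(0 <= k < Nt) step tm k.+1 * res_h iota B Nc Ne tm fs uh k.+1 (zt k.+1) +
    \sum_(0 <= k < Nt) \int[lebesgue_measure]_(t in `[tm k, tm k.+1])
      (residual iota T B N f (interp tm Nt uh) t (z t - zt k.+1) +
       res_tau iota B N Nc Ne tm Nt uh k.+1 t (zt k.+1)) +
    \sum_(0 <= k < Nt) \int[lebesgue_measure]_(t in `[tm k, tm k.+1])
      res_f iota f fs k.+1 t (zt k.+1).
  rewrite -!big_split; apply: eq_big_nat => k /andP[_ kN] /=.
  by rewrite (cell_residual hT ciota htm hB hN uh hf Nc Ne fs (zt k.+1) hz2 kN).
(* The product of u0 - uh 0 with zt 0 occurs in [R_s] and, with opposite sign, in [R_t]; their sum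
   is the product with z(0). *)
rewrite !L2dotBr galerkin0 subr0; exact: final_arith.
Qed.
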